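(* Let $\lambda>0$ and $x>0$ be constants. A function $\overline Q$ is the optimal solution to the problem $\sup_{Q\in\mathscr Q^+}\mathcal L(Q)$ if and only if it is a continuous increasing (i.e. non-decreasing) function on $(0,1)$ and satisfies, together with a Lipschitz continuous function $\overline H:[0,1]\to\mathbb R$, the ODE system \[ \begin{cases} \min\big\{\overline Q'(p),\ \overline H(p)-\lambda\eta(p)\big\}=0,\quad \overline H'(p)=\dfrac{\partial V}{\partial x}(\overline Q(p),p), & \text{for a.e. } p\in(0,1);\\[2mm] \overline H(1)=0,\qquad \overline Q(p)=0 \ \text{ for } p\in(0,\bar p_\lambda]. \end{cases} \]
   Context: Quantiles. For a distribution function $G$, its quantile is $Q_G(p)=\inf\{z\in\mathbb R: G(z)>p\}$, $p\in(0,1)$ (right-continuous inverse), extended by limits $Q_G(0)=\lim_{p\downarrow0}Q_G(p)$, $Q_G(1)=\lim_{p\uparrow1}Q_G(p)$; for a random variable $Y$ with distribution function $F_Y$, $Q_Y:=Q_{F_Y}$. $\mathscr Q^+$ is the set of all right-continuous non-decreasing functions $Q:(0,1)\to[0,\infty)$. Utility and claim. $u(x)=-\int_0^\infty e^{-\gamma x}\,dF(\gamma)$, $x\in\mathbb R$, where $F$ is a non-zero distribution function ($dF$ is a non-zero finite Borel measure, not necessarily of mass one) supported on a compact subset of $(0,\infty)$. $\vartheta$ is a random variable (the intractable claim) whose quantile $Q_\vartheta$ is Lipschitz continuous and differentiable on $[0,1]$ (so $\vartheta$ is bounded). For a fixed $\alpha\in[0,1]$, \[V(x,p)=(1-\alpha)u(x+Q_\vartheta(p))+\alpha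 u(x+Q_\vartheta(1-p)),\quad x\in\mathbb R,\ p\in(0,1).\] Pricing kernel. On a probability space with an $m$-dimensional standard Brownian motion $W$ and its augmented filtration $\{\mathcal F_t\}$, fix $T>0$ and progressively measurable $r$ (interest rate, bounded below) and $\theta$ (market price of risk, not identically zero, $\int_0^T|\theta(t)|^2dt<\infty$ a.s.) such that $Z(t)=\exp(-\int_0^t\theta(s)^\top dW(s)-\frac12\int_0^t|\theta(s)|^2ds)$ is a true martingale on $[0,T]$. Then $\rho=\exp\big(-\int_0^T(r(s)+\frac12|\theta(s)|^2)ds-\int_0^T\theta(s)^\top dW(s)\big)$; so $\rho>0$ and $\mathbb E[\rho]<\infty$. It is assumed that $Q_\rho$ is continuously differentiable, $Q_\rho(0)=0$ and $Q_\rho(1)=+\infty$. Lagrangian. $\mathcal L(Q)=\int_0^1\big[V(Q(p),p)-\lambda Q(p)Q_\rho(1-p)\big]dp+\lambda x$ for $Q\in\mathscr Q^+$. An optimal solution is a $\overline Q\in\mathscr Q^+$ attaining $\sup_{Q\in\mathscr Q^+}\mathcal L(Q)$; there is at most one. Other notation. $\eta(p)=-\int_p^1Q_\rho(1-s)\,ds$, $p\in[0,1]$; $\bar p_\lambda=\sup\{p\in(0,1):\lambda Q_\rho(1-p)\ge u'(Q_\vartheta(0))\}$, which lies in $(0,1)$.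
   Formalization: In the ODE characterization, the function Q̄ is additionally required to be absolutely continuous on compact subintervals of (0,1); without this, singular (Cantor-like) continuous increasing functions can satisfy the a.e. system without being optimal. *)

(* Defs.v *)
From HB Require Import structures.
From mathcomp Require Import all_boot all_order all_algebra.
From mathcomp Require Import all_classical all_reals all_analysis.

Set Implicit Arguments.
Unset Strict Implicit.
Unset Printing Implicit Defensive.

Import Order.TTheory GRing.Theory Num.Theory.
Import numFieldNormedType.Exports.

Local Open Scope classical_set_scope.
Local Open Scope ring_scope.

Section real_functions.
Context {R : realType}.
Implicit Types (f : R -> R) (a b : R) (A : set R).

(* Differentiability relative to A: one-sided at the end points when A is a
   closed interval. *)
Definition derivable_within A f : Prop :=
  forall p, A p ->
    cvg ((f q - f p) / (q - p) @[q --> within A p^']).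

Definition continuously_derivable_on A f : Prop :=
  (forall p, A p -> derivable f p 1) /\ {within A, continuous (derive1 f)}.

Definition absolutely_continuous a b f : Prop :=
  forall e : R, 0 < e -> exists2 d : R, 0 < d &
    forall (n : nat) (J : 'I_n -> R * R),
      (forall i, a <= (J i).1 /\ (J i).1 <= (J i).2 /\ (J i).2 <= b) ->
      trivIset [set: 'I_n] (fun i => `](J i).1, (J i).2[%classic) ->
      \sum_(i < n) ((J i).2 - (J i).1) < d ->
      \sum_(i < n) `|f (J i).2 - f (J i).1| < e.

End real_functions.

Section quantiles.
Context {R : realType}.

Definition quantile_oo (G : R -> \bar R) (p : R) : R :=
  inf [set z : R | (p%:E < G z)%E].

(* The quantile on [0, 1]; the values at 0 and 1 are one-sided limits and may be
   infinite. *)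
Definition quantile (G : R -> \bar R) (p : R) : \bar R :=
  if p <= 0 then lim ((quantile_oo G q)%:E @[q --> (0 : R)^'+])
  else if 1 <= p then lim ((quantile_oo G q)%:E @[q --> (1 : R)^'-])
  else (quantile_oo G p)%:E.

Context d (Omega : measurableType d) (P : probability Omega R).

Definition quantile_rv (Y : {RV P >-> R}) (p : R) : \bar R :=
  quantile (cdf Y) p.

(* Real-valued version, with the junk value 0 where the quantile is infinite. *)
Definition rquantile (Y : {RV P >-> R}) (p : R) : R := fine (quantile_rv Y p).

End quantiles.

Section market.
Context {R : realType} d (Omega : measurableType d) (P : probability Omega R).
Context (m : nat).

Local Notation mu := (@lebesgue_measure R).

Definition natural_gen (W : 'I_m -> R -> Omega -> R) (t : R)
    : set (set Omega) :=
  [set A | exists i : 'I_m, exists s : R, exists B : set (measurableTypeR R),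
     [/\ 0 <= s <= t, measurable B & A = W i s @^-1` B]].

(* Generators of the augmented filtration at time t. The null sets are taken
   among the events of Omega, so that no completeness of P is presupposed. *)
Definition augmented_gen (W : 'I_m -> R -> Omega -> R) (t : R)
    : set (set Omega) :=
  natural_gen W t `|` [set A | measurable A /\ P A = 0%E].

Definition brownian_motion (T : R) (W : 'I_m -> R -> Omega -> R) : Prop :=
  [/\ forall i t, 0 <= t <= T -> measurable_fun setT (W i t),
      {ae P, forall w, forall i, W i 0 w = 0},
      {ae P, forall w, forall i, {within `[0, T], continuous (W i ^~ w)}} &
      (* W t - W s is independent of the past and has law N(0, (t - s) Id) *)
      forall s t, 0 <= s -> s < t -> t <= T ->
      forall (A : set Omega) (B : 'I_m -> set (measurableTypeR R)),
        <<s natural_gen W s >> A -> (forall i, measurable (B i)) ->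
        P (A `&` [set w | forall i, B i (W i t w - W i s w)]) =
        (P A * \prod_(i < m) normal_prob 0 (Num.sqrt (t - s)) (B i))%E].

Section processes.
(* Ft t generates the sigma-algebra of time t. *)
Variables (T : R) (Ft : R -> set (set Omega)).

Definition progressive (X : R -> Omega -> R) : Prop :=
  forall t, 0 <= t <= T ->
    measurable_fun (`[0, t] `*` setT)
      (fun sw : measurableTypeR R * g_sigma_algebraType (Ft t) =>
         X sw.1 sw.2).

Definition adapted (X : R -> Omega -> R) : Prop :=
  forall t, 0 <= t <= T ->
    measurable_fun setT (X t : g_sigma_algebraType (Ft t) -> R).

Definition martingale (X : R -> Omega -> R) : Prop :=
  [/\ adapted X,
      forall t, 0 <= t <= T -> P.-integrable setT (EFin \o X t) &
      forall s t, 0 <= s -> s <= t -> t <= T ->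
        forall A : set Omega, <<s Ft s >> A ->
          (\int[P]_(w in A) (X t w)%:E = \int[P]_(w in A) (X s w)%:E)%E].

(* A process equal to sp_val k on ]sp_time k, sp_time k.+1], k < sp_size. *)
Record simple_process := SimpleProcess {
  sp_size : nat;
  sp_time : nat -> R;
  sp_val : nat -> 'I_m -> Omega -> R }.

Definition is_simple (S : simple_process) : Prop :=
  [/\ forall k, (k <= sp_size S)%N -> 0 <= sp_time S k <= T,
      forall k, (k < sp_size S)%N -> sp_time S k <= sp_time S k.+1 &
      forall k i, (k < sp_size S)%N ->
        measurable_fun setT
          (sp_val S k i : g_sigma_algebraType (Ft (sp_time S k)) -> R) /\
        exists M : R, forall w, `|sp_val S k i w| <= M].

Definition sp_eval (S : simple_process) (i : 'I_m) (t : R) (w : Omega) : R :=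
  \sum_(k < sp_size S)
    sp_val S k i w * \1_(`]sp_time S k, sp_time S k.+1] : set R) t.

Definition sp_integral (W : 'I_m -> R -> Omega -> R) (S : simple_process)
    (t : R) (w : Omega) : R :=
  \sum_(k < sp_size S) \sum_(i < m)
    sp_val S k i w *
    (W i (Num.min (sp_time S k.+1) t) w - W i (Num.min (sp_time S k) t) w).

Definition cvg_proba0 (X : nat -> Omega -> \bar R) : Prop :=
  forall e : R, 0 < e -> P [set w | (e%:E <= `|X n w|)%E] @[n --> \oo] --> 0%E.

(* I is (a version of) the Ito integral process t |-> int_0^t theta^T dW, as
   the limit in probability of integrals of simple processes. *)
Definition ito_integral (W theta : 'I_m -> R -> Omega -> R)
    (I : R -> Omega -> R) : Prop :=
  [/\ adapted I,
      {ae P, forall w, {within `[0, T], continuous (I ^~ w)}} &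
      exists S : nat -> simple_process,
        [/\ forall n, is_simple (S n),
            cvg_proba0 (fun n w => (\int[mu]_(s in `[0%R, T])
              (\sum_(i < m) (sp_eval (S n) i s w - theta i s w) ^+ 2)%:E)%E) &
            forall t, 0 <= t <= T ->
              cvg_proba0 (fun n w => (sp_integral W (S n) t w - I t w)%:E)]].

End processes.

Definition sqnorm (theta : 'I_m -> R -> Omega -> R) (s : R) (w : Omega) : R :=
  \sum_(i < m) theta i s w ^+ 2.

Definition density_process (theta : 'I_m -> R -> Omega -> R)
    (I : R -> Omega -> R) (t : R) (w : Omega) : R :=
  expR (- I t w - 2^-1 * \int[mu]_(s in `[0, t]) sqnorm theta s w).

(* rho is only determined up to a null set, as I is. The almost sure
   integrability of r is what makes rho positive: a lower bound on r alone
   allows the integral of r to be +oo. *)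
Record pricing_kernel (T : R) (W : 'I_m -> R -> Omega -> R)
    (r : R -> Omega -> R) (theta : 'I_m -> R -> Omega -> R)
    (I : R -> Omega -> R) (rho : {RV P >-> R}) : Prop := PricingKernel {
  pk_horizon : 0 < T;
  pk_brownian : brownian_motion T W;
  pk_r_progressive : progressive T (augmented_gen W) r;
  pk_r_bounded_below :
    exists c : R, forall t w, 0 <= t <= T -> c <= r t w;
  pk_r_integrable :
    {ae P, forall w, mu.-integrable `[0, T] (EFin \o (r ^~ w))};
  pk_theta_progressive :
    forall i, progressive T (augmented_gen W) (theta i);
  pk_theta_neq0 :
    exists i t w, 0 <= t <= T /\ theta i t w != 0;
  pk_theta_sqr_integrable :
    {ae P, forall w,
      (\int[mu]_(s in `[0%R, T]) (sqnorm theta s w)%:E < +oo)%E};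
  pk_ito : ito_integral T (augmented_gen W) W theta I;
  pk_martingale : martingale T (augmented_gen W) (density_process theta I);
  pk_rho :
    {ae P, forall w, rho w =
      expR (- \int[mu]_(s in `[0, T]) (r s w + 2^-1 * sqnorm theta s w)
            - I T w)} }.

End market.

Section problem.
Context {R : realType}.
Local Notation mu := (@lebesgue_measure R).

Definition Qplus : set (R -> R) :=
  [set Q : R -> R |
    [/\ forall p : R, 0 < p < 1 -> 0 <= Q p,
        forall p q : R, 0 < p -> p <= q -> q < 1 -> Q p <= Q q &
        forall p : R, 0 < p < 1 -> Q q @[q --> p^'+] --> Q p]].

Definition compactly_supported (F : cumulative R R) : Prop :=
  exists K : set R, [/\ compact K, K `<=` `]0, +oo[ &
    lebesgue_stieltjes_measure F (~` K) = 0%E].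

Definition utility (F : cumulative R R) (x : R) : R :=
  - \int[lebesgue_stieltjes_measure F]_(g in `[0, +oo[) expR (- g * x).

Context d (Omega : measurableType d) (P : probability Omega R).
Variables (F : cumulative R R) (alpha : R) (rho vartheta : {RV P >-> R}).

Local Notation u := (utility F).
Local Notation Qrho := (rquantile rho).
Local Notation Qtheta := (rquantile vartheta).

Definition V (x p : R) : R :=
  (1 - alpha) * u (x + Qtheta p) + alpha * u (x + Qtheta (1 - p)).

Definition dVdx (x p : R) : R := derive1 (V ^~ p) x.

(* The integrand is bounded above on Qplus, and the integral may be -oo. *)
Definition lagrangian (lambda x : R) (Q : R -> R) : \bar R :=
  (\int[mu]_(p in `]0%R, 1%R[)
     (V (Q p) p - lambda * Q p * Qrho (1 - p))%:E + (lambda * x)%:E)%E.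

Definition optimal (lambda x : R) (Q : R -> R) : Prop :=
  Qplus Q /\
  lagrangian lambda x Q = ereal_sup [set lagrangian lambda x Q' | Q' in Qplus].

Definition eta (p : R) : R := - \int[mu]_(s in `[p, 1]) Qrho (1 - s).

Definition pbar (lambda : R) : R :=
  sup [set p : R | 0 < p < 1 /\ derive1 u (Qtheta 0) <= lambda * Qrho (1 - p)].

(* The differential equations are understood in the sense of Caratheodory,
   i.e., for locally absolutely continuous functions: if Q were only continuous
   and monotone, the a.e. derivative of Q would not control Q (a singular Q that
   grows fast enough at 1 would be a solution without being optimal). *)
Definition ode_solution (lambda : R) (Q H : R -> R) : Prop :=
  [/\ forall a b, 0 < a -> a <= b -> b < 1 -> absolutely_continuous a b Q,
      [lipschitz H p | p in `[0, 1]],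
      {ae mu, forall p, 0 < p < 1 ->
        [/\ derivable Q p 1,
            Num.min (derive1 Q p) (H p - lambda * eta p) = 0 &
            is_derive p 1 H (dVdx (Q p) p)]},
      H 1 = 0 &
      forall p, 0 < p <= pbar lambda -> Q p = 0].

End problem.

(* Main.v *)
(* Write v = dV/dx, k(p) = lambda Q_rho(1 - p) and J(Q) = int (k Q - V(Q, .)), so
   that the problem is to minimise the convex functional J over Qplus, and put
   Phi(p) = H(p) - lambda eta(p) = int_p^1 (k - v(Q, .)).

   Sufficiency. By concavity of V, the density of J(Q) - J(Q') is at most
   Phi' (Q' - Q). On [a, b] with a <= pbar, Phi' Q = (Phi Q)' because Phi Q' = 0,
   so its integral is Phi(b) Q(b) >= 0; and Phi >= 0 with Q' nondecreasing bounds
   the integral of Phi' Q' by Phi(b) Q'(b) <= Q'(b) int_b^1 k, which is at most the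
   part of J(Q') on [b, 1]. Hence J(Q) restricted to [a, b] is at most J(Q'), and no
   limit of boundary terms is needed.

   Necessity. Perturbing Q by the indicator of [p, 1) gives Phi >= 0; flattening Q
   between c and e shows that Q is constant where Phi > 0. A jump of Q would have
   to occur at a zero of Phi, where the one-sided slopes of Phi contradict the
   strict monotonicity of v. At the zeros of Phi one then has v(Q, p) = k(p), and
   as v is strongly decreasing in Q and k is locally Lipschitz, so is Q, which is
   therefore differentiable almost everywhere. *)

Require Import Defs.
From HB Require Import structures.
From mathcomp Require Import all_boot all_order all_algebra.
From mathcomp Require Import all_classical all_reals all_analysis.
From mathcomp Require Import lra ring measurable_realfun.

Import Order.TTheory GRing.Theory Num.Theory.
Import numFieldNormedType.Exports.

Local Open Scope classical_set_scope.
Local Open Scope ring_scope.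

(** * Absolutely continuous functions and primitives *)

(** The price [k] may blow up at 0 and [Q] may be unbounded near 1, so the identities are proved on
    compact subintervals of the open unit interval. The sign convention makes this harmless: V is
    nonpositive and [k] nonnegative, so the cost density is nonnegative, the cost is defined in
    [0, +oo] for every member of [Qplus], and monotone convergence recovers the whole interval. In
    the necessity part the regularity of [Q] is earned in stages. The sign of Phi and the constancy
    of [Q] where Phi is positive rest on monotonicity and right continuity alone; only once jumps
    are excluded is Phi differentiable, which turns a one-sided inequality at its zeros into v = k.
    The resulting Lipschitz bound is local: marginal utility flattens at infinity, so its strong
    decrease depends on a bound for [Q], and [k] is controlled only away from the end points. The
    vanishing of [Q] up to pbar comes from a separate comparison: the price there is at least the
    largest marginal utility, so replacing [Q] by zero is strictly cheaper unless [Q] already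
    vanishes. *)

Section affine_approximation.
Context {R : realType}.
Implicit Types (f : R -> R) (p l : R).

(** A quotient-free form: it passes at once between functions with equal or proportional increments,
    and it bounds the increments on both sides of [p] together. *)
Lemma is_derive1_approxP f p l :
  is_derive p 1 f l <->
  forall e, 0 < e ->
    exists2 r, 0 < r &
      forall y, `|y - p| < r -> `|f y - f p - l * (y - p)| <= e * `|y - p|.
Proof.
split=> [[df dl] e e0|H].
- have : h^-1 *: ((f \o shift p) (h *: 1) - f p) @[h --> (0:R)^'] --> l.
    by rewrite -dl; exact: df.
  move/cvgrPdist_le => /(_ e e0).
  rewrite near_withinE => /nbhs_ballP[r /= r0 Hr].
  exists r => // y yr; have [->|yp] := eqVneq y p.
    by rewrite !subrr mulr0 subr0 normr0 mulr0.
  have := Hr (y - p); rewrite /ball/= sub0r normrN => /(_ yr).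
  rewrite subr_eq0 => /(_ yp); rewrite /GRing.scale/= mulr1 subrK => H.
  have -> : f y - f p - l * (y - p) =
      - ((l - (y - p)^-1 * (f y - f p)) * (y - p)) by field; rewrite subr_eq0.
  by rewrite normrN normrM ler_wpM2r.
- have cv : h^-1 *: ((f \o shift p) (h *: 1) - f p) @[h --> (0:R)^'] --> l.
    apply/cvgrPdist_le => e e0; have [r r0 Hr] := H _ e0.
    rewrite near_withinE; apply/nbhs_ballP; exists r => //= h.
    rewrite /ball/= sub0r normrN => hr h0.
    rewrite /GRing.scale/= mulr1.
    have := Hr (h + p); rewrite addrK => /(_ hr) => {}Hr.
    have -> : l - h^-1 * (f (h + p) - f p) = - (h^-1 * (f (h + p) - f p - l * h)).
      by field.
    by rewrite normrN normrM normfV mulrC ler_pdivrMr ?normr_gt0.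
  split; first by apply/cvg_ex; exists l.
  exact/cvg_lim.
Qed.

End affine_approximation.

(** * Absolutely continuous functions with zero derivative *)

Section zero_derivative.
Set Implicit Arguments.
Unset Strict Implicit.
Context {R : realType}.
Local Notation mu := (@lebesgue_measure R).

(** The order by index makes the open intervals disjoint and lets a new interval be appended on the
    right. *)
Let chain (U : set R) (a t : R) n (J : nat -> R * R) :=
  (forall i, (i < n)%N -> [/\ a <= (J i).1, (J i).1 <= (J i).2, (J i).2 <= t &
     `](J i).1, (J i).2[ `<=` U]) /\
  (forall i j, (i < j)%N -> (j < n)%N -> (J i).2 <= (J j).1).

Let chain_length (U : set R) a t n J : measurable U -> chain U a t n J ->
  ((\sum_(i < n) ((J i).2 - (J i).1))%:E <= mu U)%E.
Proof.
move=> mU [J1 J2].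
pose F i := `](J i).1, (J i).2[%classic.
have tF : trivIset `I_n F.
  apply/trivIsetP => i j /= ni nj ij.
  wlog : i j ni nj ij / (i < j)%N.
    move=> W; move: (ij); rewrite neq_ltn => /orP[|] h; first exact: W.
    by rewrite setIC; apply: W => //; rewrite eq_sym.
  move=> lij; rewrite -subset0 => x []; rewrite /F/= !in_itv/=.
  move=> /andP[_ h1] /andP[h2 _].
  by have := J2 _ _ lij nj; rewrite leNgt (lt_trans h2 h1).
rewrite -sumEFin.
rewrite (eq_bigr (fun i : 'I_n => mu (F i))); last first.
  move=> i _; rewrite /F lebesgue_measure_itv/= lte_fin.
  have [_ le12 _ _] := J1 _ (ltn_ord i).
  by case: ltP => // le21; rewrite (@le_anti _ _ (J i).1 (J i).2) ?le12// subrr.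
have mF : forall i, measurable (F i) by move=> i; exact: measurable_itv.
rewrite -(@measure_semi_additive_ord_I _ _ _ mu F n)//.
3: by apply: bigsetU_measurable => i _; exact: mF.
2: by move=> k _; exact: mF.
apply: (@le_measure _ _ _ mu); rewrite ?inE//; first by apply: bigsetU_measurable => i _; exact: mF.
move=> x; rewrite -bigcup_mkord => -[i /= ni Fx].
by have [_ _ _] := J1 _ ni; exact.
Qed.

(* Cousin's covering argument: near a point where the derivative vanishes the
   increment is bounded by e times the length, and the remaining null set is
   covered by an open set so small that absolute continuity controls it. *)
Lemma ac_derive0_eq (a b : R) (f : R -> R) : a <= b ->
  absolutely_continuous a b f ->
  {ae mu, forall p, a < p < b -> is_derive p 1 f 0} -> f a = f b.
Proof.
move=> ab acf [N [mN N0 subN]].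
(* The term [e * (b - a)] pays for the points with zero derivative, and the extra [e] for the
   variation over the small open set. *)
suff key e : 0 < e -> `|f b - f a| <= e * (b - a + 1).
  apply/eqP; rewrite eq_sym -subr_eq0 -normr_le0; apply/ler_addgt0Pr => e e0.
  have c0 : 0 < b - a + 1 by lra.
  have := key (e / (b - a + 1)); rewrite divr_gt0// => /(_ erefl) /le_trans; apply.
  by rewrite divfK ?gt_eqF// add0r.
move=> e0.
have [dlt dlt0 acd] := acf _ e0.
(* The end points join the exceptional set because the derivative is known only inside the
   interval. *)
pose D := N `|` ([set a] `|` [set b]).
have mD : measurable D by apply: measurableU => //; apply: measurableU.
have D0 : mu D = 0%E.
  rewrite /D measureU0//; first exact: measurableU.
  by rewrite measureU0//; exact: lebesgue_measure_set1.
have [U [oU DU UD]] : exists U : set R, [/\ open U, D `<=` U & (mu (U `\` D) < dlt%:E)%E].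
  by apply: lebesgue_regularity_outer => //; apply: (eq_ind_r (fun z => (z < +oo)%E) _ D0).
have mU : measurable U by exact: open_measurable.
have Ud : (mu U < dlt%:E)%E.
  rewrite -(setDKU DU) measureU0//.
  exact: measurableD.
have gauge c : a <= c <= b -> exists2 r, 0 < r &
    (ball c r `<=` U) \/ (forall y, `|y - c| < r -> `|f y - f c| <= e * `|y - c|).
  move=> /andP[ac cb].
  have [Dc|Dc] := pselect (D c).
    have /nbhs_ballP[r /= r0 rU] : nbhs c U by apply: open_nbhs_nbhs; split => //; exact: DU.
    by exists r => //; left.
  have acb : a < c < b.
    rewrite !lt_neqAle ac cb !andbT; apply/andP; split; apply/eqP => h; apply: Dc.
      by right; left; rewrite /= h.
    by right; right; rewrite /= h.
  have : is_derive c 1 f 0.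
    apply: contrapT => nd; apply: Dc; left; apply: subN => /= h; exact: nd (h acb).
  move/is_derive1_approxP => /(_ _ e0) [r r0 Hr]; exists r => //; right => y /Hr.
  by rewrite mul0r subr0.
(* [P t] says that [t] can be reached from [a]: the increment so far is paid by slope [e] and by the
   variation of [f] over a chain in [U]. *)
pose P t := exists n J, chain U a t n J /\
   `|f t - f a| <= e * (t - a) + \sum_(i < n) `|f (J i).2 - f (J i).1|.
have Pa : P a.
  exists 0%N, (fun _ => (a, a)); split; first by split.
  by rewrite big_ord0 !subrr mulr0 addr0 normr0.
(* The two points straddle [c], where the gauge is centred: either []t, y[] lies in [U] and extends
   the chain, or the increments from [t] to [c] and from [c] to [y] are both estimated at [c]. *)
have step c r t y : a <= c <= b ->
    (ball c r `<=` U) \/ (forall y, `|y - c| < r -> `|f y - f c| <= e * `|y - c|) ->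
    a <= t -> c - r < t -> t <= c -> c <= y -> y < c + r -> P t -> P y.
  move=> acb gc lat crt tc cy ycr [n [J [[J1 J2] Pt]]].
  have ty : t <= y by exact: le_trans tc cy.
  have sub : `|f y - f a| <= `|f y - f t| + `|f t - f a|.
    have -> : f y - f a = (f y - f t) + (f t - f a) by ring.
    exact: ler_normD.
  case: gc => [cU|cf].
    exists n.+1, (fun i => if (i < n)%N then J i else (t, y)); split.
      split.
        move=> i; rewrite ltnS leq_eqVlt => /orP[/eqP->|ni].
          rewrite ltnn/=; split => // x /=; rewrite in_itv/= => /andP[tx xy].
          by apply: cU; rewrite /ball/= ltr_distlC; apply/andP; split; lra.
        rewrite ni; have [? ? ? ?] := J1 _ ni; split => //; lra.
      move=> i j ij; rewrite ltnS leq_eqVlt => /orP[/eqP jn|nj].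
        by subst j; rewrite ij ltnn; have [] := J1 _ ij.
      by rewrite nj (ltn_trans ij nj); exact: J2.
    rewrite big_ord_recr/= ltnn/=.
    rewrite (eq_bigr (fun i : 'I_n => `|f (J i).2 - f (J i).1|)); last first.
      by move=> i _; rewrite ltn_ord.
    have : e * (t - a) <= e * (y - a) by rewrite ler_pM2l//; lra.
    lra.
  exists n, J; split.
    by split => // i ni; have [? ? ? ?] := J1 _ ni; split => //; lra.
  have yc : `|y - c| = y - c by rewrite ger0_norm// subr_ge0.
  have tc' : `|t - c| = - (t - c) by rewrite ler0_norm// subr_le0.
  have h1 : `|f y - f c| <= e * (y - c) by rewrite -yc; apply: cf; rewrite yc; lra.
  have h2 : `|f t - f c| <= e * - (t - c) by rewrite -tc'; apply: cf; rewrite tc'; lra.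
  have h3 : `|f y - f t| <= `|f y - f c| + `|f t - f c|.
    have -> : f y - f t = (f y - f c) - (f t - f c) by ring.
    exact: ler_normB.
  have : e * (y - a) = e * (y - c) + e * - (t - c) + e * (t - a) by ring.
  lra.
(* The gauge at the supremum of the reachable points reaches beyond it, so the supremum is [b] and
   is itself reachable. *)
have Pb : P b.
  pose S := [set t | a <= t <= b /\ P t].
  have Sa : S a by split => //; rewrite lexx.
  have hsS : has_sup S by split; [exists a|exists b => t [/andP[]]].
  pose c := sup S.
  have ac : a <= c by exact: sup_upper_bound hsS _ Sa.
  have cb : c <= b by apply: ge_sup; [exists a|move=> t [/andP[]]].
  have acb : a <= c <= b by rewrite ac cb.
  have [r r0 gr] := gauge _ acb.
  have [t [/andP[lat tb] Pt] crt] := sup_adherent r0 hsS.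
  have tc : t <= c by apply: sup_upper_bound hsS _ _; split => //; rewrite lat tb.
  have [lbc|ltcb] := leP b c.
    have <- : c = b by apply/eqP; rewrite eq_le cb lbc.
    by apply: (step c r t) => //; lra.
  pose y := Num.min b (c + r / 2).
  have cy : c < y by rewrite lt_min ltcb; lra.
  have yb : y <= b by rewrite ge_min lexx.
  have ycr : y < c + r by rewrite gt_min; apply/orP; right; lra.
  have Py : P y by apply: (step c r t) => //; exact: ltW.
  have : y <= c by apply: sup_upper_bound hsS _ _; split => //; rewrite yb andbT; lra.
  lra.
have [n [J [cJ Pfb]]] := Pb.
apply: (le_trans Pfb); rewrite [leRHS]mulrDr mulr1 lerD2l.
apply: ltW; apply: (acd n (fun i => J i)).
- by move=> i; have [? ? ? _] := cJ.1 _ (ltn_ord i); split => //; split.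
- apply/trivIsetP => i j _ _ ij.
  wlog : i j ij / (i < j)%N.
    move=> W; have : (i != j :> nat) by [].
    rewrite neq_ltn => /orP[|] h; first exact: W.
    by rewrite setIC; apply: W => //; rewrite eq_sym.
  move=> lij; rewrite -subset0 => x [] /=; rewrite !in_itv/=.
  move=> /andP[_ h1] /andP[h2 _].
  by have := cJ.2 _ _ lij (ltn_ord j); rewrite leNgt (lt_trans h2 h1).
- rewrite -lte_fin; apply: (@le_lt_trans _ _ (mu U)); last exact: Ud.
  exact: chain_length cJ.
Qed.

End zero_derivative.

Section absolutely_continuous_theory.
Context {R : realType}.
Set Implicit Arguments.
Unset Strict Implicit.
Implicit Types (f g : R -> R) (a b L M : R).

Lemma lipschitz_ac f a b L :
  (forall x y, a <= x -> x <= y -> y <= b -> `|f y - f x| <= L * (y - x)) ->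
  absolutely_continuous a b f.
Proof.
(* [L] may be zero or negative, hence the shifted constant as divisor. *)
move=> fL e e0; pose K := `|L| + 1.
have K0 : 0 < K by rewrite ltr_wpDl.
exists (e / K); first by rewrite divr_gt0.
move=> n J HJ _; rewrite ltr_pdivlMr// => sJ.
apply: le_lt_trans sJ; rewrite mulr_suml; apply: ler_sum => i _.
have [h1 [h2 h3]] := HJ i.
apply: le_trans (fL _ _ h1 h2 h3) _; rewrite mulrC ler_wpM2l ?subr_ge0//.
by rewrite /K (le_trans (ler_norm _))// lerDl.
Qed.

Lemma lipschitz_continuous_at f a b L p :
  (forall x y, a <= x -> x <= y -> y <= b -> `|f y - f x| <= L * (y - x)) ->
  a < p < b -> {for p, continuous f}.
Proof.
move=> fL /andP[ap pb]; apply/cvgrPdist_le => e e0.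
have L1 : 0 < `|L| + 1 by rewrite ltr_wpDl.
apply/nbhs_ballP; exists (Num.min (e / (`|L| + 1)) (Num.min (p - a) (b - p))) => /=.
  by rewrite !lt_min !subr_gt0 ap pb divr_gt0.
move=> x; rewrite /ball/= !lt_min => /and3P[h1 h2 h3].
have key s t : a <= s -> s <= t -> t <= b -> t - s <= e / (`|L| + 1) ->
    `|f t - f s| <= e.
  move=> ps st tp ts; apply: (le_trans (fL _ _ ps st tp)).
  apply: (@le_trans _ _ ((`|L| + 1) * (t - s))).
    by rewrite ler_wpM2r ?subr_ge0// (le_trans (ler_norm _))// lerDl.
  by rewrite mulrC -ler_pdivlMr.
have [px|/ltW xp] := leP p x.
  have px' : `|p - x| = x - p by rewrite distrC ger0_norm// subr_ge0.
  by rewrite px' in h1 h2 h3; rewrite distrC; apply: key; lra.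
have px' : `|p - x| = p - x by rewrite ger0_norm// subr_ge0.
by rewrite px' in h1 h2 h3; apply: key; lra.
Qed.

Lemma acB f g a b : absolutely_continuous a b f -> absolutely_continuous a b g ->
  absolutely_continuous a b (f \- g).
Proof.
move=> acf acg e e0; have e20 : 0 < e / 2 by rewrite divr_gt0.
have [d1 d10 Hf] := acf _ e20; have [d2 d20 Hg] := acg _ e20.
exists (Num.min d1 d2); first by rewrite lt_min d10.
move=> n J HJ tJ; rewrite lt_min => /andP[s1 s2].
have h1 := Hf n J HJ tJ s1; have h2 := Hg n J HJ tJ s2.
have /le_lt_trans : \sum_(i < n) `|(f \- g) (J i).2 - (f \- g) (J i).1| <=
   \sum_(i < n) `|f (J i).2 - f (J i).1| + \sum_(i < n) `|g (J i).2 - g (J i).1|.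
  rewrite -big_split/=; apply: ler_sum => i _.
  have -> : (f \- g) (J i).2 - (f \- g) (J i).1 =
    (f (J i).2 - f (J i).1) - (g (J i).2 - g (J i).1) by rewrite /=; ring.
  exact: ler_normB.
apply; lra.
Qed.

Lemma acM f g a b M : (forall x, a <= x <= b -> `|f x| <= M) ->
  (forall x, a <= x <= b -> `|g x| <= M) ->
  absolutely_continuous a b f -> absolutely_continuous a b g ->
  absolutely_continuous a b (f \* g).
Proof.
move=> fM gM acf acg e e0; pose K := `|M| + 1.
have K0 : 0 < K by rewrite ltr_wpDl.
have e20 : 0 < e / (2 * K) by rewrite divr_gt0// mulr_gt0.
have [d1 d10 Hf] := acf _ e20; have [d2 d20 Hg] := acg _ e20.
exists (Num.min d1 d2); first by rewrite lt_min d10.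
move=> n J HJ tJ; rewrite lt_min => /andP[s1 s2].
have h1 := Hf n J HJ tJ s1; have h2 := Hg n J HJ tJ s2.
have /le_lt_trans : \sum_(i < n) `|(f \* g) (J i).2 - (f \* g) (J i).1| <=
   K * (\sum_(i < n) `|f (J i).2 - f (J i).1| + \sum_(i < n) `|g (J i).2 - g (J i).1|).
  rewrite -big_split/= mulr_sumr; apply: ler_sum => i _.
  have [h3 [h4 h5]] := HJ i.
  have -> : f (J i).2 * g (J i).2 - f (J i).1 * g (J i).1 =
      (f (J i).2 - f (J i).1) * g (J i).2 + f (J i).1 * (g (J i).2 - g (J i).1) by ring.
  apply: le_trans (ler_normD _ _) _; rewrite !normrM mulrDr (mulrC K) lerD//.
    apply: ler_wpM2l => //; apply: (le_trans (gM _ _)); first by rewrite h5 andbT (le_trans h3).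
    by rewrite /K (le_trans (ler_norm _))// lerDl.
  apply: ler_wpM2r => //; apply: (le_trans (fM _ _)); first by rewrite h3 (le_trans h4).
  by rewrite /K (le_trans (ler_norm _))// lerDl.
apply; rewrite mulrC -ltr_pdivlMr//.
have : e / K = e / (2 * K) + e / (2 * K) by field; rewrite gt_eqF.
lra.
Qed.

End absolutely_continuous_theory.

Section real_integrable.
Context d {T : measurableType d} {R : realType} {mu : {measure set T -> \bar R}}.
Set Implicit Arguments.
Unset Strict Implicit.

Lemma integrable_addr (D : set T) (f g : T -> R) : measurable D ->
  mu.-integrable D (EFin \o f) -> mu.-integrable D (EFin \o g) ->
  mu.-integrable D (EFin \o (fun x => f x + g x)).
Proof. by move=> mD intf intg; have := integrableD mD intf intg. Qed.

Lemma integrable_subr (D : set T) (f g : T -> R) : measurable D ->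
  mu.-integrable D (EFin \o f) -> mu.-integrable D (EFin \o g) ->
  mu.-integrable D (EFin \o (fun x => f x - g x)).
Proof. by move=> mD intf intg; have := integrableB mD intf intg. Qed.

Lemma integrable_mulr (D : set T) (f : T -> R) (c : R) : measurable D ->
  mu.-integrable D (EFin \o f) -> mu.-integrable D (EFin \o (fun x => c * f x)).
Proof. by move=> mD intf; have := integrableZl mD c intf. Qed.

End real_integrable.

(** * Integrals over intervals and primitives *)

Section interval_integrals.
Context {R : realType}.
Set Implicit Arguments.
Unset Strict Implicit.
Local Notation mu := (@lebesgue_measure R).
Implicit Types (f g F : R -> R) (a b s t M : R).

Lemma ae_lebesgue_mono (P Q : R -> Prop) : (forall x, P x -> Q x) ->
  {ae mu, forall x, P x} -> {ae mu, forall x, Q x}.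
Proof. by move=> PQ; apply: filterS; first exact: (ae_filter_ringOfSetsType mu). Qed.

(** Monotonicity is asked on [D] only, since quantiles and members of [Qplus] are unconstrained
    outside the unit interval; the part of [D] above a level is again an interval. *)
Lemma interval_nondecreasing_measurable (D : set R) f : is_interval D ->
  (forall x y, D x -> D y -> x <= y -> f x <= f y) -> measurable_fun D f.
Proof.
move=> iD fnd mD.
apply: (measurability (@RGenCInfty.G R)) => //.
  exact: RGenCInfty.measurableE.
move=> /= _ [_] [r] -> <-.
apply: is_interval_measurable => x y /= [Dx fx] [Dy fy] z /andP[xz zy].
have Dz : D z by apply: (iD x y) => //; rewrite xz zy.
split => //; move: fx fy; rewrite /= !in_itv/= !andbT => fx fy.
by rewrite (le_trans fx)// fnd.
Qed.

Lemma itv_bounded_integrable f a b M : measurable_fun `[a, b] f ->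
  (forall x, a <= x <= b -> `|f x| <= M) -> mu.-integrable `[a, b] (EFin \o f).
Proof.
move=> mf fM; have fin : (mu `[a, b] < +oo)%E.
  by rewrite lebesgue_measure_itv/=; case: ifP => // _; rewrite -EFinD ltry.
apply: measurable_bounded_integrable => //.
exists M; split; first exact: num_real.
by move=> M' MM' x /=; rewrite in_itv/= => /fM h; exact: le_trans h (ltW MM').
Qed.

Lemma integrable_sub_itv f a b s t : mu.-integrable `[a, b] (EFin \o f) ->
  a <= s -> t <= b -> mu.-integrable `[s, t] (EFin \o f).
Proof.
move=> intf sa tb; apply: integrableS intf => //.
by move=> x /=; rewrite !in_itv/= => /andP[sx xt]; rewrite (le_trans sa)//= (le_trans xt).
Qed.

Lemma Rintegral_itv_split f a b s : mu.-integrable `[a, b] (EFin \o f) ->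
  a <= s -> s <= b ->
  \int[mu]_(x in `[a, b]) f x =
  \int[mu]_(x in `[a, s]) f x + \int[mu]_(x in `[s, b]) f x.
Proof.
move=> intf sa sb.
have := @Rintegral_itvB R f (BLeft a) (BRight b) s intf.
rewrite !bnd_simp => /(_ sa sb) /eqP; rewrite subr_eq addrC => /eqP ->; congr (_ + _).
apply: Rintegral_itv_obnd_cbnd; apply: integrableS intf => //.
by move=> x /=; rewrite !in_itv/= => /andP[/ltW sx ->]; rewrite (le_trans sa).
Qed.

Lemma Rintegral_itv_cst (c a b : R) : a <= b -> \int[mu]_(x in `[a, b]) c = c * (b - a).
Proof.
move=> ab; rewrite Rintegral_cst//; congr (_ * _).
have : mu `[a, b] = (b - a)%:E.
  rewrite lebesgue_measure_itv/= lte_fin; case: ltP => // ba.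
  by rewrite (_ : b = a) ?subrr//; apply/eqP; rewrite eq_le ab ba.
by move=> h; transitivity (fine (mu `[a, b])) => //; rewrite h.
Qed.

Lemma Rintegral_itv_le_cst f a b M : mu.-integrable `[a, b] (EFin \o f) -> a <= b ->
  (forall x, a <= x <= b -> f x <= M) -> \int[mu]_(x in `[a, b]) f x <= M * (b - a).
Proof.
move=> intf ab fM; rewrite -Rintegral_itv_cst//; apply: le_Rintegral => //.
by apply: (@itv_bounded_integrable (cst M) _ _ `|M|).
Qed.

Lemma Rintegral_itv_ge_cst f a b M : mu.-integrable `[a, b] (EFin \o f) -> a <= b ->
  (forall x, a <= x <= b -> M <= f x) -> M * (b - a) <= \int[mu]_(x in `[a, b]) f x.
Proof.
move=> intf ab fM; rewrite -Rintegral_itv_cst//; apply: le_Rintegral => //.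
by apply: (@itv_bounded_integrable (cst M) _ _ `|M|).
Qed.

Lemma Rintegral_itv_point f a : \int[mu]_(x in `[a, a]) f x = 0.
Proof. by rewrite set_itv1 Rintegral_set1. Qed.

(** Increments leave the additive constant free, so functions normalised at 1 can be primitives on
    intervals that stay away from 1. *)
Definition primitive f F a b :=
  forall s t, a <= s -> s <= t -> t <= b -> F t - F s = \int[mu]_(x in `[s, t]) f x.

Lemma primitive_is_derive f F a b p : mu.-integrable `[a, b] (EFin \o f) ->
  primitive f F a b -> a < p < b -> {for p, continuous f} -> is_derive p 1 F (f p).
Proof.
move=> intf prim /andP[ap pb] cf; apply/is_derive1_approxP => e e0.
have : \forall y \near p, `|f p - f y| <= e by move: cf => /cvgrPdist_le /(_ e e0).
move/nbhs_ballP => [r /= r0 Hr].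
exists (Num.min r (Num.min (p - a) (b - p))); first by rewrite !lt_min r0 !subr_gt0 ap pb.
move=> y; rewrite !lt_min => /and3P[yr ypa ypb].
have near_f x : `|x - p| <= `|y - p| -> f p - e <= f x <= f p + e.
  move=> xy; have := Hr x; rewrite /ball/= distrC => /(_ (le_lt_trans xy yr)).
  by rewrite ler_distlC.
have [py|yp] := leP p y.
  have yE : `|y - p| = y - p by rewrite ger0_norm// subr_ge0.
  rewrite yE in ypa ypb near_f *.
  rewrite prim//; try lra.
  have int' : mu.-integrable `[p, y] (EFin \o f) by apply: integrable_sub_itv intf _ _; lra.
  have near_f' x : p <= x <= y -> f p - e <= f x <= f p + e.
    by move=> /andP[px xy]; apply: near_f; rewrite ger0_norm; lra.
  have h1 : \int[mu]_(x in `[p, y]) f x <= (f p + e) * (y - p).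
    by apply: Rintegral_itv_le_cst => // x /near_f' /andP[].
  have h2 : (f p - e) * (y - p) <= \int[mu]_(x in `[p, y]) f x.
    by apply: Rintegral_itv_ge_cst => // x /near_f' /andP[].
  by rewrite ler_norml; apply/andP; split; lra.
have yE : `|y - p| = p - y by rewrite ltr0_norm ?subr_lt0// opprB.
rewrite yE in ypa ypb near_f *.
have -> : F y - F p = - (F p - F y) by rewrite opprB.
rewrite prim//; try lra.
have int' : mu.-integrable `[y, p] (EFin \o f) by apply: integrable_sub_itv intf _ _; lra.
have near_f' x : y <= x <= p -> f p - e <= f x <= f p + e.
  by move=> /andP[px xy]; apply: near_f; rewrite ler0_norm; lra.
have yp' := ltW yp.
have h1 : \int[mu]_(x in `[y, p]) f x <= (f p + e) * (p - y).
  by apply: Rintegral_itv_le_cst => // x /near_f' /andP[].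
have h2 : (f p - e) * (p - y) <= \int[mu]_(x in `[y, p]) f x.
  by apply: Rintegral_itv_ge_cst => // x /near_f' /andP[].
by rewrite ler_norml; apply/andP; split; lra.
Qed.

Lemma primitive_lipschitz f F a b M : mu.-integrable `[a, b] (EFin \o f) ->
  primitive f F a b -> (forall x, a <= x <= b -> `|f x| <= M) ->
  forall s t, a <= s -> s <= t -> t <= b -> `|F t - F s| <= M * (t - s).
Proof.
move=> intf prim fM s t sa st tb; rewrite prim//.
have int' : mu.-integrable `[s, t] (EFin \o f) by apply: integrable_sub_itv intf _ _.
have fM' x : s <= x <= t -> - M <= f x <= M.
  by move=> /andP[sx xt]; rewrite -ler_norml; apply: fM; lra.
rewrite ler_norml -mulNr; apply/andP; split.
  by apply: Rintegral_itv_ge_cst => // x /fM' /andP[].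
by apply: Rintegral_itv_le_cst => // x /fM' /andP[].
Qed.

(** The difference between [F] and the integral of [f] is absolutely continuous with derivative zero
    almost everywhere, hence constant. Continuity of [f] makes the integral differentiable at every
    interior point. *)
Lemma ac_primitive f F a b M : a <= b -> measurable_fun `[a, b] f ->
  (forall x, a <= x <= b -> `|f x| <= M) ->
  (forall x, a < x < b -> {for x, continuous f}) ->
  absolutely_continuous a b F ->
  {ae mu, forall x, a < x < b -> is_derive x 1 F (f x)} ->
  F b - F a = \int[mu]_(x in `[a, b]) f x.
Proof.
move=> ab mf fM cf acF dF.
have intf := itv_bounded_integrable mf fM.
pose G y := \int[mu]_(x in `[a, y]) f x.
have primG : primitive f G a b.
  move=> s t sa st tb; rewrite /G (@Rintegral_itv_split f a t s)//.
    by rewrite addrAC subrr add0r.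
  exact: integrable_sub_itv intf _ _.
have : (F \- G) a = (F \- G) b.
  apply: ac_derive0_eq => //.
    by apply: acB => //; apply: lipschitz_ac; exact: primitive_lipschitz intf primG fM.
  move: dF; apply: ae_lebesgue_mono => x dFx axb; rewrite -(subrr (f x)).
  by apply: is_deriveB; [exact: dFx|apply: primitive_is_derive primG _ _ => //; exact: cf].
rewrite /= {1}/G Rintegral_itv_point subr0 => ->; rewrite /G.
by rewrite opprB addrCA subrr addr0.
Qed.

(* Integration by parts against dg, with the integral of F dg dropped. *)
Lemma primitive_monotone_le f F g a b M : a <= b -> measurable_fun `[a, b] f ->
  (forall x, a <= x <= b -> `|f x| <= M) -> primitive f F a b ->
  (forall x, a <= x <= b -> 0 <= F x) ->
  (forall x y, a <= x -> x <= y -> y <= b -> g x <= g y) -> 0 <= g a ->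
  \int[mu]_(x in `[a, b]) (f x * g x) <= F b * g b.
Proof.
move=> ab mf fM prim F0 gnd ga.
have intf := itv_bounded_integrable mf fM.
have M0 : 0 <= M by apply: le_trans (fM a _); rewrite ?lexx.
have mg : measurable_fun `[a, b] g.
  apply: interval_nondecreasing_measurable; first exact: interval_is_interval.
  by move=> x y /=; rewrite !in_itv/= => /andP[ax xb] /andP[ay yb] xy; exact: gnd.
have g0 x : a <= x <= b -> 0 <= g x <= g b.
  by move=> /andP[ax xb]; rewrite (le_trans ga) ?gnd.
have intfg : mu.-integrable `[a, b] (EFin \o (fun x => f x * g x)).
  apply: (@itv_bounded_integrable _ _ _ (M * g b)).
    exact: measurable_funM.
  move=> x axb; have /andP[h1 h2] := g0 _ axb.
  by rewrite normrM (ger0_norm h1) ler_pM// fM.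
have step s t : a <= s -> s <= t -> t <= b ->
    \int[mu]_(x in `[s, t]) (f x * g x) <=
    g t * (F t - F s) + M * (g t - g s) * (t - s).
  move=> sa st tb.
  have ints : mu.-integrable `[s, t] (EFin \o f) by exact: integrable_sub_itv intf _ _.
  have intc : mu.-integrable `[s, t] (EFin \o (fun x => g t * f x)).
    exact: integrable_mulr.
  have intk : mu.-integrable `[s, t] (EFin \o (cst (M * (g t - g s)))).
    by apply: (@itv_bounded_integrable (cst _) _ _ `|M * (g t - g s)|).
  rewrite prim// -RintegralZl// -Rintegral_itv_cst// -RintegralD//.
  apply: le_Rintegral => //.
  - exact: integrable_sub_itv intfg _ _.
  - exact: integrable_addr.
  move=> x /=; rewrite in_itv/= => /andP[sx xt].
  have h1 : g s <= g x by apply: gnd => //; lra.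
  have h2 : g x <= g t by apply: gnd => //; lra.
  have : - f x <= M by have := fM x; rewrite ler_norml => /(_ _)/andP[|]; lra.
  (* Expanding this product bounds [f x * g x] by [g t * f x + M * (g t - g x)]: freezing [g] at the
     right end costs at most [M] times its oscillation. *)
  move=> h3; have : 0 <= (M + f x) * (g t - g x) by apply: mulr_ge0; lra.
  have : 0 <= M * (g x - g s) by apply: mulr_ge0; lra.
  lra.
apply/ler_addgt0Pr => e e0.
(* On a uniform partition the freezing errors telescope to [M * h * (g b - g a)], that is, to [c]
   divided by the number of cells. *)
pose c := M * (g b - g a) * (b - a).
have [n nE] : exists n : nat, c / e < n.+1%:R.
  by exists (Num.truncn (c / e)); exact: truncnS_gt.
pose h := (b - a) / n.+1%:R.
have n0 : 0 < n.+1%:R :> R by rewrite ltr0n.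
have h0 : 0 <= h by rewrite divr_ge0 ?subr_ge0.
have ch : M * h * (g b - g a) <= e.
  rewrite /h (_ : _ * _ * _ = c / n.+1%:R); last by rewrite /c; ring.
  by rewrite ler_pdivrMr// mulrC -ler_pdivrMr// ltW.
pose t i := a + i%:R * h.
have tn : t n.+1 = b by rewrite /t /h; field; rewrite gt_eqF.
have tmon i j : (i <= j)%N -> t i <= t j.
  by move=> ij; rewrite /t lerD2l ler_wpM2r// ler_nat.
have ind i : (i <= n.+1)%N -> \int[mu]_(x in `[a, t i]) (f x * g x) <=
    F (t i) * g (t i) + M * h * (g (t i) - g a).
  elim: i => [_|i IH ni].
    rewrite /t mul0r addr0 Rintegral_itv_point subrr mulr0 addr0 mulr_ge0//.
    by rewrite F0// lexx.
  have at0 : a <= t i by rewrite -[leLHS](_ : t 0%N = a) ?tmon// /t mul0r addr0.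
  have tii : t i <= t i.+1 by exact: tmon.
  have tb : t i.+1 <= b by rewrite -tn tmon.
  rewrite (@Rintegral_itv_split _ a (t i.+1) (t i))//; last first.
    exact: integrable_sub_itv intfg _ _.
  have := IH (ltnW ni).
  have := step (t i) (t i.+1) at0 tii tb.
  have -> : t i.+1 - t i = h by rewrite /t -natr1; ring.
  (* This is the term dropped at each step of the summation by parts. *)
  have : 0 <= F (t i) * (g (t i.+1) - g (t i)).
    by apply: mulr_ge0; [apply: F0; lra|rewrite subr_ge0 gnd].
  lra.
have := ind n.+1 (leqnn _); rewrite tn; lra.
Qed.

End interval_integrals.

(** * Almost everywhere differentiability of Lipschitz monotone functions *)

Section monotone_lipschitz_derivable.
Context {R : realType}.
Set Implicit Arguments.
Unset Strict Implicit.
Local Notation mu := (@lebesgue_measure R).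

Let lebesgue_stieltjes_oc (g : cumulative R R) (x y : R) : x <= y ->
  lebesgue_stieltjes_measure g `]x, y] = (g y - g x)%:E.
Proof.
move=> xy; rewrite /lebesgue_stieltjes_measure/= /measure_extension.
rewrite measurable_mu_extE/=; last exact: is_ocitv.
by rewrite wlength_itv_bnd.
Qed.

(* K * x - g x is again a distribution function, so the Stieltjes measure of g
   is at most K times the Lebesgue measure. *)
Let lebesgue_stieltjes_dominated (g : cumulativeBounded (0 : R) (1 : R)) (K : R) :
  0 < K -> (forall x y, x <= y -> g y - g x <= K * (y - x)) ->
  lebesgue_stieltjes_measure g `<< mu.
Proof.
move=> K0 gK.
pose h x := K * x - g x.
have hnd : nondecreasing h by move=> x y /gK; rewrite /h; lra.
have hrc : right_continuous h.
  move=> x; apply: cvgB; last exact: cumulative_is_right_continuous.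
  by apply: cvgM; [exact: cvg_cst|apply: cvg_within_filter; exact: cvg_id].
pose hc := HB.pack_for (cumulative R R) h (isCumulative.Build R _ R h hnd hrc).
have Ki0 : 0 <= K^-1 by rewrite invr_ge0 ltW.
(* [g + h] is [K] times the identity, so [nu] agrees with Lebesgue measure on half-open intervals,
   hence on all measurable sets. *)
pose nu := mscale (NngNum Ki0)
  (measure_add (lebesgue_stieltjes_measure g) (lebesgue_stieltjes_measure hc)).
have nuE A : nu A = ((K^-1)%:E * (lebesgue_stieltjes_measure g A
    + lebesgue_stieltjes_measure hc A))%E.
  by rewrite -measure_addE.
have munu A : measurable A -> mu A = nu A.
  move=> mA; apply: (@lebesgue_stieltjes_measure_unique R idfun nu) => // X.
  move=> /ocitvP[->|[[x y] /= /ltW xy ->]]; first by rewrite !measure0.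
  rewrite [RHS]nuE !lebesgue_stieltjes_oc//.
  by rewrite -EFinD -EFinM; congr EFin; rewrite /= /h; field; rewrite gt_eqF.
apply/null_content_dominatesP => A mA muA0.
have : nu A = 0%E by rewrite -munu.
rewrite nuE => /eqP; rewrite mule_eq0 eqe invr_eq0 (gt_eqF K0)/=.
by rewrite padde_eq0// => /andP[/eqP].
Qed.

(** By domination the Stieltjes measure has a Radon-Nikodym density, so the increments of [g] are
    integrals of an integrable function and Lebesgue differentiation applies. The point [a] serves
    as a finite base point for these integrals. *)
Let cdf_lipschitz_derivable (g : cumulativeBounded (0 : R) (1 : R)) (K a : R) :
  0 < K -> (forall x y, x <= y -> g y - g x <= K * (y - x)) ->
  {ae mu, forall x, a < x -> derivable g x 1}.
Proof.
move=> K0 gK.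
have [f [f0 ffin intf fE]] :=
  radon_nikodym_sigma_finite (lebesgue_stieltjes_dominated K0 gK).
pose w x := fine (f x).
have fw : f = EFin \o w by apply/funext => x; rewrite /w /= fineK.
have intw : mu.-integrable setT (EFin \o w) by rewrite -fw.
have locw : locally_integrable setT w.
  by apply: open_integrable_locally => //; exact: openT.
have intS D : measurable D -> mu.-integrable D (EFin \o w).
  by move=> mD; apply: integrableS intw.
have := @FTC1 R w (BLeft a) (fun y => intS _ (measurable_itv _)) locw.
apply: ae_lebesgue_mono => x H ax.
have [] := H _; first by rewrite lte_fin.
set F := (fun _ => _) => dF _.
have gF s t : a <= s -> s <= t -> g t - g s = F t - F s.
  move=> sa st.
  have -> : F t - F s = \int[mu]_(x in `]s, t]) w x.
    by apply: Rintegral_itvB; [exact: intS|rewrite bnd_simp|rewrite bnd_simp].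
  rewrite /Rintegral.
  have <- : (lebesgue_stieltjes_measure g `]s, t] =
             \int[mu]_(x in `]s, t]) (w x)%:E)%E.
    by rewrite fE// fw.
  by rewrite lebesgue_stieltjes_oc.
have /is_derive1_approxP dF' : is_derive x 1 F ('D_1 F x) by exact: derivableP.
suff : is_derive x 1 g ('D_1 F x) by case.
apply/is_derive1_approxP => e e0; have [r r0 Hr] := dF' _ e0.
exists (Num.min r (x - a)); first by rewrite lt_min r0 subr_gt0.
move=> y; rewrite lt_min => /andP[yr yx].
have ya : a <= y by move: yx; rewrite ltr_norml; lra.
have -> : g y - g x = F y - F x.
  have [xy|/ltW yx'] := leP x y; first by rewrite gF// ltW.
  by apply/eqP; rewrite -eqr_opp !opprB gF.
exact: Hr.
Qed.

Lemma lipschitz_nondecreasing_derivable (a b L : R) (f : R -> R) : a < b ->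
  (forall x y, a <= x -> x <= y -> y <= b -> 0 <= f y - f x <= L * (y - x)) ->
  {ae mu, forall x, a < x < b -> derivable f x 1}.
Proof.
move=> ab fL.
(* Clamping the argument extends the function by constants, which gives it limits at both
   infinities. *)
pose cl (x : R) := Num.max a (Num.min b x).
have clP x : a <= cl x <= b.
  by rewrite /cl le_max lexx/= ge_max ge_min lexx (ltW ab).
have cl_nd x y : x <= y -> 0 <= cl y - cl x <= y - x.
  have minP u v : u <= v -> 0 <= Num.min b v - Num.min b u <= v - u.
    by move=> uv; case: (leP b u); case: (leP b v) => *; apply/andP; split; lra.
  have maxP u v : u <= v -> 0 <= Num.max a v - Num.max a u <= v - u.
    by move=> uv; case: (leP a u); case: (leP a v) => *; apply/andP; split; lra.
  move=> /minP/andP[h1 h2]; have /maxP/andP[h3 h4] : Num.min b x <= Num.min b y by lra.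
  by rewrite /cl h3/=; lra.
have cl_id x : a <= x <= b -> cl x = x.
  by move=> /andP[ax xb]; rewrite /cl (min_idPr xb) (max_idPr ax).
(* Adding the identity makes the total increment [c] positive even if [f] is constant, so dividing
   by it yields a distribution function. *)
pose f1 x := f x + x.
pose c := f1 b - f1 a.
have c0 : 0 < c.
  have /andP[h _] : 0 <= f b - f a <= L * (b - a) by apply: fL; rewrite ?lexx ?(ltW ab).
  by rewrite /c /f1; lra.
pose g x := (f1 (cl x) - f1 a) / c.
pose K := (`|L| + 1) / c.
have K0 : 0 < K by rewrite divr_gt0// ltr_wpDl.
have gK x y : x <= y -> 0 <= g y - g x <= K * (y - x).
  move=> xy; have /andP[h1 h2] := cl_nd _ _ xy.
  have /andP[ax _] := clP x; have /andP[_ yb] := clP y.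
  have /andP[h3 h4] : 0 <= f (cl y) - f (cl x) <= L * (cl y - cl x) by apply: fL => //; lra.
  have -> : g y - g x = (f (cl y) - f (cl x) + (cl y - cl x)) / c.
    by rewrite /g /f1; ring.
  rewrite divr_ge0 ?(ltW c0)//=; last lra.
  rewrite /K mulrAC ler_pM2r ?invr_gt0//.
  have h5 : L * (cl y - cl x) <= `|L| * (cl y - cl x) by rewrite ler_wpM2r// ler_norm.
  have h6 : `|L| * (cl y - cl x) <= `|L| * (y - x) by rewrite ler_wpM2l.
  lra.
have gnd : nondecreasing g by move=> x y /gK /andP[]; rewrite subr_ge0.
have grc : right_continuous g.
  move=> x; apply/cvgrPdist_le => e e0.
  near=> y.
  have xy : x <= y by near: y; apply: nbhs_right_ge.
  have /andP[h1 h2] := gK _ _ xy.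
  rewrite distrC ger0_norm//; apply: (le_trans h2).
  rewrite mulrC -ler_pdivlMr// lerBlDl.
  near: y; apply: nbhs_right_le; rewrite ltrDl divr_gt0//.
have gNy : g @ -oo --> (0 : R).
  apply: cvg_near_cst; near=> x.
  have xa : x <= a by near: x; apply: nbhs_ninfty_le; exact: num_real.
  have xb : x <= b := le_trans xa (ltW ab).
  by rewrite /g /cl (min_idPr xb) (max_idPl xa) subrr mul0r.
have gy : g @ +oo --> (1 : R).
  apply: cvg_near_cst; near=> x.
  have xb : b <= x by near: x; apply: nbhs_pinfty_ge; exact: num_real.
  by rewrite /g /cl (min_idPl xb) (max_idPr (ltW ab)) divff// gt_eqF.
pose gc := HB.pack_for (cumulativeBounded (0 : R) (1 : R)) g
  (isCumulative.Build R _ R g gnd grc)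
  (isCumulativeBounded.Build R 0 1 g gNy gy).
have := @cdf_lipschitz_derivable gc K a K0 (fun x y xy => (andP (gK x y xy)).2).
apply: ae_lebesgue_mono => x dg /andP[ax xb].
have /is_derive1_approxP dg' : is_derive x 1 g ('D_1 g x) by apply/derivableP; exact: dg.
suff : is_derive x 1 f (c * 'D_1 g x - 1) by case.
apply/is_derive1_approxP => e e0.
have [r r0 Hr] := dg' (e / c) (divr_gt0 e0 c0).
exists (Num.min r (Num.min (x - a) (b - x))); first by rewrite !lt_min r0 !subr_gt0 ax.
move=> y; rewrite !lt_min => /and3P[yr ya yb].
have ayb : a <= y <= b by move: ya yb; rewrite !ltr_norml; lra.
have axb : a <= x <= b by rewrite !ltW.
have -> : f y - f x - (c * 'D_1 g x - 1) * (y - x) =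
    c * (g y - g x - 'D_1 g x * (y - x)).
  by rewrite /g !cl_id// /f1; field; rewrite gt_eqF.
rewrite normrM (gtr0_norm c0) mulrC -ler_pdivlMr//.
by apply: (le_trans (Hr y yr)); rewrite mulrAC.
Unshelve. all: by end_near. Qed.

End monotone_lipschitz_derivable.

(** * The reduced problem *)

Section unit_interval_integrals.
Context {R : realType}.
Set Implicit Arguments.
Unset Strict Implicit.
Local Notation mu := (@lebesgue_measure R).

Lemma sub_itvcc_oo (a b : R) : 0 < a -> b < 1 -> `[a, b] `<=` (`]0, 1[ : set R).
Proof.
by move=> a0 b1 x /=; rewrite !in_itv/= => /andP[ax xb]; rewrite (lt_le_trans a0)//= (le_lt_trans xb).
Qed.

Lemma near_itvoo01 (p : R) : 0 < p < 1 -> \forall x \near p, 0 < x < 1.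
Proof.
move=> /andP[p0 p1]; apply/nbhs_ballP; exists (Num.min p (1 - p)).
  by rewrite /= lt_min p0 subr_gt0.
move=> x; rewrite /ball/= lt_min !ltr_norml => /andP[/andP[h1 h2] /andP[h3 h4]].
by apply/andP; split; lra.
Qed.

Lemma measurable_fun_sub_oo (f : R -> R) (a b : R) : 0 < a -> b < 1 ->
  measurable_fun (`]0%R, 1%R[ : set R) f -> measurable_fun `[a, b] f.
Proof.
move=> a0 b1 mf; apply: measurable_funS mf => //; exact: sub_itvcc_oo.
Qed.

Lemma EFin_Rintegral (D : set R) (f : R -> R) : mu.-integrable D (EFin \o f) ->
  measurable D ->
  (\int[mu]_(x in D) f x)%:E = (\int[mu]_(x in D) (f x)%:E)%E.
Proof. by move=> intf mD; rewrite /Rintegral fineK//; exact: integrable_fin_num intf. Qed.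

(** Monotone convergence along compact intervals containing [m]. With [m] equal to pbar, every left
    end point falls where a solution [Q] vanishes. *)
Lemma integral_oo_le (f : R -> R) (m : R) (c : \bar R) : 0 < m < 1 ->
  measurable_fun (`]0%R, 1%R[ : set R) f -> (forall x, 0 < x < 1 -> 0 <= f x) ->
  (forall a b, 0 < a -> a <= m -> m <= b -> b < 1 ->
    (\int[mu]_(x in `[a, b]) (f x)%:E <= c)%E) ->
  (\int[mu]_(x in `]0%R, 1%R[) (f x)%:E <= c)%E.
Proof.
move=> /andP[m0 m1] mf f0 fc.
(* The scale starts at 1, where the interval is the single point [m], and then shrinks both margins
   in proportion to the distances of [m] from 0 and 1. *)
pose w (n : nat) : R := n.+1%:R^-1.
have i0 n : 0 < w n <= 1.
  by rewrite invr_gt0 ltr0n/= invf_le1 ?ltr0n// ler1n.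
have w_nincr n p : (n <= p)%N -> w p <= w n.
  by move=> np; rewrite lef_pV2 ?posrE ?ltr0n// ler_nat.
have w_small y : 0 < y -> exists n, w n <= y.
  move=> y0; exists (Num.truncn y^-1).
  by rewrite /w invf_ple ?posrE// ltW// truncnS_gt.
clearbody w.
pose F n := `[m * w n, 1 - (1 - m) * w n]%classic : set R.
have Fb n : [/\ 0 < m * w n, m * w n <= m,
    m <= 1 - (1 - m) * w n & 1 - (1 - m) * w n < 1].
  have /andP[h1 h2] := i0 n; split; first by rewrite mulr_gt0.
  - by rewrite ler_piMr// ltW.
  - have : (1 - m) * w n <= 1 - m by rewrite ler_piMr// subr_ge0 ltW.
    lra.
  - have : 0 < (1 - m) * w n by rewrite mulr_gt0// subr_gt0.
    lra.
have F01 n : F n `<=` `]0, 1[ by have [? ? ? ?] := Fb n; exact: sub_itvcc_oo.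
have UF : \bigcup_n F n = `]0, 1[%classic.
  apply/seteqP; split; first by move=> x [n _]; exact: F01.
  move=> x /=; rewrite in_itv/= => /andP[x0 x1].
  pose y := Num.min (x / m) ((1 - x) / (1 - m)).
  have y0 : 0 < y by rewrite lt_min !divr_gt0// subr_gt0.
  have [n ny] := w_small _ y0; exists n => //; rewrite /F/= in_itv/=.
  have h1 : w n <= x / m by rewrite (le_trans ny)// ge_min lexx.
  have h2 : w n <= (1 - x) / (1 - m) by rewrite (le_trans ny)// ge_min lexx orbT.
  move: h1 h2; rewrite !ler_pdivlMr// ?subr_gt0//; lra.
have ndF : nondecreasing_seq F.
  move=> n p np; apply/subsetPset => x; rewrite /F/= !in_itv/= => /andP[h1 h2].
  have h3 := w_nincr _ _ np.
  have : m * w p <= m * w n by rewrite ler_wpM2l// ltW.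
  have : (1 - m) * w p <= (1 - m) * w n by rewrite ler_wpM2l// subr_ge0 ltW.
  lra.
have mF n : measurable (F n) by exact: measurable_itv.
have cvg_F : (\int[mu]_(x in F i) (f x)%:E @[i --> \oo] -->
    \int[mu]_(x in `]0%R, 1%R[) (f x)%:E)%E.
  rewrite -UF; apply: ge0_nondecreasing_set_cvg_integral => //.
    by move=> n; apply/measurable_EFinP; exact: measurable_funS mf.
  move=> n x Fx; rewrite lee_fin; apply: f0.
  by have := F01 _ _ Fx; rewrite /= in_itv.
apply: (cvge_le _ cvg_F).
by apply: nearW => n; have [? ? ? ?] := Fb n; exact: fc.
Qed.

End unit_interval_integrals.

Section reduced_problem.
Context {R : realType} (V v : R -> R -> R) (k : R -> R) (U0 C M0 pb : R).
Set Implicit Arguments.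
Unset Strict Implicit.
Local Notation mu := (@lebesgue_measure R).

(** What the variational argument retains of the market: [v] is a supergradient of V in the wealth
    variable, bounded by [U0] and strongly decreasing on bounded sets of wealth; [k] is the price,
    at least [U0] below [pb]. *)
Record concave_problem : Prop := ConcaveProblem {
  cp_V_le0 : forall x p, 0 <= x -> 0 < p < 1 -> V x p <= 0;
  cp_V_ge : forall p, 0 < p < 1 -> - M0 <= V 0 p;
  cp_V_concave : forall x y p, 0 <= x -> 0 <= y -> 0 < p < 1 ->
    V y p - V x p <= v x p * (y - x);
  cp_v_bounds : forall x p, 0 <= x -> 0 < p < 1 -> 0 <= v x p <= U0;
  cp_v_lipschitz : forall x y p q, 0 <= x -> 0 <= y -> 0 < p < 1 -> 0 < q < 1 ->
    `|v y q - v x p| <= C * (`|y - x| + `|q - p|);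
  cp_v_decr : forall B, exists2 c, 0 < c & forall x y p, 0 <= x -> x <= y -> y <= B ->
    0 < p < 1 -> c * (y - x) <= v x p - v y p;
  cp_V_measurable : forall Q : R -> R, measurable_fun (`]0%R, 1%R[ : set R) Q ->
    (forall p, 0 < p < 1 -> 0 <= Q p) ->
    measurable_fun (`]0%R, 1%R[ : set R) (fun p => V (Q p) p);
  cp_v_measurable : forall Q : R -> R, measurable_fun (`]0%R, 1%R[ : set R) Q ->
    (forall p, 0 < p < 1 -> 0 <= Q p) ->
    measurable_fun (`]0%R, 1%R[ : set R) (fun p => v (Q p) p);
  cp_k_ge0 : forall p, 0 <= k p;
  cp_k_nincr : forall p q, 0 < p -> p <= q -> q <= 1 -> k q <= k p;
  cp_k_lipschitz : forall a b, 0 < a -> b < 1 -> exists L, forall x y,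
    a <= x -> x <= y -> y <= b -> `|k y - k x| <= L * (y - x);
  cp_pb : 0 < pb < 1;
  cp_k_pb : forall p, 0 < p -> p < pb -> U0 <= k p }.

Hypothesis cp : concave_problem.
Implicit Types (Q h : R -> R) (a b c p x y s t : R).

(** The Lagrangian integrand with its sign reversed, which makes it nonnegative on [Qplus]. *)
Definition cost_density (Q : R -> R) p := k p * Q p - V (Q p) p.

Definition cost (Q : R -> R) : \bar R :=
  (\int[mu]_(p in `]0%R, 1%R[) (cost_density Q p)%:E)%E.

(** For the concrete [k] this is [- lambda * eta p] at positive [p], so [H p + tail p] is the second
    entry of the minimum in the system. *)
Definition tail (p : R) : R := \int[mu]_(s in `[p, 1]) k s.

Let in01 (a b x : R) : 0 < a -> b < 1 -> a <= x <= b -> 0 < x < 1.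
Proof. by move=> a0 b1 /andP[ax xb]; apply/andP; split; lra. Qed.

Let k_measurable01 : measurable_fun (`]0%R, 1%R] : set R) k.
Proof.
have : measurable_fun (`]0%R, 1%R] : set R) (\- k).
  apply: interval_nondecreasing_measurable; first exact: interval_is_interval.
  move=> x y /=; rewrite !in_itv/= => /andP[x0 x1] /andP[y0 y1] xy.
  by rewrite lerN2; exact: cp_k_nincr.
by move/measurable_funN; apply: eq_measurable_fun => x _; rewrite /= opprK.
Qed.

Let k_measurable : measurable_fun (`]0%R, 1%R[ : set R) k.
Proof. by apply: measurable_funS k_measurable01 => // x /=; rewrite !in_itv/= => /andP[-> /ltW]. Qed.

Lemma k_integrable1 a : 0 < a -> mu.-integrable `[a, 1] (EFin \o k).
Proof.
move=> a0; apply: (@itv_bounded_integrable _ _ _ _ (k a)).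
  by apply: measurable_funS k_measurable01 => // x /=; rewrite !in_itv/= => /andP[/(lt_le_trans a0) -> ->].
by move=> x /andP[ax x1]; rewrite ger0_norm ?(cp_k_ge0 cp)// (cp_k_nincr cp).
Qed.

Let k_bounded a b x : 0 < a -> b < 1 -> a <= x <= b -> `|k x| <= k a.
Proof.
move=> a0 b1 /andP[ax xb]; rewrite ger0_norm ?(cp_k_ge0 cp)// (cp_k_nincr cp)//; lra.
Qed.

Let k_integrable a b : 0 < a -> b < 1 -> mu.-integrable `[a, b] (EFin \o k).
Proof.
move=> a0 b1; apply: (@itv_bounded_integrable _ _ _ _ (k a)).
  exact: measurable_fun_sub_oo k_measurable.
by move=> x; exact: k_bounded.
Qed.

Let k_continuous p : 0 < p < 1 -> {for p, continuous k}.
Proof.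
move=> /andP[p0 p1].
have [L HL] := cp_k_lipschitz cp (divr_gt0 p0 (ltr0n R 2)) (midf_lt p1).2.
by apply: (lipschitz_continuous_at HL); apply/andP; split; lra.
Qed.

Let tail_primitive a b : 0 < a -> b < 1 -> primitive (fun p => - k p) tail a b.
Proof.
move=> a0 b1 s t sa st tb; have s0 : 0 < s by lra.
rewrite /tail [in X in _ - X](@Rintegral_itv_split _ k s 1 t) ?k_integrable1//; last lra.
rewrite opprD addrCA subrr addr0.
rewrite -mulN1r -RintegralZl//; last by apply: k_integrable => //; lra.
by apply: eq_Rintegral => x _; rewrite mulN1r.
Qed.

Let Qplus_ge0 Q p : Qplus Q -> 0 < p < 1 -> 0 <= Q p.
Proof. by move=> [Q0 _ _]; exact: Q0. Qed.

Let Qplus_measurable Q : Qplus Q -> measurable_fun (`]0%R, 1%R[ : set R) Q.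
Proof.
move=> [_ Qnd _]; apply: interval_nondecreasing_measurable; first exact: interval_is_interval.
move=> x y /=; rewrite !in_itv/= => /andP[x0 x1] /andP[y0 y1] xy; exact: Qnd.
Qed.

Lemma cost_density_ge0 Q p : Qplus Q -> 0 < p < 1 -> 0 <= cost_density Q p.
Proof.
move=> hQ p01; rewrite /cost_density subr_ge0 (@le_trans _ _ 0)//.
  by rewrite (cp_V_le0 cp)// Qplus_ge0.
by rewrite mulr_ge0 ?(cp_k_ge0 cp)// Qplus_ge0.
Qed.

Let cost_density_measurable Q : Qplus Q -> measurable_fun (`]0%R, 1%R[ : set R) (cost_density Q).
Proof.
move=> hQ; have mQ := Qplus_measurable hQ; apply: measurable_funB.
  exact: measurable_funM.
by apply: (cp_V_measurable cp) => // p; exact: Qplus_ge0.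
Qed.

(** The supergradient inequality from [x] to 0, with [v] nonnegative, shows that V is smallest at
    zero wealth. *)
Let V_bounded x p : 0 <= x -> 0 < p < 1 -> `|V x p| <= M0.
Proof.
move=> x0 p01.
have h1 := cp_V_le0 cp x0 p01.
have h2 := cp_V_ge cp p01.
have h3 := cp_V_concave cp x0 (lexx 0) p01.
have /andP[h4 h5] := cp_v_bounds cp x0 p01.
have : 0 <= v x p * x by rewrite mulr_ge0.
by rewrite ler0_norm//; lra.
Qed.

Let cost_density_integrable Q a b : Qplus Q -> 0 < a -> a <= b -> b < 1 ->
  mu.-integrable `[a, b] (EFin \o cost_density Q).
Proof.
move=> hQ a0 ab b1.
apply: (@itv_bounded_integrable _ _ _ _ (k a * Q b + M0)).
  exact: measurable_fun_sub_oo (cost_density_measurable hQ).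
move=> x axb; have x01 := in01 a0 b1 axb; have /andP[ax xb] := axb.
have /andP[x0 x1] := x01.
have Qx0 := Qplus_ge0 hQ x01.
have Qxb : Q x <= Q b by case: hQ => _ Qnd _; exact: Qnd.
rewrite /cost_density (le_trans (ler_normB _ _))// lerD//.
  by rewrite normrM ler_pM// ?(k_bounded a0 b1)// ger0_norm.
exact: V_bounded.
Qed.

Let v_continuous Q p : Qplus Q -> {for p, continuous Q} -> 0 < p < 1 ->
  {for p, continuous (fun p => v (Q p) p)}.
Proof.
move=> hQ cQ p01; apply/cvgrPdist_le => e e0.
have C1 : 0 < `|C| + 1 by rewrite ltr_wpDl.
pose d := e / (`|C| + 1) / 2.
have d0 : 0 < d by rewrite !divr_gt0.
have Qn : \forall x \near p, `|Q p - Q x| <= d by have /cvgrPdist_le := cQ; exact.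
have xn : \forall x \near p, `|p - x| <= d by have /cvgrPdist_le := @cvg_id _ (nbhs p); exact.
have x01 := near_itvoo01 p01.
near=> x.
have x01' : 0 < x < 1 by near: x.
apply: (le_trans (cp_v_lipschitz cp (Qplus_ge0 hQ x01') (Qplus_ge0 hQ p01) x01' p01)).
apply: (@le_trans _ _ ((`|C| + 1) * (d + d))).
  apply: (@le_trans _ _ ((`|C| + 1) * (`|Q p - Q x| + `|p - x|))).
    by rewrite ler_wpM2r ?addr_ge0// (le_trans (ler_norm _))// lerDl.
  by rewrite ler_pM2l// lerD//; near: x.
rewrite le_eqVlt; apply/orP; left; apply/eqP; rewrite /d; field.
by rewrite gt_eqF.
Unshelve. all: by end_near. Qed.

(** * Sufficiency: solutions of the system minimise the cost *)

Section sufficiency.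
Variables (Q H : R -> R) (LH : R).
Hypothesis Qcont : forall p, 0 < p < 1 -> {for p, continuous Q}.
Hypothesis Qnd : forall p q, 0 < p -> p <= q -> q < 1 -> Q p <= Q q.
Hypothesis Qac : forall a b, 0 < a -> a <= b -> b < 1 -> absolutely_continuous a b Q.
Hypothesis HL : forall x y, 0 <= x -> x <= y -> y <= 1 -> `|H y - H x| <= LH * (y - x).
Hypothesis ode : {ae mu, forall p, 0 < p < 1 -> [/\ derivable Q p 1,
  Num.min (derive1 Q p) (H p + tail p) = 0 & is_derive p 1 H (v (Q p) p)]}.
Hypothesis H1 : H 1 = 0.
Hypothesis Qpb : forall p, 0 < p <= pb -> Q p = 0.

Lemma ode_Qplus : Qplus Q.
Proof.
have /andP[pb0 pb1] := cp_pb cp.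
split => //.
  move=> p /andP[p0 p1]; have [ppb|pbp] := leP p pb; first by rewrite Qpb// p0.
  by rewrite -(@Qpb pb) ?pb0 ?lexx//; apply: Qnd => //; exact: ltW.
by move=> p p01; apply: cvg_within_filter; exact: Qcont.
Qed.

Let hQ := ode_Qplus.
Let f p := v (Q p) p - k p.
Let Phi p := H p + tail p.

Let f_measurable a b : 0 < a -> b < 1 -> measurable_fun `[a, b] f.
Proof.
move=> a0 b1; apply: measurable_fun_sub_oo => //; apply: measurable_funB => //.
by apply: (cp_v_measurable cp); [exact: Qplus_measurable|move=> p; exact: Qplus_ge0].
Qed.

Let f_bounded a b x : 0 < a -> b < 1 -> a <= x <= b -> `|f x| <= U0 + k a.
Proof.
move=> a0 b1 axb; have x01 := in01 a0 b1 axb.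
rewrite /f (le_trans (ler_normB _ _))// lerD ?(k_bounded a0 b1)//.
by have /andP[h1 h2] := cp_v_bounds cp (Qplus_ge0 hQ x01) x01; rewrite ger0_norm.
Qed.

Let f_continuous p : 0 < p < 1 -> {for p, continuous f}.
Proof. by move=> p01; apply: cvgB; [by apply: v_continuous => //; exact: Qcont|exact: k_continuous]. Qed.

Let H_primitive a b : 0 < a -> b < 1 -> primitive (fun p => v (Q p) p) H a b.
Proof.
move=> a0 b1 s t sa st tb.
have s0 : 0 < s by lra.
have t1 : t < 1 by lra.
apply: (@ac_primitive _ _ _ _ _ U0) => //.
- apply: measurable_fun_sub_oo => //; apply: (cp_v_measurable cp).
    exact: Qplus_measurable.
  by move=> p; exact: Qplus_ge0.
- move=> x /(in01 s0 t1) x01.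
  by have /andP[h1 h2] := cp_v_bounds cp (Qplus_ge0 hQ x01) x01; rewrite ger0_norm.
- move=> x /andP[sx xt]; have x01 : 0 < x < 1 by apply/andP; split; lra.
  by apply: v_continuous => //; exact: Qcont.
- apply: (@lipschitz_ac _ _ _ _ LH) => x y sx xy yt; apply: HL; lra.
- move: ode; apply: ae_lebesgue_mono => x odex /andP[sx xt].
  have x01 : 0 < x < 1 by apply/andP; split; lra.
  by have [] := odex x01.
Qed.

Let Phi_primitive a b : 0 < a -> b < 1 -> primitive f Phi a b.
Proof.
move=> a0 b1 s t sa st tb.
have s0 : 0 < s by lra.
have t1 : t < 1 by lra.
have -> : Phi t - Phi s = (H t - H s) + (tail t - tail s) by rewrite /Phi; ring.
rewrite (H_primitive a0 b1)// (tail_primitive a0 b1)// -RintegralD//.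
- apply: (@itv_bounded_integrable _ _ _ _ U0).
    apply: measurable_fun_sub_oo => //; apply: (cp_v_measurable cp).
      exact: Qplus_measurable.
    by move=> p; exact: Qplus_ge0.
  move=> x /(in01 s0 t1) x01.
  by have /andP[h1 h2] := cp_v_bounds cp (Qplus_ge0 hQ x01) x01; rewrite ger0_norm.
- have : mu.-integrable `[s, t] (EFin \o (fun x => -1 * k x)).
    by apply: integrable_mulr => //; exact: k_integrable.
  by apply: eq_integrable => // x _ /=; rewrite mulN1r.
Qed.

Let f_integrable a b : 0 < a -> b < 1 -> mu.-integrable `[a, b] (EFin \o f).
Proof.
move=> a0 b1; apply: itv_bounded_integrable (f_measurable a0 b1) _.
by move=> x; exact: f_bounded.
Qed.

Let Phi_derive p : 0 < p < 1 -> is_derive p 1 Phi (f p).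
Proof.
move=> /andP[p0 p1].
have a0 : 0 < p / 2 by lra.
have b1 : (p + 1) / 2 < 1 by lra.
apply: primitive_is_derive (f_integrable a0 b1) (Phi_primitive a0 b1) _ _.
  by apply/andP; split; lra.
by apply: f_continuous; rewrite p0.
Qed.

(** The equation gives this almost everywhere. By continuity a negative value would persist on a
    ball, which would then be contained in a null set. *)
Let Phi_ge0 p : 0 < p < 1 -> 0 <= Phi p.
Proof.
move=> p01; rewrite leNgt; apply/negP => Pp.
have cPhi : {for p, continuous Phi}.
  apply: differentiable_continuous; apply/derivable1_diffP; exact: (Phi_derive p01).(ex_derive).
have nn : \forall x \near p, Phi x < 0.
  have /cvgrPdist_lt /(_ (- Phi p)) := cPhi; rewrite oppr_gt0 => /(_ Pp).
  by apply: filterS => x; rewrite ltr_norml => /andP[]; lra.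
have x01 := near_itvoo01 p01.
have /nbhs_ballP[r /= r0 Hr] : \forall x \near p, Phi x < 0 /\ 0 < x < 1 by near=> x; split; near: x.
have [N [mN N0 subN]] := ode.
have : ball p r `<=` N.
  move=> x /Hr [Px x01']; apply: subN => /= h.
  have [_ hm _] := h x01'.
  by move: Px; rewrite ltNge => /negP; apply; rewrite -hm ge_min /Phi lexx orbT.
move=> bN.
have : mu (ball p r) = 0%E by apply: (subset_measure0 _ mN bN N0); exact: measurable_ball.
by rewrite lebesgue_measure_ball ?ltW// => /eqP; rewrite eqe mulrn_eq0/= gt_eqF.
Unshelve. all: by end_near. Qed.

(** Integrating the almost everywhere derivative of the product is legitimate because [Q] is
    absolutely continuous on [[a, b]]; a singular part of [Q] would be lost here. *)
Let Phi_mul_Q a b : 0 < a -> a <= b -> b < 1 ->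
  Phi b * Q b - Phi a * Q a = \int[mu]_(x in `[a, b]) (f x * Q x).
Proof.
move=> a0 ab b1.
have Qb x : a <= x <= b -> `|Q x| <= Q b.
  move=> axb; rewrite ger0_norm ?(Qplus_ge0 hQ) ?(in01 a0 b1)//.
  by move: axb => /andP[ax xb]; apply: Qnd => //; lra.
have PhiL := primitive_lipschitz (f_integrable a0 b1) (Phi_primitive a0 b1)
  (fun x => @f_bounded a b x a0 b1).
(* [acM] takes one bound for both factors: the first two terms bound Phi, the last one bounds
   [Q]. *)
pose MP := `|Phi a| + (U0 + k a) * (b - a) + Q b.
have L0 : 0 <= U0 + k a by apply: le_trans (f_bounded a0 b1 (x := a) _); rewrite ?lexx.
have Qb0 : 0 <= Q b by apply: le_trans (Qb a _); rewrite ?lexx.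
apply: (@ac_primitive _ (fun x => f x * Q x) (Phi \* Q) a b ((U0 + k a) * Q b)) => //.
- apply: measurable_funM; first exact: f_measurable.
  exact: measurable_fun_sub_oo (Qplus_measurable hQ).
- by move=> x axb; rewrite normrM ler_pM// ?Qb// (f_bounded a0 b1).
- move=> x /andP[ax xb]; have x01 : 0 < x < 1 by apply/andP; split; lra.
  by apply: cvgM; [exact: f_continuous|exact: Qcont].
- apply: (@acM _ _ _ _ _ MP).
  + move=> x /andP[ax xb].
    have h1 := PhiL a x (lexx a) ax xb.
    have h2 : (U0 + k a) * (x - a) <= (U0 + k a) * (b - a) by rewrite ler_wpM2l// lerB.
    have h3 : `|Phi x| <= `|Phi x - Phi a| + `|Phi a|.
      by rewrite -[X in `|X| <= _](subrK (Phi a)) ler_normD.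
    by rewrite /MP; lra.
  + move=> x axb; apply: (le_trans (Qb x axb)); rewrite /MP lerDr addr_ge0//.
    by rewrite mulr_ge0// subr_ge0.
  + exact: lipschitz_ac PhiL.
  + exact: Qac.
- move: ode; apply: ae_lebesgue_mono => x odex /andP[ax xb].
  have x01 : 0 < x < 1 by apply/andP; split; lra.
  have [dQ mQ _] := odex x01.
  (* Complementary slackness: the minimum of the two factors is zero, so one of them is. *)
  have zero : Phi x * 'D_1 Q x = 0.
    by move: mQ; rewrite derive1E -/(Phi x); case: leP => _ ->; rewrite ?mul0r ?mulr0.
  have dM := is_deriveM (Phi_derive x01) (derivableP dQ).
  apply: is_derive_eq dM _.
  by rewrite -[LHS]/(Phi x * 'D_1 Q x + Q x * f x) zero add0r mulrC.
Qed.

(** This means that [H b] is nonpositive: [H] increases since [v] is nonnegative, and it is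
    Lipschitz up to 1, where it vanishes. The integral formula for [H] stops short of 1, so a point
    [c] close to 1 is interposed. *)
Let Phi_le_tail b : 0 < b < 1 -> Phi b <= tail b.
Proof.
move=> /andP[b0 b1]; rewrite /Phi gerDr leNgt; apply/negP => Hb.
have L1 : 0 < `|LH| + 1 by rewrite ltr_wpDl.
(* Thanks to the factor 1/2 the Lipschitz bound gives at most [H b / 2] for [H c], against
   [H b <= H c]. *)
pose d := Num.min (1 - b) (H b / (`|LH| + 1)) / 2.
have d0 : 0 < d by rewrite divr_gt0// lt_min subr_gt0 b1 divr_gt0.
have d1 : 2 * d <= 1 - b by rewrite /d mulrC divfK// ge_min lexx.
have d2 : 2 * d <= H b / (`|LH| + 1) by rewrite /d mulrC divfK// ge_min lexx orbT.
pose c := 1 - d.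
have bc : b <= c by rewrite /c; lra.
have c1 : c < 1 by rewrite /c; lra.
have h1 : H b <= H c.
  rewrite -subr_ge0 (H_primitive b0 c1)//; apply: Rintegral_ge0 => x /=.
  rewrite in_itv/= => /(in01 b0 c1) x01.
  by have /andP[] := cp_v_bounds cp (Qplus_ge0 hQ x01) x01.
have h2 : `|H 1 - H c| <= LH * (1 - c) by apply: HL; lra.
have h3 : LH * (1 - c) <= (`|LH| + 1) * d.
  by rewrite /c opprB addrC subrK ler_wpM2r ?(ltW d0)// (le_trans (ler_norm _))// lerDl.
have h4 : (`|LH| + 1) * (2 * d) <= H b by rewrite mulrC -ler_pdivlMr.
move: h2; rewrite H1 sub0r normrN => /(le_trans (ler_norm _)) h2.
have : 0 < (`|LH| + 1) * d by rewrite mulr_gt0.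
lra.
Qed.

Lemma ode_cost_min Q' : Qplus Q' -> (cost Q <= cost Q')%E.
Proof.
move=> hQ'.
apply: (integral_oo_le (cp_pb cp)).
- exact: cost_density_measurable.
- by move=> x; exact: cost_density_ge0.
move=> a b a0 apb pbb b1.
have ab : a <= b by exact: le_trans pbb.
have b0 : 0 < b by lra.
have b01 : 0 < b < 1 by rewrite b0.
have Q'b0 := Qplus_ge0 hQ' b01.
have mQ'0 := Qplus_measurable hQ'.
have mQ' : measurable_fun `[a, b] Q' by exact: measurable_fun_sub_oo mQ'0.
have mQ : measurable_fun `[a, b] Q by exact: measurable_fun_sub_oo (Qplus_measurable hQ).
have mf := f_measurable a0 b1.
have prodI (g : R -> R) : Qplus g ->
    mu.-integrable `[a, b] (EFin \o (fun x => f x * g x)).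
  move=> hg; apply: (@itv_bounded_integrable _ _ _ _ ((U0 + k a) * g b)).
    apply: measurable_funM => //; exact: measurable_fun_sub_oo (Qplus_measurable hg).
  move=> x axb; have x01 := in01 a0 b1 axb.
  rewrite normrM ler_pM ?(f_bounded a0 b1)// ger0_norm ?(Qplus_ge0 hg)//.
  by case: hg => _ + _; move: axb => /andP[ax xb]; apply; lra.
have real_le : \int[mu]_(x in `[a, b]) cost_density Q x <=
    \int[mu]_(x in `[a, b]) cost_density Q' x + tail b * Q' b.
  have e1 : \int[mu]_(x in `[a, b]) (f x * Q' x) <= Phi b * Q' b.
    apply: (primitive_monotone_le ab mf (fun x => @f_bounded a b x a0 b1)
      (Phi_primitive a0 b1)).
    - by move=> x /(in01 a0 b1); exact: Phi_ge0.
    - by move=> x y ax xy yb; case: hQ' => _ + _; apply; lra.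
    - by apply: (Qplus_ge0 hQ'); apply/andP; split; lra.
  have e2 := Phi_mul_Q a0 ab b1.
  rewrite [Q a]Qpb ?a0// mulr0 subr0 in e2.
  have e3 : 0 <= Phi b * Q b by rewrite mulr_ge0 ?Phi_ge0 ?(Qplus_ge0 hQ).
  have e4 : Phi b * Q' b <= tail b * Q' b by rewrite ler_wpM2r// Phi_le_tail.
  have jI g : Qplus g -> mu.-integrable `[a, b] (EFin \o cost_density g).
    by move=> hg; exact: cost_density_integrable.
  have fI : mu.-integrable `[a, b] (EFin \o (fun x => f x * Q' x - f x * Q x)).
    by apply: integrable_subr; [|exact: prodI|exact: prodI].
  have : \int[mu]_(x in `[a, b]) cost_density Q x <=
      \int[mu]_(x in `[a, b]) (cost_density Q' x + (f x * Q' x - f x * Q x)).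
    apply: le_Rintegral; [by []|exact: jI| |].
      by apply: integrable_addr; [|exact: jI|].
    move=> x /=; rewrite in_itv/= => /(in01 a0 b1) x01.
    have := cp_V_concave cp (Qplus_ge0 hQ x01) (Qplus_ge0 hQ' x01) x01.
    rewrite /cost_density /f; lra.
  rewrite [X in _ <= X -> _]RintegralD; [|by []|exact: jI|exact: fI].
  rewrite [X in _ <= _ + X -> _]RintegralB; [|by []|exact: prodI|exact: prodI].
  lra.
have intk := k_integrable1 b0.
have subb1 : `]b, 1[ `<=` (`[b, 1] : set R).
  by move=> x /=; rewrite !in_itv/= => /andP[/ltW -> /ltW].
apply: (@le_trans _ _ (\int[mu]_(x in `[a, b] `|` `]b, 1%R[) (cost_density Q' x)%:E)%E); last first.
  apply: ge0_subset_integral => //.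
  - exact: measurableU.
  - by apply/measurable_EFinP; exact: cost_density_measurable.
  - by move=> x /=; rewrite in_itv/= lee_fin => ?; exact: cost_density_ge0.
  - move=> x [|]/=; rewrite !in_itv/=; first exact: in01.
    by move=> /andP[bx ->]; rewrite andbT (lt_trans _ bx)// b0.
have sub01 : `]b, 1[ `<=` (`]0, 1[ : set R).
  by move=> x /=; rewrite !in_itv/= => /andP[bx ->]; rewrite andbT (lt_trans _ bx)// b0.
rewrite ge0_integral_setU//=; last 3 first.
- apply/measurable_EFinP; apply: measurable_funS (cost_density_measurable hQ') => //.
  by move=> x [|]; [exact: sub_itvcc_oo|exact: sub01].
- move=> x xab; rewrite lee_fin; apply: cost_density_ge0 => //.
  case: xab; first by rewrite /= in_itv/=; exact: in01.
  by move=> /sub01; rewrite /= in_itv.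
- apply/disj_setPS => x [] /=; rewrite !in_itv/= => /andP[_ xb] /andP[bx _].
  by move: bx; rewrite ltNge xb.
rewrite -EFin_Rintegral//; last exact: cost_density_integrable.
rewrite -EFin_Rintegral//; last exact: cost_density_integrable.
apply: (@le_trans _ _ (\int[mu]_(x in `[a, b]) cost_density Q' x + tail b * Q' b)%:E).
  by rewrite lee_fin.
rewrite EFinD leeD2l//.
have -> : tail b * Q' b = \int[mu]_(x in `]b, 1[) (Q' b * k x).
  rewrite RintegralZl//; last exact: integrableS intk.
  rewrite mulrC /tail -Rintegral_itv_obnd_cbnd; last first.
    apply: integrableS intk => //.
    by move=> x /=; rewrite !in_itv/= => /andP[/ltW -> ->].
  by rewrite -Rintegral_itv_bndo_bndc//; exact: integrableS intk.
rewrite EFin_Rintegral//; last by apply: integrable_mulr => //; exact: integrableS intk.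
apply: ge0_le_integral => //.
- move=> x /=; rewrite in_itv/= => _; rewrite lee_fin mulr_ge0// cp_k_ge0//.
- apply/measurable_EFinP/measurable_funM => //; exact: measurable_funS k_measurable.
- by apply/measurable_EFinP; apply: measurable_funS (cost_density_measurable hQ').
move=> x x1; have := sub01 _ x1; move: x1; rewrite /= !in_itv/= => /andP[bx x1] x01.
rewrite lee_fin /cost_density.
have h1 : Q' b <= Q' x by case: hQ' => _ + _; apply; rewrite ?(ltW bx) ?b0.
have h2 := cp_V_le0 cp (Qplus_ge0 hQ' x01) x01.
have h3 : Q' b * k x <= k x * Q' x by rewrite mulrC ler_wpM2l// (cp_k_ge0 cp).
lra.
Qed.

End sufficiency.

(** * Necessity: first-order conditions for a minimiser *)

Section necessity.
Variable Q : R -> R.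
Hypothesis hQ : Qplus Q.
Hypothesis opt : forall Q', Qplus Q' -> (cost Q <= cost Q')%E.

Let Qnd p q : 0 < p -> p <= q -> q < 1 -> Q p <= Q q.
Proof. by case: hQ => _ + _; apply. Qed.

Let Q0 p : 0 < p < 1 -> 0 <= Q p.
Proof. exact: Qplus_ge0. Qed.

Let mI01 : measurable (`]0%R, 1%R[ : set R).
Proof. exact: measurable_itv. Qed.

(** The zero function is admissible and costs at most [M0]. Finiteness allows the cost off a
    perturbed set to be cancelled. *)
Let cost_finite : mu.-integrable (`]0%R, 1%R[ : set R) (EFin \o cost_density Q).
Proof.
have hQ0 : Qplus (fun=> 0 : R) by split => // p _; exact: cvg_cst.
apply/integrableP; split; first by apply/measurable_EFinP; exact: cost_density_measurable.
have -> : (\int[mu]_(x in `]0%R, 1%R[) `|(EFin \o cost_density Q) x| = cost Q)%E.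
  apply: eq_integral => x; rewrite inE/= in_itv/= => x01.
  by rewrite /= ger0_norm// cost_density_ge0.
apply: (le_lt_trans (opt hQ0)).
apply: (@le_lt_trans _ _ (\int[mu]_(x in `]0%R, 1%R[) (cst M0%:E) x)%E).
  apply: ge0_le_integral => //.
  - by move=> x /=; rewrite in_itv/= lee_fin => x01; exact: cost_density_ge0.
  - by apply/measurable_EFinP; exact: cost_density_measurable.
  - move=> x /=; rewrite in_itv/= lee_fin /cost_density mulr0 sub0r => x01.
    by have := cp_V_ge cp x01; lra.
have fin : mu `]0%R, 1%R[ = 1%E.
  by rewrite lebesgue_measure_itv/= lte_fin ltr01 -EFinD subr0.
by rewrite integral_cst//= [X in (_ * X)%E]fin mule1 ltry.
Qed.

(** Localised optimality: off [D] both functions have the same finite cost, which cancels. Bounding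
    the change of density by an integrable [g] spares a separate proof that the density of the
    competitor is integrable. *)
Let compare (D : set R) (Q' g : R -> R) : measurable D -> D `<=` `]0, 1[ -> Qplus Q' ->
  (forall x, 0 < x < 1 -> ~ D x -> Q' x = Q x) ->
  mu.-integrable D (EFin \o g) ->
  (forall x, D x -> cost_density Q' x <= cost_density Q x + g x) ->
  0 <= \int[mu]_(x in D) g x.
Proof.
move=> mD D01 hQ' QQ' intg le_g.
pose E := `]0, 1[ `\` D : set R.
have mE : measurable E by exact: measurableD.
have UE : `]0, 1[%classic = E `|` D by rewrite /E setUC setDUK.
have E01 : E `<=` `]0, 1[ by move=> x [].
have DE : [disjoint E & D] by apply/disj_setPS => x [[_ nD] Dx].
have split_cost P : Qplus P -> cost P = (\int[mu]_(x in E) (cost_density P x)%:E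
    + \int[mu]_(x in D) (cost_density P x)%:E)%E.
  move=> hP; rewrite /cost UE ge0_integral_setU//.
  - by rewrite -UE; apply/measurable_EFinP; exact: cost_density_measurable.
  - by move=> x; rewrite -UE /= in_itv/= lee_fin => x01; exact: cost_density_ge0.
have intE : mu.-integrable E (EFin \o cost_density Q) by exact: integrableS cost_finite.
have intD : mu.-integrable D (EFin \o cost_density Q) by exact: integrableS cost_finite.
have := opt hQ'; rewrite !split_cost//.
have -> : (\int[mu]_(x in E) (cost_density Q' x)%:E =
           \int[mu]_(x in E) (cost_density Q x)%:E)%E.
  apply: eq_integral => x; rewrite inE => -[/= x01 nD].
  by rewrite /cost_density QQ'//; move: x01; rewrite in_itv.
rewrite leeD2lE; last exact: integrable_fin_num intE.
move=> h.
have : (\int[mu]_(x in D) (cost_density Q x)%:E <=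
        \int[mu]_(x in D) (cost_density Q x + g x)%:E)%E.
  apply: (le_trans h); apply: ge0_le_integral => //.
  - by move=> x /D01; rewrite /= in_itv/= lee_fin => x01; exact: cost_density_ge0.
  - by apply/measurable_EFinP; apply: measurable_funS (cost_density_measurable hQ').
  - apply/measurable_EFinP/measurable_funD; first exact: measurable_funS (cost_density_measurable hQ).
    by case/integrableP : intg => /measurable_EFinP.
have intS : mu.-integrable D (EFin \o (fun x => cost_density Q x + g x)).
  exact: integrable_addr.
rewrite -EFin_Rintegral// -EFin_Rintegral// lee_fin.
by rewrite [X in _ <= X -> _]RintegralD// lerDl.
Qed.

(* psi is minus the gradient of the Lagrangian at Q. *)
Let psi p := k p - v (Q p) p.

Let psi_measurable : measurable_fun (`]0%R, 1%R[ : set R) psi.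
Proof.
apply: measurable_funB => //.
by apply: (cp_v_measurable cp); [exact: Qplus_measurable|move=> p; exact: Q0].
Qed.

Let psi_bounded c x : 0 < c -> c <= x < 1 -> `|psi x| <= k c + U0.
Proof.
move=> c0 /andP[cx x1]; have x01 : 0 < x < 1 by rewrite (lt_le_trans c0).
rewrite /psi (le_trans (ler_normB _ _))// lerD//.
  by rewrite ger0_norm ?(cp_k_ge0 cp)// (cp_k_nincr cp)// ltW.
by have /andP[h1 h2] := cp_v_bounds cp (Q0 x01) x01; rewrite ger0_norm.
Qed.

Let sub_co c : 0 < c -> `[c, 1[ `<=` (`]0, 1[ : set R).
Proof. by move=> c0 x /=; rewrite !in_itv/= => /andP[cx ->]; rewrite (lt_le_trans c0). Qed.

Let co_bounded_integrable (g : R -> R) c B : 0 < c ->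
  measurable_fun (`]0%R, 1%R[ : set R) g -> (forall x, c <= x < 1 -> `|g x| <= B) ->
  mu.-integrable `[c, 1[ (EFin \o g).
Proof.
move=> c0 mg gB; have fin : (mu `[c, 1%R[ < +oo)%E.
  by rewrite lebesgue_measure_itv/=; case: ifP => // _; rewrite -EFinD ltry.
apply: measurable_bounded_integrable => //.
  by apply: measurable_funS mg => //; exact: sub_co.
exists B; split; first exact: num_real.
by move=> B' BB' x /=; rewrite in_itv/= => /gB h; exact: le_trans h (ltW BB').
Qed.

(** Directional derivative at the minimiser. The supergradient inequality is used at the perturbed
    point and then moved back to [Q] by the Lipschitz bound on [v]; the error is of order [e * e],
    so it disappears after division by [e]. Directions vanish below [c] because [k], hence [psi],
    may be unbounded at 0. *)
Let first_order (h : R -> R) c B : 0 < c -> c < 1 ->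
  measurable_fun (`]0%R, 1%R[ : set R) h ->
  (forall x, c <= x < 1 -> `|h x| <= B) -> (forall x, 0 < x -> x < c -> h x = 0) ->
  (forall e, 0 < e -> e <= 1 -> Qplus (fun x => Q x + e * h x)) ->
  0 <= \int[mu]_(x in `[c, 1[) (psi x * h x).
Proof.
move=> c0 c1 mh hB h0 hQe.
have B0 : 0 <= B by apply: le_trans (hB c _); rewrite ?lexx.
have intph : mu.-integrable `[c, 1[ (EFin \o (fun x => psi x * h x)).
  apply: (@co_bounded_integrable _ _ ((k c + U0) * B)) => //.
    exact: measurable_funM.
  by move=> x xc; rewrite normrM ler_pM// ?hB// psi_bounded.
(* A change of [v] of at most [|C| * e * B], multiplied by a displacement of at most [e * B]. *)
pose K := `|C| * B * B.
have K0 : 0 <= K by rewrite !mulr_ge0.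
have intK d : mu.-integrable `[c, 1[ (EFin \o cst d).
  by apply: (@co_bounded_integrable _ _ `|d|).
have key e : 0 < e -> e <= 1 -> 0 <= e * (\int[mu]_(x in `[c, 1[) (psi x * h x))
    + e * e * K * (1 - c).
  move=> e0 e1.
  have cE : \int[mu]_(x in `[c, 1[) (e * e * K) = e * e * K * (1 - c).
    rewrite Rintegral_itv_bndo_bndc; last exact: intK.
    by rewrite Rintegral_itv_cst// ltW.
  rewrite -cE -RintegralZl// -RintegralD//; last 2 first.
  - exact: integrable_mulr.
  - exact: intK.
  apply: (@compare `[c, 1[%classic (fun x => Q x + e * h x)) => //.
  - exact: sub_co.
  - exact: hQe.
  - move=> x /andP[x0 x1] /= /negP; rewrite in_itv/= x1 andbT -ltNge => xc.
    by rewrite h0// mulr0 addr0.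
  - apply: integrable_addr => //; last exact: intK.
    exact: integrable_mulr.
  move=> x /=; rewrite in_itv/= => xc1.
  have x01 : 0 < x < 1 by move: xc1 => /andP[? ->]; rewrite (lt_le_trans c0).
  have Qe0 : 0 <= Q x + e * h x by apply: (Qplus_ge0 (hQe _ e0 e1)).
  have h1 := cp_V_concave cp Qe0 (Q0 x01) x01.
  have h2 := cp_v_lipschitz cp Qe0 (Q0 x01) x01 x01.
  rewrite subrr normr0 addr0 in h2.
  have hb := hB _ xc1.
  have h3 : `|(v (Q x) x - v (Q x + e * h x) x) * (e * h x)| <= e * e * K.
    rewrite normrM.
    have -> : e * e * K = (`|C| * (e * B)) * (e * B) by rewrite /K; ring.
    have eh : `|e * h x| <= e * B by rewrite normrM gtr0_norm// ler_pM2l.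
    apply: ler_pM => //; apply: (le_trans h2).
    have -> : Q x - (Q x + e * h x) = - (e * h x) by ring.
    rewrite normrN; apply: (@le_trans _ _ (`|C| * `|e * h x|)).
      by rewrite ler_wpM2r// ler_norm.
    by rewrite ler_wpM2l.
  move: h3; rewrite ler_norml => /andP[_ h3].
  rewrite /cost_density /psi; lra.
set I := \int[mu]_(x in _) _ in key *.
apply/ler_addgt0Pr => d d0; rewrite addrC.
have K1 : 0 < K * (1 - c) + 1 by rewrite ltr_wpDl// mulr_ge0// subr_ge0 ltW.
pose e := Num.min 1 (d / (K * (1 - c) + 1)).
have e0 : 0 < e by rewrite lt_min ltr01 divr_gt0.
have e1 : e <= 1 by rewrite ge_min lexx.
have e2 : e * (K * (1 - c) + 1) <= d by rewrite -ler_pdivlMr// ge_min lexx orbT.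
have := key e e0 e1.
have -> : e * I + e * e * K * (1 - c) = e * (I + e * (K * (1 - c))) by ring.
rewrite pmulr_rge0//; lra.
Qed.

Let Qplus_comp (G : R -> R) : continuous G -> {homo G : x y / x <= y} ->
  (forall x, 0 <= x -> 0 <= G x) -> Qplus (G \o Q).
Proof.
move=> cG Gnd G0; have [q0 qnd qrc] := hQ; split.
- by move=> p p01; exact/G0/q0.
- by move=> p q p0 pq q1; exact/Gnd/qnd.
- by move=> p p01; apply: (cvg_comp Q G (qrc p p01)); exact: cG.
Qed.

(** Extension by zero: neither [Q] nor [v] is controlled outside the open unit interval, while the
    dual integral runs up to 1. *)
Let w p := if 0 < p < 1 then v (Q p) p else 0.

Let w_bounded p : `|w p| <= U0.
Proof.
have Hb : 0 <= U0.
  have h : 0 < (2^-1 : R) < 1 by apply/andP; split; lra.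
  by have /andP[h1 h2] := cp_v_bounds cp (Q0 h) h; exact: le_trans h2.
rewrite /w; case: ifPn => p01; last by rewrite normr0.
by have /andP[h1 h2] := cp_v_bounds cp (Q0 p01) p01; rewrite ger0_norm.
Qed.

Let w_measurable : measurable_fun [set: R] w.
Proof.
have -> : w = (fun p => v (Q p) p) \_ `]0, 1[.
  apply/funext => p; rewrite /w patchE; case: ifPn => p01.
    by rewrite mem_set//= in_itv.
  by rewrite memNset//= in_itv/=; exact/negP.
apply/(measurable_restrictT _ _).1 => //.
by apply: (cp_v_measurable cp); [exact: Qplus_measurable|move=> p; exact: Q0].
Qed.

Let w_integrable a b : mu.-integrable `[a, b] (EFin \o w).
Proof.
apply: (@itv_bounded_integrable _ _ _ _ U0); first exact: measurable_funS w_measurable.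
by move=> x _; exact: w_bounded.
Qed.

Definition dual p := - \int[mu]_(s in `[p, 1]) w s.

Let H := dual.

Let H_w_primitive a b : b <= 1 -> primitive w H a b.
Proof.
move=> b1 s t sa st tb.
rewrite /H /dual [in X in _ - X](@Rintegral_itv_split _ w s 1 t)//; last lra.
by rewrite opprK addrC addrK.
Qed.

Lemma dual_lipschitz s t : s <= t -> t <= 1 -> `|H t - H s| <= U0 * (t - s).
Proof.
move=> st t1.
by apply: (primitive_lipschitz (@w_integrable s 1) (H_w_primitive (lexx 1))
  (fun x _ => w_bounded x)).
Qed.

Lemma dual1 : H 1 = 0.
Proof. by rewrite /H /dual Rintegral_itv_point oppr0. Qed.

Let H_primitive' a b : 0 < a -> b < 1 -> primitive (fun p => v (Q p) p) H a b.
Proof.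
move=> a0 b1 s t sa st tb; rewrite (@H_w_primitive a b (ltW b1))//.
apply: eq_Rintegral => x; rewrite inE/= in_itv/= => /andP[sx xt]; rewrite /w ifT//.
by apply/andP; split; lra.
Qed.

Let Phi p := H p + tail p.

Let Phi_primitive' a b : 0 < a -> b < 1 -> primitive (fun p => - psi p) Phi a b.
Proof.
move=> a0 b1 s t sa st tb.
have s0 : 0 < s by lra.
have t1 : t < 1 by lra.
have -> : Phi t - Phi s = (H t - H s) + (tail t - tail s) by rewrite /Phi; ring.
rewrite (@H_w_primitive a b (ltW b1))// (tail_primitive a0 b1)// -RintegralD//.
- apply: eq_Rintegral => x; rewrite inE/= in_itv/= => /andP[sx xt].
  by rewrite /w ifT ?/psi; [ring|apply/andP; split; lra].
- have : mu.-integrable `[s, t] (EFin \o (fun x => -1 * k x)).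
    by apply: integrable_mulr => //; exact: k_integrable.
  by apply: eq_integrable => // x _ /=; rewrite mulN1r.
Qed.

(** The point 1 is removed because [psi] is unconstrained there, whereas [w] was set to zero. *)
Let Phi_tail p : 0 < p -> p < 1 -> Phi p = \int[mu]_(x in `[p, 1[) psi x.
Proof.
move=> p0 p1.
have kI : mu.-integrable `[p, 1[ (EFin \o k).
  apply: integrableS (k_integrable1 p0) => //.
  by move=> x /=; rewrite !in_itv/= => /andP[-> /ltW].
have wI : mu.-integrable `[p, 1[ (EFin \o w).
  apply: integrableS (@w_integrable p 1) => //.
  by move=> x /=; rewrite !in_itv/= => /andP[-> /ltW].
rewrite /Phi /H /dual /tail addrC -[in X in X - _]Rintegral_itv_bndo_bndc//.
rewrite -[in X in _ - X]Rintegral_itv_bndo_bndc// -RintegralB//.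
apply: eq_Rintegral => x; rewrite inE/= in_itv/= => /andP[px x1].
by rewrite /w /psi ifT// x1 andbT (lt_le_trans p0).
Qed.

Let Phi_nonneg p : 0 < p < 1 -> 0 <= Phi p.
Proof.
move=> /andP[p0 p1]; rewrite Phi_tail//.
pose h x : R := if p <= x then 1 else 0.
have -> : \int[mu]_(x in `[p, 1[) psi x = \int[mu]_(x in `[p, 1[) (psi x * h x).
  by apply: eq_Rintegral => x; rewrite inE/= in_itv/= /h => /andP[-> _]; rewrite mulr1.
have h01 x : 0 <= h x <= 1 by rewrite /h; case: ifP; rewrite ?lexx ler01.
have hnd x y : x <= y -> h x <= h y.
  move=> xy; rewrite /h; case: ifPn => [px|_]; first by rewrite (le_trans px xy).
  by case: ifP.
apply: (@first_order h p 1) => //.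
- exact: nondecreasing_measurable.
- by move=> x _; have /andP[h1 h2] := h01 x; rewrite ger0_norm.
- by move=> x _ xp; rewrite /h leNgt xp.
move=> e e0 e1; split.
- move=> x x01; rewrite addr_ge0 ?Q0// mulr_ge0 ?(ltW e0)//.
  by have /andP[] := h01 x.
- by move=> x y x0 xy y1; rewrite lerD ?Qnd// ler_pM2l// hnd.
- move=> x x01; apply: cvgD; first by case: hQ => _ _; exact.
  apply: cvg_near_cst; have [px|xp] := leP p x.
    near=> y; have xy : x <= y by near: y; exact: nbhs_right_ge.
    by rewrite /h px (le_trans px xy).
  near=> y; have yp : y < p by near: y; exact: nbhs_right_lt.
  by rewrite /h !leNgt xp yp.
Unshelve. all: by end_near. Qed.

Let psi_continuous p : 0 < p < 1 -> {for p, continuous Q} ->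
  {for p, continuous (fun p => - psi p)}.
Proof.
move=> p01 cQ; apply: cvgN; apply: cvgB; first exact: k_continuous.
exact: v_continuous.
Qed.

Let psi_integrable a b : 0 < a -> b < 1 -> mu.-integrable `[a, b] (EFin \o (fun p => - psi p)).
Proof.
move=> a0 b1; apply: (@itv_bounded_integrable _ _ _ _ (k a + U0)).
  by apply: measurable_funN; exact: measurable_fun_sub_oo psi_measurable.
by move=> x /andP[ax xb]; rewrite normrN psi_bounded// ax (le_lt_trans xb).
Qed.

Let Phi_continuous p : 0 < p < 1 -> {for p, continuous Phi}.
Proof.
move=> /andP[p0 p1].
have a0 : 0 < p / 2 by lra.
have b1 : (p + 1) / 2 < 1 by lra.
apply: (@lipschitz_continuous_at _ _ (p / 2) ((p + 1) / 2) (k (p / 2) + U0)).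
  apply: primitive_lipschitz (psi_integrable a0 b1) (Phi_primitive' a0 b1) _.
  by move=> x /andP[ax xb]; rewrite normrN psi_bounded// ax (le_lt_trans xb).
by apply/andP; split; lra.
Qed.

Let near_Phi_gt0 p : 0 < p < 1 -> 0 < Phi p -> exists2 r, 0 < r &
  forall x, `|x - p| < r -> 0 < x < 1 /\ 0 < Phi x.
Proof.
move=> p01 Pp.
have H1 : \forall x \near p, 0 < Phi x.
  have /cvgrPdist_lt /(_ _ Pp) := Phi_continuous p01.
  by apply: filterS => x; rewrite ltr_norml => /andP[]; lra.
have H2 := near_itvoo01 p01.
have : \forall x \near p, 0 < x < 1 /\ 0 < Phi x by near=> x; split; near: x.
move=> /nbhs_ballP[r /= r0 Hr]; exists r => // x xr; apply: Hr.
by rewrite /ball/= distrC.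
Unshelve. all: by end_near. Qed.

(** The competitor removes a fraction of the rise of [Q] on [[c, e]] and lowers [Q] after [e] by the
    same fraction of [Q e - Q c]. Let [m] be the minimum of Phi on [[c, e]]. The part after [e]
    contributes [- (Q e - Q c) * Phi e], the part before at most [(Phi e - m) * (Q e - Q c)], so
    optimality leaves [m * (Q e - Q c) <= 0] with [m] positive. *)
Let Q_constant c e : 0 < c -> c <= e -> e < 1 ->
  (forall x, c <= x <= e -> 0 < Phi x) -> Q c = Q e.
Proof.
move=> c0 ce e1 Ppos.
have c1 : c < 1 by lra.
have e0 : 0 < e by lra.
have [z zce zmin] : exists2 z, z \in `[c, e]%R & forall t, t \in `[c, e]%R -> Phi z <= Phi t.
  apply: EVT_min => //; apply: continuous_in_subspaceT => x.
  by rewrite inE/= in_itv/= => /(in01 c0 e1); exact: Phi_continuous.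
have m0 : 0 < Phi z by apply: Ppos; move: zce; rewrite in_itv.
set m := Phi z in m0 zmin *.
pose ga := Q c; pose be := Q e.
have gabe : ga <= be by exact: Qnd.
have ga0 : 0 <= ga by apply: Q0; rewrite c0.
(* The rise of [Q] truncated to the levels between [ga] and [be]. As [T] is nondecreasing and
   1-Lipschitz, [y - d * T y] is nondecreasing for [d <= 1]. *)
pose T y := Num.max (Num.min y be) ga - ga.
have minP u v' : u <= v' -> 0 <= Num.min v' be - Num.min u be <= v' - u.
  by move=> uv; case: (leP u be); case: (leP v' be) => *; apply/andP; split; lra.
have maxP u v' : u <= v' -> 0 <= Num.max v' ga - Num.max u ga <= v' - u.
  by move=> uv; case: (leP u ga); case: (leP v' ga) => *; apply/andP; split; lra.
have TL x y : x <= y -> 0 <= T y - T x <= y - x.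
  move=> /minP/andP[h1 h2]; have /maxP/andP[h3 h4] : Num.min x be <= Num.min y be by lra.
  by rewrite /T; apply/andP; split; lra.
have Tga y : y <= ga -> T y = 0.
  move=> yga; rewrite /T (min_idPl _) ?(max_idPr _) ?subrr//; exact: le_trans gabe.
have Tbe y : be <= y -> T y = be - ga.
  by move=> bey; rewrite /T (min_idPr bey) (max_idPl gabe).
have Tb y : 0 <= T y <= be - ga.
  apply/andP; split.
    have [yg|/ltW gy] := leP y ga; first by rewrite Tga.
    by have := TL _ _ gy; rewrite (Tga ga)// subr0 => /andP[].
  have [byy|/ltW yb] := leP be y; first by rewrite Tbe.
  by have := TL _ _ yb; rewrite (Tbe be)// => /andP[]; lra.
have TQ_nd x y : 0 < x -> x <= y -> y < 1 -> T (Q x) <= T (Q y).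
  by move=> x0 xy y1; rewrite -subr_ge0; have /TL/andP[] := Qnd x0 xy y1.
have mTQ : measurable_fun (`]0%R, 1%R[ : set R) (T \o Q).
  apply: interval_nondecreasing_measurable; first exact: interval_is_interval.
  by move=> x y /=; rewrite !in_itv/= => /andP[x0 x1] /andP[y0 y1] xy; exact: TQ_nd.
have : 0 <= \int[mu]_(x in `[c, 1[) (psi x * - T (Q x)).
  apply: (@first_order (fun x => - T (Q x)) c (be - ga)) => //.
  - exact: measurable_funN.
  - by move=> x _; have /andP[h1 h2] := Tb (Q x); rewrite normrN ger0_norm.
  - by move=> x x0 xc; rewrite Tga ?oppr0//; apply: Qnd => //; exact: ltW.
  move=> d d0 d1.
  pose G y := y + d * - T y.
  have GL x y : x <= y -> 0 <= G y - G x <= 1 * (y - x).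
    move=> xy; have /andP[h1 h2] := TL _ _ xy.
    have h3 : d * (T y - T x) <= T y - T x by rewrite ler_piMl.
    have h4 : 0 <= d * (T y - T x) by rewrite mulr_ge0// ltW.
    by rewrite /G; apply/andP; split; lra.
  apply: (@Qplus_comp G).
  - move=> y; apply: (@lipschitz_continuous_at _ G (y - 1) (y + 1) 1); last by lra.
    by move=> s t _ st _; have /andP[h1 h2] := GL _ _ st; rewrite ger0_norm.
  - by move=> x y /GL/andP[]; rewrite subr_ge0.
  - move=> y /GL/andP[+ _]; rewrite subr_ge0; apply: le_trans.
    by rewrite /G Tga// oppr0 mulr0 addr0.
have intS : mu.-integrable `[c, 1[ (EFin \o (fun x => - psi x * T (Q x))).
  apply: (@co_bounded_integrable _ _ ((k c + U0) * (be - ga))) => //.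
    by apply: measurable_funM => //; exact: measurable_funN.
  move=> x xc; rewrite normrM normrN ler_pM// ?psi_bounded//.
  by have /andP[h1 h2] := Tb (Q x); rewrite ger0_norm.
have -> : \int[mu]_(x in `[c, 1[) (psi x * - T (Q x)) =
    \int[mu]_(x in `[c, 1[) (- psi x * T (Q x)).
  by apply: eq_Rintegral => x _; rewrite mulrN mulNr.
have := @Rintegral_itvB R _ (BLeft c) (BLeft 1) e intS.
rewrite !bnd_simp => /(_ ce e1).
rewrite Rintegral_itv_obnd_cbnd; last first.
  apply: integrableS intS => //.
  by move=> x /=; rewrite !in_itv/= => /andP[/ltW ex ->]; rewrite (le_trans ce).
have -> : \int[mu]_(x in `[e, 1[) (- psi x * T (Q x)) = - (be - ga) * Phi e.
  rewrite Phi_tail// -RintegralZl//; last first.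
    apply: (@co_bounded_integrable _ _ (k e + U0)) => // x xe.
    exact: psi_bounded.
  apply: eq_Rintegral => x; rewrite inE/= in_itv/= => /andP[ex x1].
  by rewrite Tbe; [ring|exact: Qnd].
have : \int[mu]_(x in `[c, e]) (- psi x * T (Q x)) <= (Phi e - m) * T (Q e).
  (* Shifting the primitive by [m] keeps it nonnegative on [[c, e]] and produces the decisive term
     in [m]. *)
  apply: (@primitive_monotone_le _ _ (fun x => Phi x - m) (T \o Q) c e (k c + U0)) => //.
  - by apply: measurable_funN; exact: measurable_fun_sub_oo psi_measurable.
  - by move=> x /andP[ax xb]; rewrite normrN psi_bounded// ax (le_lt_trans xb).
  - move=> s t cs st te; rewrite -(Phi_primitive' c0 e1)//; ring.
  - by move=> x xce; rewrite subr_ge0; apply: zmin; rewrite in_itv.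
  - by move=> x y cx xy ye; apply: TQ_nd => //; lra.
  - by rewrite /= Tga.
rewrite (Tbe be)// => h1 h2 h3.
have : m * (be - ga) <= 0 by lra.
rewrite pmulr_rle0// subr_le0 => h4.
by apply/eqP; rewrite eq_le gabe h4.
Qed.

(** * Continuity of the minimiser and its contact points *)

Let v_nincr x y p : 0 <= x -> x <= y -> 0 < p < 1 -> v y p <= v x p.
Proof.
move=> x0 xy p01; have [c c0 Hc] := cp_v_decr cp y.
have := Hc x y p x0 xy (lexx y) p01.
have : 0 <= c * (y - x) by rewrite mulr_ge0 ?subr_ge0// ltW.
lra.
Qed.

Let v_time x p q : 0 <= x -> 0 < p < 1 -> 0 < q < 1 -> p <= q ->
  v x q - v x p <= `|C| * (q - p).
Proof.
move=> x0 p01 q01 pq; apply: (le_trans (ler_norm _)).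
apply: (le_trans (cp_v_lipschitz cp x0 x0 p01 q01)).
rewrite subrr normr0 add0r (_ : `|q - p| = q - p); last by rewrite ger0_norm// subr_ge0.
by rewrite ler_wpM2r ?subr_ge0// ler_norm.
Qed.

Let k_local p : 0 < p < 1 -> exists2 L, 0 <= L & forall x y,
  p / 2 <= x -> x <= y -> y <= (p + 1) / 2 -> k x - k y <= L * (y - x).
Proof.
move=> /andP[p0 p1].
have [L HL] := cp_k_lipschitz cp (divr_gt0 p0 (ltr0n R 2)) (midf_lt p1).2.
exists `|L| => // x y px xy yp; have := HL x y px xy yp.
rewrite ler_norml => /andP[h _].
have : L * (y - x) <= `|L| * (y - x) by rewrite ler_wpM2r ?subr_ge0// ler_norm.
lra.
Qed.

Let small_step (K g d1 : R) : 0 <= K -> 0 < g -> 0 < d1 ->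
  exists d, [/\ 0 < d, d <= d1 & K * d <= g].
Proof.
move=> K0 g0 d10; exists (Num.min d1 (g / (K + 1))); split.
- by rewrite lt_min d10 divr_gt0// ltr_wpDl.
- by rewrite ge_min lexx.
- apply: (@le_trans _ _ ((K + 1) * Num.min d1 (g / (K + 1)))).
    by rewrite ler_wpM2r ?lerDl// le_min (ltW d10)/= divr_ge0 ?(ltW g0)// addr_ge0.
  by rewrite mulrC -ler_pdivlMr ?ltr_wpDl// ge_min lexx orbT.
Qed.

(** Phi cannot decrease to the right of a zero. Continuity of [Q] is not yet available, but
    monotonicity bounds [v (Q x) x] from above for [x >= p], so a strict gap would keep the slope of
    Phi below [- g] on a short interval. *)
Let contact_right p : 0 < p < 1 -> Phi p = 0 -> k p <= v (Q p) p.
Proof.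
move=> p01 Pp; rewrite leNgt; apply/negP => gap.
have /andP[p0 p1] := p01.
have [L L0 HL] := k_local p01.
pose g := (k p - v (Q p) p) / 2.
have g0 : 0 < g by rewrite divr_gt0// subr_gt0.
have d1 : 0 < (1 - p) / 2 by rewrite divr_gt0// subr_gt0.
have [d [d0 dd1 Kd]] := small_step (addr_ge0 (normr_ge0 C) L0) g0 d1.
have pd1 : p + d < 1 by lra.
have psi_le x : p <= x <= p + d -> - psi x <= - g.
  move=> /andP[px xd]; have x01 : 0 < x < 1 by apply/andP; split; lra.
  have h1 : v (Q x) x <= v (Q p) x by apply: v_nincr => //; [exact: Q0|apply: Qnd => //; lra].
  have h2 := v_time (Q0 p01) p01 x01 px.
  have h3 : k p - k x <= L * (x - p) by apply: HL; lra.
  have h4 : (`|C| + L) * (x - p) <= (`|C| + L) * d by rewrite ler_wpM2l ?addr_ge0//; lra.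
  have h5 : 2 * g = k p - v (Q p) p by rewrite /g; field.
  rewrite /psi; lra.
have := Phi_primitive' p0 pd1 (lexx p) (ltW (ltr_pwDr d0 (lexx p))) (lexx _).
rewrite Pp subr0 => PE.
have : Phi (p + d) <= - g * (p + d - p).
  rewrite PE; apply: Rintegral_itv_le_cst => //; first exact: psi_integrable.
  lra.
rewrite addrAC subrr add0r.
have : 0 <= Phi (p + d) by apply: Phi_nonneg; apply/andP; split; lra.
have : 0 < g * d by rewrite mulr_gt0.
lra.
Qed.

(** A jump at [p] forces [Phi p = 0], since [Q] is constant around points where Phi is positive.
    Left of the jump [v] exceeds its value at [Q p] by at least [c * e], while [contact_right] gives
    [k p <= v (Q p) p]; hence Phi would rise to zero at a positive rate and be negative before
    [p]. *)
Let Q_left p e : 0 < p < 1 -> 0 < e -> exists2 q, 0 < q < p & Q p - Q q <= e.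
Proof.
move=> p01 e0; apply: contrapT => nq.
have jump q : 0 < q -> q < p -> e < Q p - Q q.
  by move=> q0 qp; rewrite ltNge; apply/negP => h; apply: nq; exists q; rewrite ?q0.
have /andP[p0 p1] := p01.
have Pp : Phi p = 0.
  apply/eqP; rewrite eq_le Phi_nonneg// andbT leNgt; apply/negP => Pp.
  have [r r0 Hr] := near_Phi_gt0 p01 Pp.
  pose q := p - r / 2.
  have qr : `|q - p| < r by rewrite /q addrAC subrr sub0r normrN gtr0_norm; lra.
  have [/andP[q0 q1] _] := Hr _ qr.
  have : Q q = Q p.
    apply: Q_constant => //; first by rewrite /q; lra.
    move=> x /andP[qx xp]; apply: (Hr _ _).2; rewrite ler0_norm; [rewrite /q in qx; lra|lra].
  have := jump q q0; rewrite /q; lra.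
have kv := contact_right p01 Pp.
have [c c0 Hc] := cp_v_decr cp (Q p).
have [L L0 HL] := k_local p01.
have ce0 : 0 < c * e / 2 by rewrite divr_gt0// mulr_gt0.
have d1 : 0 < p / 2 by rewrite divr_gt0.
have [d [d0 dd1 Kd]] := small_step (addr_ge0 (normr_ge0 C) L0) ce0 d1.
pose q := p - d.
have q0 : 0 < q by rewrite /q; lra.
(* The point [p] is excluded because [Q] has already jumped there; this is why the integrals below
   are taken over [[q, p[]. Half of [c * e] absorbs the variation of [k] and of [v] in its second
   argument. *)
have psi_ge x : q <= x < p -> c * e / 2 <= - psi x.
  move=> /andP[qx xp]; have x01 : 0 < x < 1 by apply/andP; split; lra.
  have xd : p - x <= d by rewrite /q in qx; lra.
  have x0 : 0 < x by lra.
  have h1 : c * (Q p - Q x) <= v (Q x) x - v (Q p) x.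
    by apply: Hc => //; [exact: Q0|apply: Qnd => //; exact: ltW].
  have h2 : c * e <= c * (Q p - Q x) by rewrite ler_pM2l// ltW// jump.
  have h3 := v_time (Q0 p01) x01 p01 (ltW xp).
  have h4 : k x - k p <= L * (p - x) by apply: HL; lra.
  have h5 : (`|C| + L) * (p - x) <= (`|C| + L) * d by rewrite ler_wpM2l ?addr_ge0.
  rewrite /psi; lra.
have qp : q <= p by rewrite /q; lra.
have PE := Phi_primitive' q0 p1 (lexx q) qp (lexx p).
have intq : mu.-integrable `[q, p] (EFin \o (fun x => - psi x)) by exact: psi_integrable.
have subqp : `[q, p[ `<=` (`[q, p] : set R).
  by move=> x /=; rewrite !in_itv/= => /andP[-> /ltW].
have intqo : mu.-integrable `[q, p[ (EFin \o (fun x => - psi x)) by exact: integrableS intq.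
have intc : mu.-integrable `[q, p] (EFin \o cst (c * e / 2)).
  by apply: (@itv_bounded_integrable _ _ _ _ `|c * e / 2|).
have : c * e / 2 * (p - q) <= Phi p - Phi q.
  rewrite PE -Rintegral_itv_cst// -Rintegral_itv_bndo_bndc; last exact: integrableS intc.
  rewrite -[leRHS]Rintegral_itv_bndo_bndc//.
  apply: le_Rintegral; [by []|exact: integrableS intc|exact: intqo|].
  by move=> x; rewrite /= in_itv/=; exact: psi_ge.
have : 0 <= Phi q by apply: Phi_nonneg; apply/andP; split; lra.
have : 0 < c * e / 2 * (p - q) by rewrite mulr_gt0// /q; lra.
lra.
Qed.

Lemma optimal_continuous p : 0 < p < 1 -> {for p, continuous Q}.
Proof.
move=> p01; have /andP[p0 p1] := p01; apply/cvgrPdist_le => e e0.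
have [q /andP[q0 qp] Qq] := Q_left p01 e0.
have : Q x @[x --> p^'+] --> Q p by case: hQ => _ _; exact.
move/cvgrPdist_le => /(_ e e0); rewrite near_withinE => /nbhs_ballP[r /= r0 Hr].
apply/nbhs_ballP; exists (Num.min r (p - q)); first by rewrite /= lt_min r0 subr_gt0.
move=> x; rewrite /ball/= lt_min => /andP[xr xq].
have [px|xp] := ltP p x; first exact: Hr.
have qx : q <= x by move: xq; rewrite ltr_norml => /andP[]; lra.
have h1 : Q x <= Q p by apply: Qnd => //; lra.
have h2 : Q q <= Q x by apply: Qnd => //; lra.
by rewrite ger0_norm; lra.
Qed.

Let Phi_derive' p : 0 < p < 1 -> is_derive p 1 Phi (- psi p).
Proof.
move=> p01; have /andP[p0 p1] := p01.
have a0 : 0 < p / 2 by lra.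
have b1 : (p + 1) / 2 < 1 by lra.
apply: (primitive_is_derive (psi_integrable a0 b1) (Phi_primitive' a0 b1)).
  by apply/andP; split; lra.
by apply: psi_continuous => //; exact: optimal_continuous.
Qed.

(** A zero of Phi is an interior minimum, and the derivative [v (Q p) p - k p] exists now that [Q]
    is continuous. A positive derivative would make Phi negative just to the left. *)
Let contact p : 0 < p < 1 -> Phi p = 0 -> v (Q p) p = k p.
Proof.
move=> p01 Pp; have kv := contact_right p01 Pp.
apply/eqP; rewrite eq_le kv andbT leNgt; apply/negP => gap.
have /is_derive1_approxP dP := Phi_derive' p01.
have g0 : 0 < (- psi p) / 2 by rewrite /psi; lra.
have [r r0 Hr] := dP _ g0.
have /andP[p0 p1] := p01.
have d0 : 0 < Num.min (r / 2) (p / 2) by rewrite lt_min; lra.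
set d := Num.min _ _ in d0.
have d1 : d <= r / 2 by rewrite ge_min lexx.
have d2 : d <= p / 2 by rewrite ge_min lexx orbT.
have dE : p - d - p = - d by ring.
have := Hr (p - d); rewrite dE normrN (gtr0_norm d0) => /(_ _) H'.
have : `|Phi (p - d) - Phi p - - psi p * - d| <= - psi p / 2 * d by apply: H'; lra.
rewrite Pp subr0 ler_norml => /andP[_].
have : 0 <= Phi (p - d) by apply: Phi_nonneg; apply/andP; split; lra.
have : 0 < (- psi p) / 2 * d by rewrite mulr_gt0.
lra.
Qed.

Let Q_near p e : 0 < p < 1 -> 0 < e -> exists2 r, 0 < r &
  forall x, `|x - p| < r -> `|Q x - Q p| < e.
Proof.
move=> p01 e0; have := optimal_continuous p01.
move/cvgrPdist_lt => /(_ e e0)/nbhs_ballP[r /= r0 Hr]; exists r => // x xr.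
by rewrite distrC; apply: Hr; rewrite /ball/= distrC.
Qed.

(* The last point of a level set of Q, and dually the first one, is a contact
   point of the obstacle. *)
Let contact_after s t : 0 < s -> s <= t -> t < 1 -> Q s < Q t ->
  exists i, [/\ s <= i, i <= t, Q i = Q s & Phi i = 0].
Proof.
move=> s0 st t1 Qst.
pose S := [set x | s <= x <= t /\ Q x <= Q s].
have Ss : S s by rewrite /S/= lexx st.
have hS : has_sup S by split; [exists s|exists t => x [/andP[]]].
pose i := sup S.
have si : s <= i by exact: sup_upper_bound hS _ Ss.
have it : i <= t by apply: ge_sup; [exists s|move=> x [/andP[]]].
have i01 : 0 < i < 1 by apply/andP; split; lra.
have /andP[i0 i1] := i01.
have Qi : Q i <= Q s.
  rewrite leNgt; apply/negP => h.
  have d0 : 0 < Q i - Q s by rewrite subr_gt0.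
  have [r r0 Hr] := Q_near i01 d0.
  have [x [/andP[sx xt] Qx] ix] := sup_adherent r0 hS.
  have xi : x <= i by apply: sup_upper_bound hS _ _; rewrite /S/= sx xt.
  rewrite -/i in ix.
  have xr : `|x - i| < r by rewrite ler0_norm ?subr_le0//; lra.
  by have := Hr _ xr; rewrite ltr_norml => /andP[]; lra.
have Qis : Q i = Q s by apply/eqP; rewrite eq_le Qi Qnd.
exists i; split => //.
apply/eqP; rewrite eq_le Phi_nonneg// andbT leNgt; apply/negP => Pi.
(* Where Phi is positive [Q] is locally constant, so the level of [Q s] would extend beyond its
   supremum. *)
have [r r0 Hr] := near_Phi_gt0 i01 Pi.
have ilt : i < t by rewrite lt_neqAle it andbT; apply/eqP => h; move: Qst; rewrite -h; lra.
pose y := Num.min t (i + r / 2).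
have iy : i < y by rewrite lt_min ilt; lra.
have yr : y <= i + r / 2 by rewrite ge_min lexx orbT.
have yt : y <= t by rewrite ge_min lexx.
have Qiy : Q i = Q y.
  apply: Q_constant => //; [exact: ltW|lra|].
  move=> x /andP[ix xy]; have xr : `|x - i| < r by rewrite ger0_norm; lra.
  by have [] := Hr _ xr.
have : y <= i by apply: sup_upper_bound hS _ _; rewrite /S/= yt -Qiy Qi; split => //; lra.
lra.
Qed.

Let contact_before s t : 0 < s -> s <= t -> t < 1 -> Q s < Q t ->
  exists i, [/\ s <= i, i <= t, Q i = Q t & Phi i = 0].
Proof.
move=> s0 st t1 Qst.
pose S := [set x | s <= x <= t /\ Q t <= Q x].
have St : S t by rewrite /S/= lexx st.
have hS : has_inf S by split; [exists t|exists s => x [/andP[]]].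
pose i := inf S.
have it : i <= t by exact: ge_inf hS.2 _ St.
have si : s <= i by apply: lb_le_inf; [exists t|move=> x [/andP[]]].
have i01 : 0 < i < 1 by apply/andP; split; lra.
have /andP[i0 i1] := i01.
have Qi : Q t <= Q i.
  rewrite leNgt; apply/negP => h.
  have d0 : 0 < Q t - Q i by rewrite subr_gt0.
  have [r r0 Hr] := Q_near i01 d0.
  have [x [/andP[sx xt] Qx] ix] := inf_adherent r0 hS.
  have xi : i <= x by apply: ge_inf hS.2 _ _; rewrite /S/= sx xt.
  rewrite -/i in ix.
  have xr : `|x - i| < r by rewrite ger0_norm ?subr_ge0//; lra.
  by have := Hr _ xr; rewrite ltr_norml => /andP[]; lra.
have Qit : Q i = Q t by apply/eqP; rewrite eq_le Qi Qnd.
exists i; split => //.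
apply/eqP; rewrite eq_le Phi_nonneg// andbT leNgt; apply/negP => Pi.
have [r r0 Hr] := near_Phi_gt0 i01 Pi.
have ilt : s < i by rewrite lt_neqAle si andbT; apply/eqP => h; move: Qst; rewrite h; lra.
pose y := Num.max s (i - r / 2).
have iy : y < i by rewrite gt_max ilt; lra.
have yr : i - r / 2 <= y by rewrite le_max lexx orbT.
have sy : s <= y by rewrite le_max lexx.
have Qyi : Q y = Q i.
  apply: Q_constant => //; [lra|exact: ltW|].
  move=> x /andP[yx xi]; have xr : `|x - i| < r by rewrite ler0_norm; lra.
  by have [] := Hr _ xr.
have : i <= y by apply: ge_inf hS.2 _ _; rewrite /S/= sy Qyi Qi; split => //; lra.
lra.
Qed.

(** Passing from [s] and [t] to the contact points [s'] and [t'] keeps the increment of [Q] and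
    shortens the interval. At contact points v equals [k], so strong decrease of [v] bounds the
    increment of [Q] by the variations of [k] and of [v] in its second argument. *)
Lemma optimal_lipschitz a b : 0 < a -> a <= b -> b < 1 -> exists K, forall s t,
  a <= s -> s <= t -> t <= b -> 0 <= Q t - Q s <= K * (t - s).
Proof.
move=> a0 ab b1.
have [c c0 Hc] := cp_v_decr cp (Q b).
have [L HL] := cp_k_lipschitz cp a0 b1.
pose K := (`|L| + `|C|) / c; exists K => s t sa st tb.
have K0 : 0 <= K by rewrite divr_ge0// ?addr_ge0// ltW.
have Qst : Q s <= Q t by apply: Qnd; lra.
rewrite subr_ge0 Qst/=.
have [Qlt|Qge] := ltP (Q s) (Q t); last first.
  by apply: (@le_trans _ _ 0); [rewrite subr_le0|rewrite mulr_ge0// subr_ge0].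
have s0 : 0 < s by lra.
have t1 : t < 1 by lra.
have [s' [ss' s't Qs' Ps']] := contact_after s0 st t1 Qlt.
have [t' [st' t't Qt' Pt']] := contact_before s0 st t1 Qlt.
have s't' : s' <= t'.
  rewrite leNgt; apply/negP => h.
  have : Q t' <= Q s' by apply: Qnd; lra.
  by rewrite Qs' Qt' leNgt Qlt.
have s'01 : 0 < s' < 1 by apply/andP; split; lra.
have t'01 : 0 < t' < 1 by apply/andP; split; lra.
have h1 : c * (Q t' - Q s') <= v (Q s') t' - v (Q t') t'.
  by apply: Hc => //; [exact: Q0|apply: Qnd; lra|apply: Qnd; lra].
have h2 := v_time (Q0 s'01) s'01 t'01 s't'.
have := HL s' t' (le_trans sa ss') s't' (le_trans t't tb).
rewrite ler_norml => /andP[h3 _].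
have h4 : L * (t' - s') <= `|L| * (t' - s') by rewrite ler_wpM2r ?subr_ge0// ler_norm.
rewrite (contact s'01 Ps') in h2.
rewrite (contact t'01 Pt') in h1.
rewrite -Qs' -Qt' /K mulrAC ler_pdivlMr// mulrC.
have h5 : (`|L| + `|C|) * (t' - s') <= (`|L| + `|C|) * (t - s).
  by rewrite ler_wpM2l ?addr_ge0//; lra.
lra.
Qed.

(** The competitor is zero below [pb] and [Q] afterwards. It is nowhere dearer, because [k] is at
    least [U0] there, and it is cheaper by a fixed amount on [[p, pb[] if [Q p] is positive. The
    perturbation reaches 0, so [compare] is applied directly instead of [first_order]. *)
Let Q_zero_before p : 0 < p -> p < pb -> Q p = 0.
Proof.
move=> p0 ppb; have /andP[pb0 pb1] := cp_pb cp.
have p01 : 0 < p < 1 by rewrite p0 (lt_trans ppb).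
apply/eqP; rewrite eq_le (Q0 p01) andbT leNgt; apply/negP => q0.
pose q := Q p; have {}q0 : 0 < q by [].
have [c c0 Hc] := cp_v_decr cp q.
(* Splitting the rise from 0 to [Q x] at [q / 2]: beyond that level the supergradient has dropped by
   at least [c * (q / 2)], over a length of at least [q / 2]. *)
pose d := c * (q / 2) * (q / 2).
have d0 : 0 < d by rewrite !mulr_gt0// invr_gt0.
pose P : set R := `[p, pb]%classic.
pose D : set R := `]0, pb[%classic.
pose g := (cst (- d) : R -> R) \_ P.
pose Q' x := if x < pb then 0 else Q x.
have hQ' : Qplus Q'.
  split.
  - by move=> x x01; rewrite /Q'; case: ifP => // _; exact: Q0.
  - move=> x y x0 xy y1; rewrite /Q'; case: ifPn => xpb.
      by case: ifP => // _; apply: Q0; rewrite y1 andbT (lt_le_trans x0).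
    by rewrite ifF ?Qnd//; apply/negbTE; rewrite -leNgt (le_trans _ xy)// leNgt.
  - move=> x x01; have [pbx|xpb] := leP pb x.
      have -> : Q' x = Q x by rewrite /Q' ltNge pbx.
      have Qx : Q y @[y --> x^'+] --> Q x by case: hQ => _ _; exact.
      apply: cvg_trans Qx; apply: near_eq_cvg; near=> y.
      have xy : x <= y by near: y; exact: nbhs_right_ge.
      by rewrite /Q' ltNge (le_trans pbx xy).
    apply: cvg_near_cst; near=> y.
    have ypb : y < pb by near: y; exact: nbhs_right_lt.
    by rewrite /Q' ypb xpb.
have mD : measurable D by exact: measurable_itv.
have mP : measurable P by exact: measurable_itv.
have DP : D `&` P = `[p, pb[%classic.
  apply/seteqP; split => x; rewrite /D /P/= !in_itv/=.
    by move=> [/andP[_ ->] /andP[-> _]].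
  by move=> /andP[px xpb]; rewrite px xpb (ltW xpb) (lt_le_trans p0).
have D01 : D `<=` `]0, 1[.
  by move=> x; rewrite /D/= !in_itv/= => /andP[-> /lt_trans]; exact.
have finD : (mu D < +oo)%E.
  by rewrite /D lebesgue_measure_itv/=; case: ifP => // _; rewrite -EFinD ltry.
have gE x : g x = if p <= x <= pb then - d else 0.
  rewrite /g patchE; case: ifPn => [|]; first by rewrite inE/P/= in_itv/= => ->.
  by rewrite notin_setE/P/= in_itv/= => /negP/negbTE ->.
have intg : mu.-integrable D (EFin \o g).
  apply: measurable_bounded_integrable => //.
    by apply: measurable_funS (_ : measurable_fun setT g) => //; apply/(measurable_restrictT _ _).1.
  exists d; split; first exact: num_real.
  move=> M dM x _ /=; rewrite gE; case: ifP => _; last by rewrite normr0 ltW// (lt_trans d0).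
  by rewrite normrN gtr0_norm// ltW.
have : 0 <= \int[mu]_(x in D) g x.
  apply: (@compare D Q' g) => //.
  - move=> x /andP[x0 x1] nD; rewrite /Q' ifF//; apply/negP => xpb; apply: nD.
    by rewrite /D/= in_itv/= x0.
  - move=> x; rewrite /D/= in_itv/= => /andP[x0 xpb].
    have x01 : 0 < x < 1 by rewrite x0 (lt_trans xpb).
    have y0 := Q0 x01.
    rewrite /cost_density /Q' xpb mulr0 sub0r gE.
    have kU := cp_k_pb cp x0 xpb.
    have /andP[v0 vU] := cp_v_bounds cp (lexx 0) x01.
    have h0 : v 0 x * Q x <= k x * Q x by rewrite ler_wpM2r// (le_trans vU).
    case: ifPn => [/andP[px _]|_]; last first.
      have := cp_V_concave cp (lexx 0) y0 x01; lra.
    have qy : q <= Q x by apply: Qnd => //; case/andP: x01.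
    have q20 : 0 <= q / 2 by rewrite divr_ge0// ltW.
    have h1 := cp_V_concave cp (lexx 0) q20 x01.
    have h2 := cp_V_concave cp q20 y0 x01.
    have h3 : c * (q / 2 - 0) <= v 0 x - v (q / 2) x by apply: Hc => //; lra.
    have h4 : (v 0 x - v (q / 2) x - c * (q / 2)) * (Q x - q / 2) >= 0.
      by apply: mulr_ge0; lra.
    have h5 : c * (q / 2) * (q / 2) <= c * (q / 2) * (Q x - q / 2).
      by rewrite ler_wpM2l ?mulr_ge0 ?(ltW c0)//; lra.
    rewrite /d; lra.
have -> : \int[mu]_(x in D) g x = - d * (pb - p).
  rewrite /g -Rintegral_mkcondr DP Rintegral_itv_bndo_bndc; last first.
    have intc : mu.-integrable `[p, pb] (EFin \o (fun=> - d)).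
      by apply: (@itv_bounded_integrable _ _ _ _ `|- d|).
    apply: integrableS intc => // x /=; rewrite !in_itv/= => /andP[-> /ltW]; exact.
  by rewrite Rintegral_itv_cst// ltW.
have : 0 < d * (pb - p) by rewrite mulr_gt0// subr_gt0.
lra.
Unshelve. all: by end_near. Qed.

Lemma optimal_zero p : 0 < p <= pb -> Q p = 0.
Proof.
move=> /andP[p0]; rewrite le_eqVlt => /orP[/eqP pE|]; last exact: Q_zero_before.
have p01 : 0 < p < 1 by rewrite pE; exact: cp_pb.
apply/eqP; rewrite eq_le Q0// andbT leNgt; apply/negP => Qp.
have [r r0 Hr] := Q_near p01 Qp.
have d0 : 0 < Num.min (r / 2) (p / 2) by rewrite lt_min; lra.
set d := Num.min _ _ in d0.
have d1 : d <= r / 2 by rewrite ge_min lexx.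
have d2 : d <= p / 2 by rewrite ge_min lexx orbT.
have xr : `|p - d - p| < r.
  by rewrite (_ : _ - p = - d) ?normrN ?gtr0_norm//; [lra|ring].
have := Hr _ xr; rewrite (@Q_zero_before (p - d)); [|lra|lra].
by rewrite sub0r normrN gtr0_norm// ltxx.
Qed.

Let derive_ge0 p : 0 < p < 1 -> derivable Q p 1 -> 0 <= derive1 Q p.
Proof.
move=> p01 dQ; have /andP[p0 p1] := p01; rewrite derive1E leNgt; apply/negP => neg.
have /is_derive1_approxP : is_derive p 1 Q ('D_1 Q p) by exact: derivableP.
set D := 'D_1 Q p in neg *.
have D0 : 0 < - D / 2 by lra.
move=> /(_ _ D0) [r r0 Hr].
have d0 : 0 < Num.min (r / 2) ((1 - p) / 2) by rewrite lt_min; lra.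
set d := Num.min _ _ in d0.
have d1 : d <= r / 2 by rewrite ge_min lexx.
have d2 : d <= (1 - p) / 2 by rewrite ge_min lexx orbT.
have dE : p + d - p = d by ring.
have := Hr (p + d); rewrite dE (gtr0_norm d0) => H'.
have : `|Q (p + d) - Q p - D * d| <= - D / 2 * d by apply: H'; lra.
rewrite ler_norml => /andP[_].
have : Q p <= Q (p + d) by apply: Qnd; lra.
have : 0 < - D / 2 * d by rewrite mulr_gt0.
lra.
Qed.

(** If Phi is positive at [p] then [Q] is constant nearby and its derivative is zero; otherwise Phi
    is zero and monotonicity makes the derivative nonnegative. *)
Lemma optimal_obstacle p : 0 < p < 1 -> derivable Q p 1 ->
  Num.min (derive1 Q p) (H p + tail p) = 0.
Proof.
move=> p01 dQ; have D0 := derive_ge0 p01 dQ; have P0 := Phi_nonneg p01.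
rewrite -/(Phi p); have [P1|P1] := leP (Phi p) 0.
  have -> : Phi p = 0 by apply/eqP; rewrite eq_le P1 P0.
  exact/min_idPr.
suff -> : derive1 Q p = 0 by exact/min_idPl.
rewrite derive1E; apply: derive_val.
apply/is_derive1_approxP => e e0; have [r r0 Hr] := near_Phi_gt0 p01 P1.
exists r => // y yr; have [/andP[y0 y1] _] := Hr _ yr.
have /andP[p0 p1] := p01.
have -> : Q y = Q p.
  have [py|/ltW yp] := leP p y.
    apply/esym; apply: Q_constant => // x /andP[px xy]; apply: (Hr _ _).2.
    by apply: le_lt_trans yr; rewrite !ger0_norm; lra.
  apply: Q_constant => // x /andP[yx xp]; apply: (Hr _ _).2.
  by apply: le_lt_trans yr; rewrite !ler0_norm; lra.
by rewrite subrr mul0r subr0 normr0 mulr_ge0// ltW.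
Qed.

Lemma optimal_dual_derive p : 0 < p < 1 -> is_derive p 1 H (v (Q p) p).
Proof.
move=> p01; have /andP[p0 p1] := p01.
have a0 : 0 < p / 2 by lra.
have b1 : (p + 1) / 2 < 1 by lra.
apply: (primitive_is_derive _ (H_primitive' a0 b1)).
- have : mu.-integrable `[p / 2, (p + 1) / 2] (EFin \o w) by exact: w_integrable.
  apply: eq_integrable => // x; rewrite inE/= in_itv/= => /andP[sx xt].
  by rewrite /w ifT//; apply/andP; split; lra.
- by apply/andP; split; lra.
- by apply: v_continuous => //; exact: optimal_continuous.
Qed.

Lemma optimal_derivable : {ae mu, forall p, 0 < p < 1 -> derivable Q p 1}.
Proof.
(* Starting at 1/2, so that [1 - a n] is never below [a n]; the first interval is empty. *)
pose a (n : nat) : R := n.+2%:R^-1.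
have a0 n : 0 < a n by rewrite invr_gt0.
have a1 n : a n <= 2^-1 by rewrite lef_pV2 ?posrE// ler_nat.
have asmall y : 0 < y -> exists n, a n < y.
  move=> y0; exists (Num.truncn y^-1); rewrite /a invf_plt ?posrE//.
  by apply: lt_trans (truncnS_gt _) _; rewrite ltr_nat.
clearbody a.
have dQ n : {ae mu, forall p, a n < p < 1 - a n -> derivable Q p 1}.
  have an0 := a0 n; have an1 := a1 n.
  have [half|half] := ltP (a n) (1 - a n); last first.
    by apply: aeW => p /andP[h1 h2]; lra.
  have bn : 1 - a n < 1 by lra.
  have [K HK] := optimal_lipschitz an0 (ltW half) bn.
  exact: lipschitz_nondecreasing_derivable HK.
have := ae_foralln dQ.
apply: ae_lebesgue_mono => p Hp /andP[p0 p1].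
have m0 : 0 < Num.min p (1 - p) by rewrite lt_min p0 subr_gt0.
have [n na] := asmall _ m0.
by apply: (Hp n); move: na; rewrite lt_min => /andP[h1 h2]; apply/andP; split; lra.
Qed.

End necessity.

End reduced_problem.

(** * Exponential utilities and quantiles *)

Section exponential_utility.
Context {R : realType} (l : R) (F : cumulativeBounded (0 : R) l).
Set Implicit Arguments.
Unset Strict Implicit.
Hypothesis l0 : l != 0.
Hypothesis suppF : compactly_supported F.

Local Notation nu := (lebesgue_stieltjes_measure F).

Let support : exists a b, [/\ 0 < a, a <= b & nu (~` `[a, b]) = 0%E].
Proof.
have [K [cK K0 nuK]] := suppF.
have mK : measurable K by exact: compact_measurable.
have [Ke|/set0P K00] := eqVneq K set0; last first.
  have cid : {within K, continuous (id : R -> R)}.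
    by apply: continuous_subspaceT => x; exact: cvg_id.
  have [a /set_mem Ka amin] := compact_EVT_min K00 cK cid.
  have [b /set_mem Kb bmax] := compact_EVT_max K00 cK cid.
  exists a, b; split.
  - by have := K0 _ Ka; rewrite /= in_itv/= andbT.
  - by apply: amin; exact/mem_set.
  - apply: (@subset_measure0 _ _ _ nu _ (~` K)) => //.
    + by apply: measurableC; exact: measurable_itv.
    + exact: measurableC.
    + apply: subsetC => x Kx /=; rewrite in_itv/=; apply/andP; split.
        by apply: amin; exact/mem_set.
      by apply: bmax; exact/mem_set.
(* If [K] is empty the measure is zero and any interval in the positive half-line serves. *)
move: nuK; rewrite Ke setC0 => nuT; exists 1, 1; split => //.
apply: (@subset_measure0 _ _ _ nu _ setT) => //.
by apply: measurableC; exact: measurable_itv.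
Qed.

Let nu_oc (x y : R) : x <= y -> nu `]x, y] = (F y - F x)%:E.
Proof.
move=> xy; rewrite /lebesgue_stieltjes_measure/= /measure_extension.
rewrite measurable_mu_extE/=; last exact: is_ocitv.
by rewrite wlength_itv_bnd.
Qed.

(* exp(-g y) lies above its tangent at x, and all estimates below are this
   inequality integrated over the compact support [a, b]. *)
Lemma utility_derivative : exists u1 : R -> R,
  [/\ forall x y, utility F y - utility F x <= u1 x * (y - x),
      forall M, exists C, forall x y, - M <= x -> x <= y -> u1 x - u1 y <= C * (y - x),
      forall B, exists2 c, 0 < c & forall x y, x <= y -> y <= B ->
        c * (y - x) <= u1 x - u1 y,
      forall x, utility F x <= 0 &
      forall x, 0 < u1 x].
Proof.
have [a [b [a0 ab nuC]]] := support.
pose I : set R := `[a, b]%classic.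
have mI : measurable I by exact: measurable_itv.
have b0 : 0 < b by exact: lt_le_trans ab.
have nuI_fin : (nu I < +oo)%E.
  apply: (@le_lt_trans _ _ (nu `]a - 1, b])).
    apply: le_measure; [by rewrite inE|by rewrite inE; exact: measurable_itv|].
    by move=> x; rewrite /I/= !in_itv/= => /andP[ax ->]; rewrite andbT; lra.
  by rewrite nu_oc ?ltry//; lra.
(* Otherwise [F] would be constant, although its limits 0 and [l] differ. *)
have nuI_gt0 : (0 < nu I)%E.
  rewrite lt_neqAle measure_ge0 andbT; apply/negP => /eqP nuI0.
  have nuT : nu setT = 0%E.
    have h : nu (I `|` ~` I) = nu I by apply: measureU0 => //; exact: measurableC.
    by rewrite -(setUv I) h -nuI0.
  have Fcst x y : x <= y -> F y = F x.
    move=> xy; apply/eqP; rewrite -subr_eq0 -eqe -nu_oc//; apply/eqP.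
    by apply: (@subset_measure0 _ _ _ nu _ setT) => //; exact: measurable_itv.
  have Fy : F x @[x --> +oo] --> F 0.
    apply: cvg_near_cst; near=> x; apply: Fcst.
    by near: x; apply: nbhs_pinfty_ge; exact: num_real.
  have FNy : F x @[x --> -oo] --> F 0.
    apply: cvg_near_cst; near=> x; apply/esym/Fcst.
    by near: x; apply: nbhs_ninfty_le; exact: num_real.
  have e1 : F 0 = l by apply: (cvg_unique _ Fy (cumulativey F)); exact: Rhausdorff.
  have e2 : F 0 = 0 by apply: (cvg_unique _ FNy (cumulativeNy F)); exact: Rhausdorff.
  by move/eqP : l0; apply; exact: etrans (esym e1) e2.
pose w := fine (nu I).
have w0 : 0 < w by rewrite fine_gt0// nuI_gt0.
have int (f : R -> R) M : measurable_fun setT f -> (forall g, a <= g <= b -> `|f g| <= M) ->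
    nu.-integrable I (EFin \o f).
  move=> mf fM; apply: measurable_bounded_integrable => //.
    exact: measurable_funS mf.
  exists M; split; first exact: num_real.
  by move=> M' MM' x; rewrite /I/= in_itv/= => /fM h; exact: le_trans h (ltW MM').
have intcst c : nu.-integrable I (EFin \o cst c).
  by apply: (int _ `|c|).
have cstE c : \int[nu]_(g in I) c = c * w by rewrite Rintegral_cst.
have mexp (x : R) : measurable_fun setT (fun g : R => expR (- g * x)).
  apply: measurableT_comp => //; apply: measurable_funM => //.
have expb (x g : R) : a <= g <= b -> 0 <= expR (- g * x) <= expR (b * `|x|).
  move=> /andP[ag gb]; rewrite expR_ge0/= ler_expR mulNr -mulrN.
  apply: (@le_trans _ _ (g * `|x|)); last by rewrite ler_wpM2r.
  by rewrite ler_wpM2l ?(le_trans (ltW a0))// -normrN ler_norm.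
have intexp x : nu.-integrable I (EFin \o (fun g => expR (- g * x))).
  apply: (int _ (expR (b * `|x|))) => // g /(expb x)/andP[h1 h2].
  by rewrite ger0_norm.
have intgexp x : nu.-integrable I (EFin \o (fun g => g * expR (- g * x))).
  apply: (int _ (b * expR (b * `|x|))); first exact: measurable_funM.
  move=> g gab; have /andP[h1 h2] := expb x g gab; have /andP[h3 h4] := gab.
  by rewrite normrM (ger0_norm h1) ger0_norm ?ler_pM//; lra.
have uE x : utility F x = - \int[nu]_(g in I) expR (- g * x).
  rewrite /utility /Rintegral; congr (- fine _).
  have DI : `[0, +oo[ `\` ~` I = I.
    apply/seteqP; split => g; rewrite /I/= !in_itv/= andbT.
      by move=> [_ /contrapT].
    by move=> gab; split; [lra|exact].
  have mD : measurable (`[0, +oo[ : set R) by exact: measurable_itv.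
  rewrite (@negligible_integral _ _ _ nu `[0, +oo[ (~` I)) ?DI//.
  - exact: measurableC.
  - apply/(@negligible_integrable _ _ _ nu _ (~` I)) => //.
    + exact: measurableC.
    + by apply/measurable_EFinP; exact: measurable_funS (mexp x).
    + by rewrite DI; exact: intexp.
pose u1 x := \int[nu]_(g in I) (g * expR (- g * x)).
have tangent (g x y : R) :
    expR (- g * x) - expR (- g * y) <= g * expR (- g * x) * (y - x).
  have -> : - g * y = - g * x + - (g * (y - x)) by ring.
  rewrite expRD.
  have := expR_ge1Dx (- (g * (y - x))).
  rewrite -(@ler_pM2l _ (expR (- g * x))) ?expR_gt0//; lra.
(* The tangent inequality at [y], multiplied by [g]; the factor [g * g] is then bounded below by
   [a * a]. The upper estimate uses the tangent at [x] and [b * b]. *)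
have gap_lower g x y : a <= g <= b -> x <= y ->
    a * a * expR (- g * y) * (y - x) <= g * expR (- g * x) - g * expR (- g * y).
  move=> /andP[ag gb] xy; have := tangent g y x.
  have e0 := expR_ge0 (- g * y).
  have : a * a <= g * g by rewrite ler_pM// ltW.
  move=> h; have : a * a * (expR (- g * y) * (y - x)) <= g * g * (expR (- g * y) * (y - x)).
    by rewrite ler_wpM2r// mulr_ge0// subr_ge0.
  move=> h1 h2; have : g * (expR (- g * y) * g * (y - x)) <= g * (expR (- g * x) - expR (- g * y)).
    by rewrite ler_wpM2l//; lra.
  lra.
have gap_upper g x y : a <= g <= b -> x <= y ->
    g * expR (- g * x) - g * expR (- g * y) <= b * b * expR (- g * x) * (y - x).
  move=> /andP[ag gb] xy; have := tangent g x y.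
  have e0 := expR_ge0 (- g * x).
  have g0 : 0 <= g by lra.
  have : g * g <= b * b by rewrite ler_pM.
  move=> h; have : g * g * (expR (- g * x) * (y - x)) <= b * b * (expR (- g * x) * (y - x)).
    by rewrite ler_wpM2r// mulr_ge0// subr_ge0.
  move=> h1 h2; have : g * (expR (- g * x) - expR (- g * y)) <= g * (g * expR (- g * x) * (y - x)).
    by rewrite ler_wpM2l.
  lra.
have intgap x y : nu.-integrable I (EFin \o (fun g => g * expR (- g * x) - g * expR (- g * y))).
  exact: integrable_subr.
have gapE x y : u1 x - u1 y = \int[nu]_(g in I) (g * expR (- g * x) - g * expR (- g * y)).
  by rewrite RintegralB.
exists u1; split.
- move=> x y; rewrite !uE opprK addrC -RintegralB// -RintegralZr//.
  apply: le_Rintegral => //; first exact: integrable_subr.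
  have : nu.-integrable I (EFin \o (fun g => (y - x) * (g * expR (- g * x)))).
    exact: integrable_mulr.
  by apply: eq_integrable => // g _ /=; rewrite mulrC.
- move=> M; exists (b * b * expR (b * `|M|) * w) => x y Mx xy.
  rewrite gapE mulrAC -cstE; apply: le_Rintegral => //; first exact: intcst.
  move=> g; rewrite /I/= in_itv/= => gab.
  apply: (le_trans (gap_upper g x y gab xy)).
  rewrite ler_wpM2r ?subr_ge0// ler_wpM2l ?mulr_ge0 ?(ltW b0)// ler_expR.
  have /andP[ag gb] := gab.
  apply: (@le_trans _ _ (g * `|M|)); last by rewrite ler_wpM2r.
  rewrite mulNr -mulrN ler_wpM2l; [by []|lra|].
  by rewrite (le_trans _ (ler_norm M))// lerNl.
- move=> B; exists (a * a * expR (- (b * `|B|)) * w).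
    by rewrite !mulr_gt0// expR_gt0.
  move=> x y xy yB.
  rewrite gapE mulrAC -cstE; apply: le_Rintegral => //; first exact: intcst.
  move=> g; rewrite /I/= in_itv/= => gab.
  apply: le_trans (gap_lower g x y gab xy).
  rewrite ler_wpM2r ?subr_ge0// ler_wpM2l ?mulr_ge0 ?(ltW a0)// ler_expR.
  have /andP[ag gb] := gab.
  rewrite mulNr lerN2; apply: (@le_trans _ _ (g * `|B|)); last by rewrite ler_wpM2r.
  by rewrite ler_wpM2l ?(le_trans yB)// ?ler_norm//; lra.
- by move=> x; rewrite uE oppr_le0; apply: Rintegral_ge0 => g _; exact: expR_ge0.
- move=> x; apply: (@lt_le_trans _ _ (a * expR (- (b * `|x|)) * w)).
    by rewrite !mulr_gt0// expR_gt0.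
  rewrite -cstE; apply: le_Rintegral => //; first exact: intcst.
  move=> g; rewrite /I/= in_itv/= => gab; have /andP[ag gb] := gab.
  rewrite ler_pM ?expR_ge0// ?(ltW a0)// ler_expR mulNr lerN2.
  apply: (@le_trans _ _ (g * `|x|)); last by rewrite ler_wpM2r.
  by rewrite ler_wpM2l ?ler_norm//; lra.
Unshelve. all: by end_near. Qed.

End exponential_utility.

Section lipschitz_interval.
Context {R : realType}.
Set Implicit Arguments.
Unset Strict Implicit.

Lemma lipschitz_itvP (f : R -> R) (a b : R) :
  [lipschitz f x | x in `[a, b]] <->
  exists L, forall x y, a <= x -> x <= y -> y <= b -> `|f y - f x| <= L * (y - x).
Proof.
split.
- move=> [M [_ HM]]; exists (M + 1) => x y ax xy yb.
  have xin : `[a, b]%classic x by rewrite /= in_itv/= ax (le_trans xy).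
  have yin : `[a, b]%classic y by rewrite /= in_itv/= yb (le_trans ax).
  have := HM (M + 1) (_ : M < M + 1) (y, x) (conj yin xin).
  rewrite ltrDl ltr01 => /(_ isT); rewrite /self_sub/=.
  by rewrite [X in _ <= _ * X -> _]ger0_norm// subr_ge0.
- move=> [L HL]; exists `|L|; split; first exact: num_real.
  move=> M LM [x y] [/= xin yin]; move: xin yin; rewrite !in_itv/=.
  move=> /andP[ax xb] /andP[ay yb]; rewrite /self_sub/=.
  have key s t : a <= s -> s <= t -> t <= b -> `|f t - f s| <= M * `|t - s|.
    move=> sa st tb; apply: (le_trans (HL _ _ sa st tb)).
    rewrite (_ : `|t - s| = t - s); last by rewrite ger0_norm// subr_ge0.
    by rewrite ler_wpM2r ?subr_ge0// (le_trans (ler_norm L))// ltW.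
  have [xy|/ltW yx] := leP x y; last exact: key.
  by rewrite distrC (distrC x); exact: key.
Qed.

End lipschitz_interval.

(** * Quantiles of random variables and their end point limits *)

Section quantile_theory.
Context {R : realType} {d : measure_display} {Omega : measurableType d}.
Context {P : probability Omega R}.
Set Implicit Arguments.
Unset Strict Implicit.
Implicit Types (Y : {RV P >-> R}) (p q : R).

Let level_set Y p := [set z : R | (p%:E < cdf Y z)%E].

Let level_set_neq0 Y p : p < 1 -> level_set Y p !=set0.
Proof.
move=> p1; have H : \forall z \near +oo, (p%:E < cdf Y z)%E.
  have p1' : (p%:E < 1)%E by rewrite lte_fin.
  exact: (@cvg_cdfy1 _ _ _ _ Y _ (open_ereal_gt' p1')).
have [z Hz] : exists z, (p%:E < cdf Y z)%E.
  near (pinfty_nbhs R) => z.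
  by exists z; near: z.
by exists z.
Unshelve. all: by end_near. Qed.

Let level_set_lbound Y p : 0 < p -> has_lbound (level_set Y p).
Proof.
move=> p0; have H : \forall z \near -oo, (cdf Y z < p%:E)%E.
  have p0' : (0 < p%:E)%E by rewrite lte_fin.
  exact: (@cvg_cdfNy0 _ _ _ _ Y _ (open_ereal_lt' p0')).
have [z Hz] : exists z, (cdf Y z < p%:E)%E.
  near (ninfty_nbhs R) => z.
  by exists z; near: z.
exists z => t pt; rewrite leNgt; apply/negP => tz.
have := lt_trans pt (le_lt_trans (cdf_nondecreasing Y (ltW tz)) Hz).
by rewrite ltxx.
Unshelve. all: by end_near. Qed.

Lemma quantile_oo_nondecreasing Y p q : 0 < p -> p <= q -> q < 1 ->
  quantile_oo (cdf Y) p <= quantile_oo (cdf Y) q.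
Proof.
move=> p0 pq q1; apply: lb_le_inf; first exact: level_set_neq0.
move=> z qz; apply: ge_inf; first exact: level_set_lbound.
by apply: le_lt_trans qz; rewrite lee_fin.
Qed.

Lemma rquantileE Y p : 0 < p < 1 -> rquantile Y p = quantile_oo (cdf Y) p.
Proof.
by move=> /andP[p0 p1]; rewrite /rquantile /quantile_rv /quantile leNgt p0/= leNgt p1.
Qed.

Lemma rquantile_nondecreasing Y p q : 0 < p -> p <= q -> q < 1 ->
  rquantile Y p <= rquantile Y q.
Proof.
move=> p0 pq q1; rewrite !rquantileE ?p0 ?q1 ?andbT//; first exact: quantile_oo_nondecreasing.
- exact: lt_le_trans pq.
- exact: le_lt_trans q1.
Qed.

Section quantile_from_zero.
Variable Y : {RV P >-> R}.
Hypothesis Q0 : quantile_rv Y 0 = 0%E.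
Hypothesis Q1 : quantile_rv Y 1 = +oo%E.

(** A value of [lim] does not assert convergence; monotonicity provides a limit, which the
    hypothesis then identifies. *)
Let cvg_zero : (quantile_oo (cdf Y) q)%:E @[q --> (0 : R)^'+] --> 0%E.
Proof.
have : lim ((quantile_oo (cdf Y) q)%:E @[q --> (0 : R)^'+]) = 0%E.
  by move: Q0; rewrite /quantile_rv /quantile lexx.
have := @nondecreasing_at_right_cvge R (fun q => (quantile_oo (cdf Y) q)%:E) 0 (BLeft 1).
rewrite bnd_simp ltr01 => /(_ isT).
set s := ereal_inf _ => cvs.
have {}cvs : (quantile_oo (cdf Y) q)%:E @[q --> (0 : R)^'+] --> s.
  apply: cvs => p q; rewrite !in_itv/= => /andP[p0 p1] /andP[q0 q1] pq.
  by rewrite lee_fin; exact: quantile_oo_nondecreasing.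
by move=> <-; rewrite (cvg_lim _ cvs).
Qed.

Lemma rquantile_ge0 p : 0 <= rquantile Y p.
Proof.
have [p0|p0] := leP p 0.
  have -> : rquantile Y p = fine (quantile_rv Y 0).
    by rewrite /rquantile /quantile_rv /quantile p0 lexx.
  by rewrite Q0.
(* From 1 on the quantile is infinite and [fine] returns 0, so the bound holds on the whole line. *)
have [p1|p1] := leP 1 p.
  have -> : rquantile Y p = fine (quantile_rv Y 1).
    by rewrite /rquantile /quantile_rv /quantile p1 lexx !leNgt p0 ltr01.
  by rewrite Q1.
have p01 : 0 < p < 1 by rewrite p0.
rewrite rquantileE// -lee_fin; apply: (cvge_le _ cvg_zero).
near=> q; rewrite lee_fin; apply: quantile_oo_nondecreasing => //.
  by near: q; apply: nbhs_right_le.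
Unshelve. all: by end_near. Qed.

Lemma rquantile0 : rquantile Y 0 = 0.
Proof. by rewrite /rquantile Q0. Qed.

Lemma rquantile_small e : 0 < e -> exists2 q, 0 < q < 1 & rquantile Y q < e.
Proof.
move=> e0.
have H : \forall q \near (0 : R)^'+, ((quantile_oo (cdf Y) q)%:E < e%:E)%E.
  have e0' : (0 < e%:E)%E by rewrite lte_fin.
  exact: (cvg_zero (open_ereal_lt' e0')).
near ((0 : R)^'+) => q.
have q01 : 0 < q < 1.
  by apply/andP; split; near: q; [exact: nbhs_right_gt|exact: nbhs_right_lt].
exists q => //; rewrite rquantileE// -lte_fin.
by near: q.
Unshelve. all: by end_near. Qed.

Lemma rquantile_large A : exists2 q, 0 < q < 1 & A < rquantile Y q.
Proof.
have lim1 : lim ((quantile_oo (cdf Y) q)%:E @[q --> (1 : R)^'-]) = +oo%E.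
  by move: Q1; rewrite /quantile_rv /quantile lexx leNgt ltr01.
(* Without convergence [lim] would be the default point, which is not [+oo]. *)
have [cv|/dvgP dv] := pselect (cvg ((quantile_oo (cdf Y) q)%:E @[q --> (1 : R)^'-])); last first.
  by move: lim1; rewrite dv.
have cvy : (quantile_oo (cdf Y) q)%:E @[q --> (1 : R)^'-] --> +oo%E by rewrite -lim1.
have H : \forall q \near (1 : R)^'-, (A%:E < (quantile_oo (cdf Y) q)%:E)%E.
  exact: (cvy _ (open_ereal_gt' (ltry A))).
near ((1 : R)^'-) => q.
have q01 : 0 < q < 1.
  by apply/andP; split; near: q; [exact: nbhs_left_gt|exact: nbhs_left_lt].
exists q => //; rewrite rquantileE// -lte_fin.
by near: q.
Unshelve. all: by end_near. Qed.

End quantile_from_zero.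

End quantile_theory.

Lemma continuously_derivable_lipschitz {R : realType} (f : R -> R) (a b : R) :
  continuously_derivable_on `]0, 1[ f -> 0 < a -> a <= b -> b < 1 ->
  exists L, forall x y, a <= x -> x <= y -> y <= b -> `|f y - f x| <= L * (y - x).
Proof.
move=> [df cf] a0 ab b1.
have cf' : {within `[a, b], continuous (derive1 f)}.
  by apply: continuous_subspaceW cf; exact: sub_itvcc_oo.
have [m _ Hm] := EVT_min ab cf'.
have [M _ HM] := EVT_max ab cf'.
exists (`|derive1 f m| + `|derive1 f M|) => x y ax xy yb.
have df' z : x <= z <= y -> derivable f z 1.
  by move=> /andP[xz zy]; apply: df; rewrite /= in_itv/=; apply/andP; split; lra.
have [z zxy ->] : exists2 c, c \in `[x, y]%R & f y - f x = derive1 f c * (y - x).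
  apply: MVT_segment => //.
    move=> z; rewrite in_itv/= => /andP[xz zy]; rewrite derive1E; apply/derivableP/df'.
    by rewrite !ltW.
  apply: continuous_in_subspaceT => z; rewrite inE/= in_itv/= => /df' dz.
  by apply: differentiable_continuous; exact/derivable1_diffP.
rewrite normrM [X in _ * X]ger0_norm ?subr_ge0// ler_wpM2r ?subr_ge0//.
have zab : z \in `[a, b]%R.
  by move: zxy; rewrite !in_itv/= => /andP[xz zy]; apply/andP; split; lra.
have h1 := Hm _ zab; have h2 := HM _ zab.
have h3 := ler_norm (derive1 f M).
have : - `|derive1 f m| <= derive1 f m by rewrite lerNl -normrN ler_norm.
have := normr_ge0 (derive1 f m); have := normr_ge0 (derive1 f M).
by rewrite ler_norml => *; apply/andP; split; lra.
Qed.

(** * From utility and quantiles to the reduced problem *)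

Section mixed_utility.
Context {R : realType}.
Set Implicit Arguments.
Unset Strict Implicit.

Lemma is_derive1_shift (f : R -> R) (c x l : R) :
  is_derive (x + c) 1 f l -> is_derive x 1 (fun y => f (y + c)) l.
Proof.
move=> /is_derive1_approxP df; apply/is_derive1_approxP => e e0.
have [r r0 Hr] := df _ e0; exists r => // y yr.
have yE : y + c - (x + c) = y - x by ring.
by have := Hr (y + c); rewrite yE; exact.
Qed.

Variables (u u1 : R -> R).
Hypothesis conc : forall x y, u y - u x <= u1 x * (y - x).
Hypothesis lip : forall M, exists C, forall x y, - M <= x -> x <= y ->
  u1 x - u1 y <= C * (y - x).

(** The supergradients at [x] and at [y] enclose the increment of [u], and their difference is
    locally of order [|y - x|], which leaves a quadratic error. *)
Lemma concave_smooth_is_derive (x : R) : is_derive x 1 u (u1 x).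
Proof.
have [C HC] := lip (`|x| + 1).
have HC' s t : - (`|x| + 1) <= s -> - (`|x| + 1) <= t -> s <= t ->
    u1 s - u1 t <= (`|C| + 1) * (t - s).
  move=> hs _ st; apply: (le_trans (HC _ _ hs st)).
  by rewrite ler_wpM2r ?subr_ge0// (le_trans (ler_norm C))// lerDl.
set K := `|C| + 1 in HC'; have K0 : 0 < K by rewrite ltr_wpDl.
apply/is_derive1_approxP => e e0.
exists (Num.min 1 (e / K)); first by rewrite lt_min ltr01 divr_gt0.
move=> y; rewrite lt_min => /andP[y1 ye].
have Ky : K * `|y - x| <= e by rewrite mulrC -ler_pdivlMr// ltW.
have hx : - (`|x| + 1) <= x by have := ler_norm (- x); rewrite normrN; lra.
have hy : - (`|x| + 1) <= y.
  have := ler_norm (- x); rewrite normrN; move: y1; rewrite ltr_norml => /andP[]; lra.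
have h1 := conc x y; have h2 := conc y x.
have sq : (u1 x - u1 y) * (y - x) <= K * `|y - x| * `|y - x|.
  have [xy|/ltW yx] := leP x y.
    have -> : `|y - x| = y - x by rewrite ger0_norm// subr_ge0.
    by rewrite ler_wpM2r ?subr_ge0// HC'.
  have -> : `|y - x| = x - y by rewrite distrC ger0_norm// subr_ge0.
  have -> : (u1 x - u1 y) * (y - x) = (u1 y - u1 x) * (x - y) by ring.
  by rewrite ler_wpM2r ?subr_ge0// HC'.
have : K * `|y - x| * `|y - x| <= e * `|y - x| by rewrite ler_wpM2r.
by rewrite ler_norml => h3; apply/andP; split; lra.
Qed.

Hypothesis decr : forall B, exists2 c, 0 < c & forall x y, x <= y -> y <= B ->
  c * (y - x) <= u1 x - u1 y.
Hypothesis u_le0 : forall x, u x <= 0.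
Hypothesis u1_gt0 : forall x, 0 < u1 x.
Variables (theta qr : R -> R) (alpha lambda pb : R).
Hypothesis theta_nd : forall x y, 0 < x -> x <= y -> y < 1 -> theta x <= theta y.
Hypothesis theta_lip : exists L, forall x y, 0 <= x -> x <= y -> y <= 1 ->
  `|theta y - theta x| <= L * (y - x).
Hypothesis alpha01 : 0 <= alpha <= 1.
Hypothesis lambda0 : 0 < lambda.
Hypothesis qr_ge0 : forall p, 0 <= qr p.
Hypothesis qr_nd : forall x y, 0 < x -> x <= y -> y < 1 -> qr x <= qr y.
Hypothesis qr0 : qr 0 = 0.
Hypothesis qr_lip : forall a b, 0 < a -> a <= b -> b < 1 -> exists L, forall x y,
  a <= x -> x <= y -> y <= b -> `|qr y - qr x| <= L * (y - x).
Hypothesis pb01 : 0 < pb < 1.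
Hypothesis k_pb : forall p, 0 < p -> p < pb -> u1 (theta 0) <= lambda * qr (1 - p).

Let onem01 (p : R) : 0 < p < 1 -> 0 < 1 - p < 1.
Proof. by move=> /andP[p0 p1]; apply/andP; split; lra. Qed.

(** Monotonicity is known on the open interval only; the Lipschitz bound connects it to the end
    point 0. *)
Let theta_ge0 (p : R) : 0 < p < 1 -> theta 0 <= theta p.
Proof.
move=> /andP[p0 p1]; have [L HL] := theta_lip.
apply/ler_addgt0Pr => e e0.
have L1 : 0 < `|L| + 1 by rewrite ltr_wpDl.
pose z := Num.min p (e / (`|L| + 1)).
have z0 : 0 < z by rewrite lt_min p0 divr_gt0.
have zp : z <= p by rewrite ge_min lexx.
have z1 : z <= 1 by lra.
have := HL 0 z (lexx 0) (ltW z0) z1; rewrite subr0 ler_norml => /andP[h _].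
have h1 : theta z <= theta p by exact: theta_nd.
have h2 : L * z <= (`|L| + 1) * z.
  by rewrite ler_wpM2r ?(ltW z0)// (le_trans (ler_norm L))// lerDl.
have h3 : z * (`|L| + 1) <= e by rewrite -ler_pdivlMr// ge_min lexx orbT.
lra.
Qed.

Let theta_measurable : measurable_fun (`]0%R, 1%R[ : set R) theta.
Proof.
apply: interval_nondecreasing_measurable; first exact: interval_is_interval.
move=> x y /=; rewrite !in_itv/= => /andP[x0 x1] /andP[y0 y1] xy.
exact: theta_nd.
Qed.

Let theta_onem_measurable : measurable_fun (`]0%R, 1%R[ : set R) (fun p => theta (1 - p)).
Proof.
have : measurable_fun (`]0%R, 1%R[ : set R) (fun p => - theta (1 - p)).
  apply: interval_nondecreasing_measurable; first exact: interval_is_interval.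
  move=> x y /=; rewrite !in_itv/= => /andP[x0 x1] /andP[y0 y1] xy.
  by rewrite lerN2; apply: theta_nd; lra.
by move/measurable_funN; apply: eq_measurable_fun => x _; rewrite /= opprK.
Qed.

Let a0 : 0 <= alpha. Proof. by case/andP: alpha01. Qed.
Let a1 : 0 <= 1 - alpha. Proof. by rewrite subr_ge0; case/andP: alpha01. Qed.

(** Taken at [u] this is V, taken at [u1] it is the derivative of V in wealth. *)
Definition mixture (f : R -> R) (x p : R) :=
  (1 - alpha) * f (x + theta p) + alpha * f (x + theta (1 - p)).

Lemma mixture_is_derive (x p : R) : is_derive x 1 (mixture u ^~ p) (mixture u1 x p).
Proof.
have d1 := is_derive1_shift (concave_smooth_is_derive (x + theta p)).
have d2 := is_derive1_shift (concave_smooth_is_derive (x + theta (1 - p))).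
exact: is_deriveD (is_deriveZ (1 - alpha) d1) (is_deriveZ alpha d2).
Qed.

Lemma mixture_concave_problem : exists C, concave_problem (mixture u) (mixture u1)
  (fun p => lambda * qr (1 - p)) (u1 (theta 0)) C (- u (theta 0)) pb.
Proof.
have u1_ni x y : x <= y -> u1 y <= u1 x.
  move=> xy; have [c c0 Hc] := decr y; have := Hc x y xy (lexx y).
  have : 0 <= c * (y - x) by rewrite mulr_ge0 ?subr_ge0// ltW.
  lra.
have u_cont : measurable_fun setT u.
  apply: continuous_measurable_fun => x.
  apply: differentiable_continuous; apply/derivable1_diffP.
  by have [] := concave_smooth_is_derive x.
have u1_meas : measurable_fun setT u1.
  by apply: nonincreasing_measurable => // x y; exact: u1_ni.
have [L HL] := theta_lip.
have theta_le p : 0 < p < 1 -> theta p <= theta 0 + `|L|.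
  move=> /andP[p0 p1]; have := HL 0 p (lexx 0) (ltW p0) (ltW p1).
  rewrite subr0 ler_norml => /andP[_ h].
  have h1 : L * p <= `|L| * p by rewrite ler_wpM2r ?ler_norm// ltW.
  have : `|L| * p <= `|L| by rewrite ler_piMr// ltW.
  lra.
have theta_L p q : 0 < p < 1 -> 0 < q < 1 -> `|theta q - theta p| <= `|L| * `|q - p|.
  have key s t : 0 < s -> s <= t -> t < 1 -> `|theta t - theta s| <= `|L| * `|t - s|.
    move=> s0 st t1; apply: (le_trans (HL _ _ (ltW s0) st (ltW t1))).
    by rewrite [X in _ <= _ * X]ger0_norm ?subr_ge0// ler_wpM2r ?subr_ge0// ler_norm.
  move=> /andP[p0 p1] /andP[q0 q1]; have [pq|/ltW qp] := leP p q; first exact: key.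
  by rewrite distrC (distrC q); exact: key.
(* Wealth never falls below [theta 0], so one local Lipschitz constant of [u1] serves throughout. *)
have [C0 HC0] := lip `|theta 0|.
have u1L s t : theta 0 <= s -> theta 0 <= t -> `|u1 t - u1 s| <= `|C0| * `|t - s|.
  have key x y : theta 0 <= x -> x <= y -> `|u1 y - u1 x| <= `|C0| * `|y - x|.
    move=> tx xy; rewrite distrC ger0_norm ?subr_ge0 ?u1_ni//.
    apply: (@le_trans _ _ (C0 * (y - x))).
      apply: HC0 => //; apply: le_trans tx.
      by rewrite lerNl -normrN ler_norm.
    by rewrite [X in _ <= _ * X]ger0_norm ?subr_ge0// ler_wpM2r ?subr_ge0// ler_norm.
  move=> ts tt; have [st|/ltW ts'] := leP s t; first exact: key.
  by rewrite distrC (distrC t); exact: key.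
have th0 x p : 0 <= x -> 0 < p < 1 -> theta 0 <= x + theta p.
  by move=> x0 /theta_ge0; lra.
have mix (s t b1 b2 : R) : s <= b1 -> t <= b2 ->
    (1 - alpha) * s + alpha * t <= (1 - alpha) * b1 + alpha * b2.
  by move=> h1 h2; rewrite lerD// ler_wpM2l.
have u_tail p : theta 0 <= p -> u (theta 0) <= u p.
  move=> tp; have h := conc p (theta 0).
  have : 0 <= u1 p * (p - theta 0) by rewrite mulr_ge0 ?subr_ge0// ltW.
  lra.
exists (`|C0| * (1 + `|L|)); split.
- move=> x p x0 p01; rewrite /mixture.
  have := mix _ _ _ _ (u_le0 (x + theta p)) (u_le0 (x + theta (1 - p))); lra.
- move=> p p01; rewrite /mixture opprK.
  have := mix _ _ _ _ (u_tail _ (th0 _ _ (lexx 0) p01)) (u_tail _ (th0 _ _ (lexx 0) (onem01 p01))).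
  lra.
- move=> x y p _ _ p01; rewrite /mixture.
  have h1 := conc (x + theta p) (y + theta p).
  have h2 := conc (x + theta (1 - p)) (y + theta (1 - p)).
  have e1 c : y + c - (x + c) = y - x by ring.
  rewrite !e1 in h1 h2.
  have := mix _ _ _ _ h1 h2; lra.
- move=> x p x0 p01; rewrite /mixture; apply/andP; split.
    by rewrite addr_ge0// mulr_ge0// ltW.
  have := mix _ _ _ _ (u1_ni _ _ (th0 _ _ x0 p01)) (u1_ni _ _ (th0 _ _ x0 (onem01 p01))).
  lra.
- move=> x y p q x0 y0 p01 q01; rewrite /mixture.
  have bound r s : 0 < r < 1 -> 0 < s < 1 -> `|s - r| = `|q - p| ->
      `|u1 (y + theta s) - u1 (x + theta r)| <=
      `|C0| * (1 + `|L|) * (`|y - x| + `|q - p|).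
    move=> r01 s01 rs; apply: (le_trans (u1L _ _ (th0 _ _ x0 r01) (th0 _ _ y0 s01))).
    rewrite -mulrA ler_wpM2l//.
    have -> : y + theta s - (x + theta r) = (y - x) + (theta s - theta r) by ring.
    apply: (le_trans (ler_normD _ _)).
    have h := theta_L _ _ r01 s01; rewrite rs in h.
    have : 0 <= `|L| * `|y - x| by rewrite mulr_ge0.
    have : 0 <= `|q - p| by [].
    lra.
  have b1 := bound p q p01 q01 erefl.
  have b2 : `|u1 (y + theta (1 - q)) - u1 (x + theta (1 - p))| <=
      `|C0| * (1 + `|L|) * (`|y - x| + `|q - p|).
    apply: bound; [exact: onem01|exact: onem01|].
    by rewrite -normrN; congr (`|_|); ring.
  have -> : (1 - alpha) * u1 (y + theta q) + alpha * u1 (y + theta (1 - q)) -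
      ((1 - alpha) * u1 (x + theta p) + alpha * u1 (x + theta (1 - p))) =
      (1 - alpha) * (u1 (y + theta q) - u1 (x + theta p)) +
      alpha * (u1 (y + theta (1 - q)) - u1 (x + theta (1 - p))) by ring.
  apply: (le_trans (ler_normD _ _)); rewrite !normrM (ger0_norm a0) (ger0_norm a1).
  have := mix _ _ _ _ b1 b2; lra.
(* The bound on total wealth: [B] plus the largest value that the Lipschitz claim can take. *)
- move=> B; have [c c0 Hc] := decr (B + (theta 0 + `|L|)); exists c => // x y p x0 xy yB p01.
  have dE r : 0 < r < 1 -> c * (y - x) <= u1 (x + theta r) - u1 (y + theta r).
    move=> r01; have tr := theta_le _ r01.
    have := Hc (x + theta r) (y + theta r).
    have -> : y + theta r - (x + theta r) = y - x by ring.
    by apply; lra.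
  rewrite /mixture; have := mix _ _ _ _ (dE _ p01) (dE _ (onem01 p01)); lra.
- move=> Q mQ _; rewrite /mixture; apply: measurable_funD; apply: measurable_funM => //.
    by apply: (measurableT_comp u_cont); exact: measurable_funD.
  by apply: (measurableT_comp u_cont); exact: measurable_funD.
- move=> Q mQ _; rewrite /mixture; apply: measurable_funD; apply: measurable_funM => //.
    by apply: (measurableT_comp u1_meas); exact: measurable_funD.
  by apply: (measurableT_comp u1_meas); exact: measurable_funD.
- by move=> p; rewrite mulr_ge0 ?(ltW lambda0)// qr_ge0.
- move=> p q p0 pq; rewrite le_eqVlt => /orP[/eqP ->|q1].
    (* At the right end the price is the quantile at 0, outside the range of the monotonicity
       hypothesis, and equals zero. *)
    by rewrite subrr qr0// mulr0 mulr_ge0 ?(ltW lambda0)// qr_ge0.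
  by rewrite ler_pM2l//; apply: qr_nd; lra.
- move=> a b aa bb.
  have [ab|ba] := leP a b; last by exists 0 => x y ax xy yb; lra.
  have [||| L' HL'] := @qr_lip (1 - b) (1 - a); [lra|lra|lra|].
  exists (lambda * L') => x y ax xy yb.
  rewrite -mulrBr normrM (gtr0_norm lambda0) -mulrA ler_pM2l// distrC.
  have -> : y - x = (1 - x) - (1 - y) by ring.
  by apply: HL'; lra.
- exact: pb01.
- exact: k_pb.
Qed.

End mixed_utility.

Section concave_instance.
Context {R : realType} {d : measure_display} {Omega : measurableType d}.
Context {P : probability Omega R} (rho vartheta : {RV P >-> R}).
Context (l : R) (F : cumulativeBounded (0 : R) l) (alpha lambda : R).
Set Implicit Arguments.
Unset Strict Implicit.

Hypothesis rhoC1 : continuously_derivable_on `]0, 1[ (rquantile rho).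
Hypothesis rho0 : quantile_rv rho 0 = 0%E.
Hypothesis rho1 : quantile_rv rho 1 = +oo%E.
Hypothesis theta_lip : [lipschitz (rquantile vartheta) p | p in `[0, 1]].
Hypothesis l0 : l != 0.
Hypothesis suppF : compactly_supported F.
Hypothesis alpha01 : 0 <= alpha <= 1.
Hypothesis lambda0 : 0 < lambda.

Local Notation u := (utility F).
Local Notation theta := (rquantile vartheta).
Local Notation k := (fun p => lambda * rquantile rho (1 - p)).

(** The infinite limit of the quantile at 1 makes the defining set nonempty, and the zero limit at 0
    keeps it away from 1. By monotonicity the set contains every positive point below its
    supremum. *)
Lemma pbar_bounds (U0 : R) : derive1 u (theta 0) = U0 -> 0 < U0 ->
  0 < pbar F rho vartheta lambda < 1 /\
  forall p, 0 < p -> p < pbar F rho vartheta lambda -> U0 <= k p.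
Proof.
move=> uE U00; rewrite /pbar uE; set S := [set p | _].
have [q0 /andP[q00 q01] Hq0] := rquantile_small rho0 (divr_gt0 U00 lambda0).
have [q1 /andP[q10 q11] Hq1] := rquantile_large rho1 (U0 / lambda).
have S1 : S (1 - q1).
  split; first by apply/andP; split; lra.
  have -> : 1 - (1 - q1) = q1 by ring.
  by rewrite mulrC -ler_pdivrMr// ltW.
have ubS : ubound S (1 - q0).
  move=> p [/andP[p0 p1] hp]; rewrite leNgt; apply/negP => pq.
  have : rquantile rho (1 - p) <= rquantile rho q0 by apply: rquantile_nondecreasing; lra.
  rewrite -(ler_pM2l lambda0) => h; move: Hq0; rewrite ltr_pdivlMr// mulrC; lra.
have hS : has_sup S by split; [exists (1 - q1)|exists (1 - q0)].
split.
  apply/andP; split.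
    by apply: (@lt_le_trans _ _ (1 - q1)); [lra|exact: sup_upper_bound hS _ S1].
  by apply: (@le_lt_trans _ _ (1 - q0)); [apply: ge_sup => //; exists (1 - q1)|lra].
move=> p p0 pS.
have e0 : 0 < sup S - p by rewrite subr_gt0.
have [q [/andP[q2 q3] hq]] := sup_adherent e0 hS.
have -> : sup S - (sup S - p) = p by ring.
move=> pq; apply: (le_trans hq); rewrite ler_pM2l//.
by apply: rquantile_nondecreasing; lra.
Qed.

Lemma utility_concave_problem : exists (v : R -> R -> R) U0 C M0,
  concave_problem (V F alpha vartheta) v k U0 C M0 (pbar F rho vartheta lambda) /\
  forall x p : R, is_derive x 1 (V F alpha vartheta ^~ p) (v x p).
Proof.
have [u1 [conc lip decr u_le0 u1_gt0]] := utility_derivative l0 suppF.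
have uD : derive1 u (theta 0) = u1 (theta 0).
  by rewrite derive1E; apply: derive_val; exact: concave_smooth_is_derive.
have [pb01 kpb] := pbar_bounds uD (u1_gt0 _).
have [C HC] := mixture_concave_problem conc lip decr u_le0 u1_gt0
  (@rquantile_nondecreasing _ _ _ _ vartheta) ((lipschitz_itvP _ _ _).1 theta_lip)
  alpha01 lambda0 (rquantile_ge0 rho0 rho1) (@rquantile_nondecreasing _ _ _ _ rho)
  (rquantile0 rho0) (fun a b => @continuously_derivable_lipschitz R _ a b rhoC1) pb01 kpb.
exists (mixture theta alpha u1), (u1 (theta 0)), C, (- u (theta 0)); split.
  exact: HC.
by move=> x p; exact: (mixture_is_derive conc lip theta alpha x p).
Qed.

End concave_instance.

(** Nonnegativity of the cost density lets the sign leave the integral even when the cost is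
    infinite. *)
Lemma lagrangian_cost {R : realType} (d : measure_display)
  (Omega : measurableType d) (P : probability Omega R) (rho vartheta : {RV P >-> R})
  (F : cumulative R R) (alpha lambda x : R) (v : R -> R -> R) (U0 C M0 pb : R)
  (Q : R -> R) :
  concave_problem (V F alpha vartheta) v (fun p => lambda * rquantile rho (1 - p)) U0 C M0 pb ->
  Qplus Q ->
  lagrangian F alpha rho vartheta lambda x Q = ((lambda * x)%R%:E -
    cost (V F alpha vartheta) (fun p => lambda * rquantile rho (1 - p))%R Q)%E.
Proof.
move=> cp hQ; rewrite /lagrangian addeC; congr (_ + _)%E.
rewrite /cost -integral_ge0N; last first.
  by move=> p /=; rewrite in_itv/= lee_fin => p01; exact: (cost_density_ge0 cp hQ p01).
apply: eq_integral => p _; rewrite -EFinN; congr (_%:E); rewrite /cost_density; ring.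
Qed.

Theorem theorem3p10 (R : realType) (d : measure_display)
  (Omega : measurableType d) (P : probability Omega R)
  (m : nat) (T : R) (W : 'I_m -> R -> Omega -> R)
  (r : R -> Omega -> R) (theta : 'I_m -> R -> Omega -> R)
  (I : R -> Omega -> R) (rho vartheta : {RV P >-> R})
  (l : R) (F : cumulativeBounded (0 : R) l) (alpha lambda x : R)
  (Q : R -> R) :
  pricing_kernel T W r theta I rho ->
  continuously_derivable_on `]0, 1[ (rquantile rho) ->
  quantile_rv rho 0 = 0%E ->
  quantile_rv rho 1 = +oo%E ->
  [lipschitz (rquantile vartheta) p | p in `[0, 1]] ->
  derivable_within `[0, 1] (rquantile vartheta) ->
  l != 0 ->
  compactly_supported F ->
  0 <= alpha <= 1 ->
  0 < lambda ->
  0 < x ->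
  optimal F alpha rho vartheta lambda x Q <->
  [/\ (forall p, 0 < p < 1 -> {for p, continuous Q}),
      (forall p q, 0 < p -> p <= q -> q < 1 -> Q p <= Q q) &
      exists H : R -> R, ode_solution F alpha rho vartheta lambda Q H].

Proof.
move=> _ rhoC1 rho0 rho1 theta_lip _ l0 suppF alpha01 lambda0 _.
have [v [U0 [C [M0 [cp dV]]]]] := utility_concave_problem
  rhoC1 rho0 rho1 theta_lip l0 suppF alpha01 lambda0.
set k := fun p => lambda * rquantile rho (1 - p) in cp.
set VV := V F alpha vartheta in cp dV.
have dVE p : dVdx F alpha vartheta (Q p) p = v (Q p) p.
  by rewrite /dVdx derive1E; apply: derive_val; exact: dV.
have etaE p : 0 < p -> - (lambda * Defs.eta rho p) = tail k p.
  move=> p0; rewrite /Defs.eta mulrN opprK /tail.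
  have -> : \int[lebesgue_measure]_(s in `[p, 1]) rquantile rho (1 - s) =
      \int[lebesgue_measure]_(s in `[p, 1]) (lambda^-1 * k s).
    by apply: eq_Rintegral => s _; rewrite /k mulKf// gt_eqF.
  rewrite RintegralZl//; last exact: (k_integrable1 cp p0).
  by rewrite mulVKf// gt_eqF.
have lagE Q' : Qplus Q' -> lagrangian F alpha rho vartheta lambda x Q' =
    ((lambda * x)%R%:E - cost VV k Q')%E.
  by move=> hQ'; exact: lagrangian_cost cp hQ'.
have optE : optimal F alpha rho vartheta lambda x Q <->
    Qplus Q /\ forall Q', Qplus Q' -> (cost VV k Q <= cost VV k Q')%E.
  (* The two functionals are made opaque, lest conversion unfold the integrals. *)
  rewrite /optimal; move: lagE.
  move: (lagrangian F alpha rho vartheta lambda x) (cost VV k) => L J lagE.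
  (* The constant [lambda * x] is finite, so it cancels even when a cost is infinite. *)
  have LJ Q1 Q2 : Qplus Q1 -> Qplus Q2 -> (L Q1 <= L Q2)%E = (J Q2 <= J Q1)%E.
    by move=> h1 h2; rewrite !lagE// leeD2lE// leeN2.
  split=> -[hQ opt]; (split; first exact: hQ).
    move=> Q' hQ'; rewrite -LJ// opt; apply: ereal_sup_ubound.
    by exists Q'.
  apply/eqP; rewrite eq_le; apply/andP; split.
    by apply: ereal_sup_ubound; exists Q.
  by apply: ge_ereal_sup => _ [Q' hQ' <-]; rewrite LJ//; exact: opt.
rewrite optE; split.
  move=> [hQ opt]; split.
  - by move=> p p01; exact: (optimal_continuous cp hQ opt p01).
  - by case: hQ.
  exists (dual v Q); split.
  - move=> a b a0 ab b1; have [K HK] := optimal_lipschitz cp hQ opt a0 ab b1.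
    apply: (@lipschitz_ac _ _ _ _ K) => s t sa st tb.
    by have /andP[h1 h2] := HK _ _ sa st tb; rewrite ger0_norm.
  - apply/lipschitz_itvP; exists U0 => s t _ st t1.
    exact: (dual_lipschitz cp hQ st t1).
  - have := optimal_derivable cp hQ opt; apply: ae_lebesgue_mono => p dQ p01.
    have dQp := dQ p01; split => //.
    + rewrite etaE; last by case/andP: p01.
      exact: (optimal_obstacle cp hQ opt p01 dQp).
    + by rewrite dVE; exact: (optimal_dual_derive cp hQ opt p01).
  - exact: dual1.
  - by move=> p ppb; exact: (optimal_zero cp hQ opt ppb).
move=> [Qcont Qnd [H [Qac /lipschitz_itvP[LH HL] ode H1 Qpb]]].
have hQ := ode_Qplus cp Qcont Qnd Qpb.
split; first exact: hQ.
move=> Q' hQ'.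
apply: (ode_cost_min cp Qcont Qnd Qac HL _ H1 Qpb hQ').
move: ode; apply: ae_lebesgue_mono => p ode p01; have [dQ mQ dH] := ode p01.
rewrite -dVE -etaE; last by case/andP: p01.
by split.
Qed.
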